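(* Let $A$ be a $\mathbb{K}$-algebra over a field $\mathbb{K}$, let $H$ be a (Schauenburg) Hopf algebroid over $A$, and let $B$ be a braided Hopf algebra (with structure maps $\Delta_B,\epsilon_B$, antipode $S_B$) in the lax left center of the monoidal category ${}_{H}\mathcal{M}$ of left $H$-modules, with $H$-action $\triangleright$ and coaction $b\mapsto b_{(-1)}\otimes_A b_{(0)}$. Then composing the Hopf monad $B\otimes_A-$ on ${}_{H}\mathcal{M}$ with the Hopf monad $H\boxtimes-$ on $A$-bimodules gives a Hopf monad on $A$-bimodules which corresponds to a (Schauenburg) Hopf algebroid structure over $A$ on $B\otimes_A H$, denoted $B\mathbin{\rtimes\!\cdot}H$, where $H$ carries the left $A$-action $a\cdot h=\eta(a)h$. Its $A^e$-bimodule structure is $a_1\overline{a_2}(b\otimes_A h)a_3\overline{a_4}=a_1b\otimes_A\overline{a_2}ha_3\overline{a_4}$, its unit is $1_B\otimes_A 1_H$, and $$(b\otimes_A h)(b'\otimes_A h')=b(h_{(1)}\triangleright b')\otimes_A h_{(2)}h',$$ $$(b\otimes_A h)_{(1)}\otimes_A(b\otimes_A h)_{(2)}=(b_{(1)}\otimes_A b_{(2)(-1)}h_{(1)})\otimes_A(b_{(2)(0)}\otimes_A h_{(2)}),$$ $$\epsilon(b\otimes_A h)=\epsilon_B(b)\epsilon_H(h).$$ The inverse of the left canonical map $\beta$ of $B\mathbin{\rtimes\!\cdot}H$ is given by $$(b\otimes_A h)_{(+)}\otimes_{A^{\mathrm{op}}}(b\otimes_A h)_{(-)}=(b_{(1)}\otimes_A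 b_{(2)(-1)}h_{(+)})\otimes_{A^{\mathrm{op}}}(S_B(b_{(2)(0)})\otimes_A h_{(-)}).$$
   Context: Write $A^{e}=A\otimes_{\mathbb{K}}A^{\mathrm{op}}$ with elements written $a\overline{b}$, $a\in A$, $\overline b\in A^{\mathrm{op}}$; $A$-bimodules are left $A^e$-modules ($a\overline b m=amb$). For an $A^e$-bimodule $D$, $|D$ denotes $D$ as an $A$-bimodule through its left $A^e$-action; unless decorated, $\otimes_A$ of copies of $D$ is that of $|D$. The functor $D\boxtimes-$ on $A$-bimodules is $D\otimes_{A^e}-$. A left $A$-bialgebroid is an $A^e$-bimodule $D$ with: a $\mathbb{K}$-algebra structure and an algebra map $\eta:A^e\to D$ inducing the bimodule structure by multiplication; $A$-bimodule maps $\Delta:|D\to|D\otimes_A|D$, $d\mapsto d_{(1)}\otimes_A d_{(2)}$, and $\epsilon:|D\to A$ making $|D$ a comonoid in $A$-bimodules, with $\Delta(dr\overline s)=d_{(1)}r\otimes_A d_{(2)}\overline s$ and $\epsilon(dr)=\epsilon(d\overline r)$ for $r,s\in A$; and $\Delta(dd')=d_{(1)}d'_{(1)}\otimes_A d_{(2)}d'_{(2)}$, $\Delta(1)=1\otimes_A 1$, $\epsilon(1)=1$, $\epsilon(dd')=\epsilon(d\,\epsilon(d'))=\epsilon(d\,\overline{\epsilon(d')})$. Its left and right canonical maps are $\beta:D\otimes_{A^{\mathrm{op}}}D\to D\diamond D$, $d\otimes d'\mapsto d_{(1)}\diamond d_{(2)}d'$, and $\vartheta:D\odot D\to D\diamond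 D$, $d\odot d'\mapsto d_{(1)}d'\diamond d_{(2)}$, where $D\otimes_{A^{\mathrm{op}}}D$, $D\odot D$, $D\diamond D$ are the quotients of $D\otimes_{\mathbb{K}}D$ by the relations $d\overline s\otimes d'=d\otimes\overline s d'$, $dr\otimes d'=d\otimes rd'$, $\overline s d\otimes d'=d\otimes sd'$ respectively. $D$ is a (Schauenburg) Hopf algebroid if $\beta$ and $\vartheta$ are both invertible; one writes $\beta^{-1}(d\diamond 1)=d_{(+)}\otimes_{A^{\mathrm{op}}}d_{(-)}$. Bialgebroid structures on $D$ correspond to bimonad structures on $D\boxtimes-$, and $D$ is a Hopf algebroid exactly when $D\boxtimes-$ is a Hopf monad, i.e. when its left and right fusion operators $(\mathrm{id}\otimes\mu)T_2$ and $(\mu\otimes\mathrm{id})T_2$ are invertible ($\mu$ the multiplication and $T_2$ the comonoidal structure of the bimonad). The category ${}_{H}\mathcal{M}$ is monoidal: an $H$-module is an $A$-bimodule via $\eta$, the tensor product is $\otimes_A$ with action $h\triangleright(m\otimes n)=h_{(1)}m\otimes_A h_{(2)}n$, and the unit is $A$. An object of its lax left center is an $H$-module $B$ with a (not necessarily invertible) natural transformation of $H$-modules $\tau_M:B\otimes_A M\to M\otimes_A B$ satisfying $\tau_{M\otimes N}=(\mathrm{id}_M\otimes\tau_N)(\tau_M\otimes\mathrm{id}_N)$, $\tau_A=\mathrm{id}$; morphisms are $H$-linear maps compatible with the $\tau$'s; the tensor product of $(B,\tau),(B',\tau')$ is $(B\otimes_A B',(\tau\otimes\mathrm{id})(\mathrm{id}\otimes\tau'))$,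 and $\tau_{B'}$ is a lax braiding. The coaction is $b_{(-1)}\otimes_A b_{(0)}:=\tau_H(b\otimes_A 1_H)\in|H\otimes_A B$, so that $\tau_M(b\otimes m)=b_{(-1)}m\otimes_A b_{(0)}$; this makes $B$ a Yetter-Drinfeld module over $H$. A braided Hopf algebra in this category is an object with monoid and comonoid structures consisting of morphisms of the category, with $\Delta_B$, $\epsilon_B$ algebra maps with respect to the lax braiding ($(m\otimes m)(\mathrm{id}\otimes\tau_B\otimes\mathrm{id})(\Delta_B\otimes\Delta_B)=\Delta_B m$, etc.), and an antipode $S_B$ (a morphism of the category) with $m(\mathrm{id}\otimes S_B)\Delta_B=1_B\epsilon_B=m(S_B\otimes\mathrm{id})\Delta_B$. Notation: $\Delta_B(b)=b_{(1)}\otimes_A b_{(2)}$, and $b_{(2)(-1)}\otimes_A b_{(2)(0)}$ is the coaction applied to $b_{(2)}$. The composed monad is the cross product $U(B\otimes_A-)F$, where $F=H\boxtimes-$ is the free $H$-module functor from $A$-bimodules to ${}_{H}\mathcal{M}$ and $U$ the forgetful functor; on objects it is $M\mapsto B\otimes_A(H\boxtimes M)$.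
   Formalization: The printed inverse of β fails (Sweedler's algebra); proved is (b_(1)⊗(b_(2)(-1)h)_(+))⊗(1_B⊗(b_(2)(-1)h)_(-))(S_B(b_(2)(0))⊗1_H). Invertibility of ϑ and right fusion operators is proved assuming B⊗_A- is a Hopf monad; it fails for some non-bijective S_B. *)

(* Defs.v *)
From HB Require Import structures.
From mathcomp Require Import all_boot all_order all_algebra.
From mathcomp Require Import generic_quotient boolp.

Set Implicit Arguments.
Unset Strict Implicit.
Unset Printing Implicit Defensive.

Import GRing.Theory.
Local Open Scope ring_scope.
Local Open Scope quotient_scope.

Section LinearMaps.
Variables (R : pzRingType) (M N : lmodType R).

Definition mklin (f : M -> N) (hf : linear f) : {linear M -> N} :=
  HB.pack f (GRing.isLinear.Build R M N *:%R f hf).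

Lemma linext (f g : {linear M -> N}) : (forall x, f x = g x) -> f = g.
Proof.
case: f g => [f [[f1] [f2]]] [g [[g1] [g2]]] /= fg.
have e : f = g by apply: functional_extensionality_dep.
subst g; congr (GRing.Linear.Pack _).
by rewrite (Prop_irrelevance f1 g1) (Prop_irrelevance f2 g2).
Qed.
End LinearMaps.

(* [tens r l] is the abelian group generated by symbols m (x) n, additive in m *)
(* and in n, modulo r i m (x) n = m (x) l i n.  In every use below the actions  *)
(* of I include those of the ground field K, so that this is also the quotient  *)
(* of the tensor product over K by these relations.  A sequence of pairs stands *)
(* for the sum of the corresponding pure tensors.                               *)
Section Tensor.
Variables (I : Type) (M N : zmodType) (r : I -> M -> M) (l : I -> N -> N).

Inductive tens_eq : seq (M * N) -> seq (M * N) -> Prop :=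
| TensRefl s : tens_eq s s
| TensSym s t : tens_eq s t -> tens_eq t s
| TensTrans s t u : tens_eq s t -> tens_eq t u -> tens_eq s u
| TensCat s s' t t' : tens_eq s s' -> tens_eq t t' -> tens_eq (s ++ t) (s' ++ t')
| TensComm s t : tens_eq (s ++ t) (t ++ s)
| TensZero n : tens_eq [:: (0, n)] [::]
| TensDl m m' n : tens_eq [:: (m + m', n)] [:: (m, n); (m', n)]
| TensDr m n n' : tens_eq [:: (m, n + n')] [:: (m, n); (m, n')]
| TensBal i m n : tens_eq [:: (r i m, n)] [:: (m, l i n)].

Definition tens_eqb (s t : seq (M * N)) : bool := `[< tens_eq s t >].

Lemma tens_eqb_refl : reflexive tens_eqb.
Proof. by move=> s; apply/asboolP; apply: TensRefl. Qed.
Lemma tens_eqb_sym : symmetric tens_eqb.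
Proof. by move=> s t; apply/asboolP/asboolP; apply: TensSym. Qed.
Lemma tens_eqb_trans : transitive tens_eqb.
Proof.
move=> t s u /asboolP st /asboolP tu; apply/asboolP; exact: TensTrans st tu.
Qed.

Canonical tens_equiv := EquivRel tens_eqb tens_eqb_refl tens_eqb_sym tens_eqb_trans.

Definition tens : Type := {eq_quot tens_equiv}.
HB.instance Definition _ := Choice.on tens.
HB.instance Definition _ := EqQuotient.on tens.

Definition tens_cls (s : seq (M * N)) : tens := \pi_tens s.

Lemma tens_clsP s t : tens_cls s = tens_cls t <-> tens_eq s t.
Proof. by split=> [/eqmodP/asboolP //|st]; apply/eqmodP/asboolP. Qed.

Lemma tens_clsK t : tens_cls (repr t) = t.
Proof. exact: reprK. Qed.

Definition tens_opp_seq (s : seq (M * N)) := [seq (- p.1, p.2) | p <- s].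

Let tzero : tens := tens_cls [::].
Let tadd (x y : tens) : tens := tens_cls (repr x ++ repr y).
Let topp (x : tens) : tens := tens_cls (tens_opp_seq (repr x)).

Let taddE s t : tadd (tens_cls s) (tens_cls t) = tens_cls (s ++ t).
Proof. by apply/tens_clsP; apply: TensCat; apply/tens_clsP; rewrite tens_clsK. Qed.

Let taddA : associative tadd.
Proof.
move=> x y z; rewrite -(tens_clsK x) -(tens_clsK y) -(tens_clsK z).
by rewrite !taddE catA.
Qed.
Let taddC : commutative tadd.
Proof.
move=> x y; rewrite -(tens_clsK x) -(tens_clsK y) !taddE.
by apply/tens_clsP; apply: TensComm.
Qed.
Let tadd0 : left_id tzero tadd.
Proof. by move=> x; rewrite -(tens_clsK x) taddE. Qed.
Let taddN : left_inverse tzero topp tadd.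
Proof.
move=> x; rewrite /topp -{2}(tens_clsK x) taddE; apply/tens_clsP.
elim: (repr x) => [|[m n] s IH] /=; first exact: TensRefl.
have h : tens_eq ([:: (- m, n)] ++ [:: (m, n)]) [::].
  apply: (TensTrans (t := [:: (- m + m, n)])); first by apply: TensSym; apply: TensDl.
  by rewrite addNr; apply: TensZero.
rewrite -cat1s -[(m, n) :: s]cat1s.
apply: (TensTrans (t := ([:: (- m, n)] ++ [:: (m, n)]) ++ (tens_opp_seq s ++ s))); last first.
  by rewrite -[[::]]/([::] ++ [::]); apply: TensCat.
rewrite -!catA; apply: TensCat; first exact: TensRefl.
rewrite !catA; apply: TensCat; [exact: TensComm|exact: TensRefl].
Qed.

HB.instance Definition _ := GRing.isZmodule.Build tens taddA taddC tadd0 taddN.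

Definition pure (m : M) (n : N) : tens := tens_cls [:: (m, n)].

Lemma tens_clsE s : tens_cls s = \sum_(p <- s) pure p.1 p.2.
Proof.
elim: s => [|[m n] s IH]; first by rewrite big_nil.
by rewrite big_cons -IH -cat1s -taddE.
Qed.

Lemma tens_sum t : t = \sum_(p <- repr t) pure p.1 p.2.
Proof. by rewrite -tens_clsE tens_clsK. Qed.

Lemma pureDl m m' n : pure (m + m') n = pure m n + pure m' n.
Proof.
by rewrite [RHS](taddE [:: _] [:: _]); apply/tens_clsP; apply: TensDl.
Qed.
Lemma pureDr m n n' : pure m (n + n') = pure m n + pure m n'.
Proof.
by rewrite [RHS](taddE [:: _] [:: _]); apply/tens_clsP; apply: TensDr.
Qed.
Lemma pure_bal i m n : pure (r i m) n = pure m (l i n).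
Proof. by apply/tens_clsP; apply: TensBal. Qed.

Lemma pure0l n : pure 0 n = 0.
Proof. by apply: (@addrI _ (pure 0 n)); rewrite -pureDl !addr0. Qed.
Lemma pure0r m : pure m 0 = 0.
Proof. by apply: (@addrI _ (pure m 0)); rewrite -pureDr !addr0. Qed.
Lemma pureNl m n : pure (- m) n = - pure m n.
Proof. by apply: (@addrI _ (pure m n)); rewrite -pureDl !subrr pure0l. Qed.
Lemma pureNr m n : pure m (- n) = - pure m n.
Proof. by apply: (@addrI _ (pure m n)); rewrite -pureDr !subrr pure0r. Qed.

Lemma tens_ind (P : tens -> Prop) :
  P 0 -> (forall x y, P x -> P y -> P (x + y)) -> (forall m n, P (pure m n)) ->
  forall t, P t.
Proof.
move=> P0 PD Pp t; rewrite (tens_sum t).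
by elim: (repr t) => [|p s IH]; rewrite ?big_nil // big_cons; apply: PD.
Qed.

Section Lift.
Variable P : zmodType.

Definition balanced (f : M -> N -> P) : Prop :=
  [/\ forall m m' n, f (m + m') n = f m n + f m' n,
      forall m n n', f m (n + n') = f m n + f m n' &
      forall i m n, f (r i m) n = f m (l i n)].

Variables (f : M -> N -> P) (hf : balanced f).

Definition tlift of balanced f := fun t : tens => \sum_(p <- repr t) f p.1 p.2.

Lemma tlift_seq s : tlift hf (tens_cls s) = \sum_(p <- s) f p.1 p.2.
Proof.
case: hf => fDl fDr fb.
have f0 n : f 0 n = 0 by apply: (@addrI _ (f 0 n)); rewrite -fDl !addr0.
have e s' t : tens_eq s' t -> \sum_(p <- s') f p.1 p.2 = \sum_(p <- t) f p.1 p.2.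
  elim=> {s s' t}; rewrite ?big_seq1 //=.
  - by move=> s t u _ -> _ ->.
  - by move=> s s' t t' _ IH _ IH'; rewrite !big_cat /= IH IH'.
  - by move=> s t; rewrite !big_cat /= addrC.
  - by move=> n; rewrite big_seq1 big_nil f0.
  - by move=> m m' n; rewrite !big_cons big_nil /= fDl !addr0.
  - by move=> m n n'; rewrite !big_cons big_nil /= fDr !addr0.
  - by move=> i m n; rewrite !big_seq1 fb.
by apply: e; apply/tens_clsP; rewrite tens_clsK.
Qed.

Lemma tlift_pure m n : tlift hf (pure m n) = f m n.
Proof. by rewrite /pure tlift_seq big_seq1. Qed.

Let tliftD : {morph tlift hf : x y / x + y}.
Proof.
move=> x y; rewrite -(tens_clsK x) -(tens_clsK y) -[_ + _]/(tadd _ _) taddE.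
by rewrite !tlift_seq big_cat.
Qed.
Let tlift_zmod : zmod_morphism (tlift hf).
Proof.
move=> x y; apply: (@addIr _ (tlift hf y)); rewrite -tliftD.
by rewrite -!addrA !addNr !addr0.
Qed.
HB.instance Definition _ := GRing.isZmodMorphism.Build tens P (tlift hf) tlift_zmod.
End Lift.

Lemma tens_ext (P : zmodType) (f g : {additive tens -> P}) :
  (forall m n, f (pure m n) = g (pure m n)) -> forall t, f t = g t.
Proof.
move=> fg; elim/tens_ind => [|x y hx hy|//]; rewrite ?raddf0 //.
by rewrite !raddfD hx hy.
Qed.
End Tensor.

Arguments tlift {I M N r l P f} hf.
Arguments tens : simpl never.

Record category := Category {
  ob :> Type;
  mor : ob -> ob -> Type;
  idm : forall X, mor X X;
  compm : forall X Y Z, mor Y Z -> mor X Y -> mor X Z;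
  comp1m : forall X Y (f : mor X Y), compm (idm Y) f = f;
  compm1 : forall X Y (f : mor X Y), compm f (idm X) = f;
  compmA : forall X Y Z W (h : mor Z W) (g : mor Y Z) (f : mor X Y),
    compm h (compm g f) = compm (compm h g) f
}.
Arguments mor {c} _ _.
Arguments idm {c} _.
Arguments compm {c X Y Z} _ _.

Declare Scope cat_scope.
Delimit Scope cat_scope with cat.
Local Open Scope cat_scope.
Notation "g ∘ f" := (compm g f) (at level 40, left associativity) : cat_scope.

Definition is_iso (C : category) (X Y : C) (f : mor X Y) : Prop :=
  exists g : mor Y X, g ∘ f = idm X /\ f ∘ g = idm Y.

Record monoidal := Monoidal {
  mcat :> category;
  tob : mcat -> mcat -> mcat;
  tmor : forall X X' Y Y' : mcat,
    mor X X' -> mor Y Y' -> mor (tob X Y) (tob X' Y');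
  munit : mcat;
  asc : forall X Y Z, mor (tob (tob X Y) Z) (tob X (tob Y Z));
  asci : forall X Y Z, mor (tob X (tob Y Z)) (tob (tob X Y) Z);
  lun : forall X, mor (tob munit X) X;
  luni : forall X, mor X (tob munit X);
  run : forall X, mor (tob X munit) X;
  runi : forall X, mor X (tob X munit);
  tmor1 : forall X Y, tmor (idm X) (idm Y) = idm (tob X Y);
  tmor_comp : forall X X' X'' Y Y' Y'' (f' : mor X' X'') (f : mor X X')
    (g' : mor Y' Y'') (g : mor Y Y'),
    tmor (f' ∘ f) (g' ∘ g) = tmor f' g' ∘ tmor f g;
  ascK : forall X Y Z, asci X Y Z ∘ asc X Y Z = idm _;
  asciK : forall X Y Z, asc X Y Z ∘ asci X Y Z = idm _;
  lunK : forall X, luni X ∘ lun X = idm _;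
  luniK : forall X, lun X ∘ luni X = idm _;
  runK : forall X, runi X ∘ run X = idm _;
  runiK : forall X, run X ∘ runi X = idm _;
  asc_nat : forall X X' Y Y' Z Z' (f : mor X X') (g : mor Y Y') (h : mor Z Z'),
    tmor f (tmor g h) ∘ asc X Y Z = asc X' Y' Z' ∘ tmor (tmor f g) h;
  lun_nat : forall X Y (f : mor X Y), f ∘ lun X = lun Y ∘ tmor (idm munit) f;
  run_nat : forall X Y (f : mor X Y), f ∘ run X = run Y ∘ tmor f (idm munit);
  triangle : forall X Y,
    tmor (idm X) (lun Y) ∘ asc X munit Y = tmor (run X) (idm Y);
  pentagon : forall X Y Z W,
    asc X Y (tob Z W) ∘ asc (tob X Y) Z W =
    tmor (idm X) (asc Y Z W) ∘ asc X (tob Y Z) W ∘ tmor (asc X Y Z) (idm W)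
}.
Arguments tob {m} _ _.
Arguments tmor {m X X' Y Y'} _ _.
Arguments munit {m}.
Arguments asc {m} _ _ _.
Arguments asci {m} _ _ _.
Arguments lun {m} _.
Arguments luni {m} _.
Arguments run {m} _.
Arguments runi {m} _.
Notation "X ⊗ Y" := (tob X Y) (at level 35, right associativity) : cat_scope.
Notation "f ⊗₁ g" := (tmor f g) (at level 35, right associativity) : cat_scope.
Notation "𝟙" := munit : cat_scope.

Section MonoidsComonoids.
Variable C : monoidal.

Definition is_monoid (X : C) (m : mor (X ⊗ X) X) (u : mor 𝟙 X) : Prop :=
  [/\ m ∘ (m ⊗₁ idm X) = m ∘ (idm X ⊗₁ m) ∘ asc X X X,
      m ∘ (u ⊗₁ idm X) = lun X &
      m ∘ (idm X ⊗₁ u) = run X].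

Definition is_comonoid (X : C) (d : mor X (X ⊗ X)) (e : mor X 𝟙) : Prop :=
  [/\ asc X X X ∘ (d ⊗₁ idm X) ∘ d = (idm X ⊗₁ d) ∘ d,
      lun X ∘ (e ⊗₁ idm X) ∘ d = idm X &
      run X ∘ (idm X ⊗₁ e) ∘ d = idm X].
End MonoidsComonoids.

Section LaxCenter.
Variable C : monoidal.

Definition half_braiding (X : C) := forall M : C, mor (X ⊗ M) (M ⊗ X).

Definition unit_braiding : half_braiding 𝟙 := fun M => runi M ∘ lun M.

Definition tensor_braiding (X Y : C) (s : half_braiding X) (t : half_braiding Y) :
    half_braiding (X ⊗ Y) := fun M =>
  asc M X Y ∘ (s M ⊗₁ idm Y) ∘ asci X M Y ∘ (idm X ⊗₁ t M) ∘ asc X Y M.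

Definition is_lax_half_braiding (X : C) (t : half_braiding X) : Prop :=
  [/\ forall M N (f : mor M N), t N ∘ (idm X ⊗₁ f) = (f ⊗₁ idm X) ∘ t M,
      forall M N, t (M ⊗ N) =
        asci M N X ∘ (idm M ⊗₁ t N) ∘ asc M X N ∘ (t M ⊗₁ idm N) ∘ asci X M N &
      t 𝟙 = luni X ∘ run X].

Definition central_mor (X Y : C) (s : half_braiding X) (t : half_braiding Y)
  (f : mor X Y) : Prop :=
  forall M, (idm M ⊗₁ f) ∘ s M = t M ∘ (f ⊗₁ idm M).

(* the middle exchange (id (x) t (x) id) *)
Definition exchange (X : C) (t : half_braiding X) (W M Y : C) :
    mor ((W ⊗ X) ⊗ (M ⊗ Y)) ((W ⊗ M) ⊗ (X ⊗ Y)) :=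
  asci W M (X ⊗ Y) ∘ (idm W ⊗₁ (asc M X Y ∘ (t M ⊗₁ idm Y) ∘ asci X M Y))
    ∘ asc W X (M ⊗ Y).

Record lax_central_hopf := LaxCentralHopf {
  lh_ob : C;
  lh_tau : half_braiding lh_ob;
  lh_mul : mor (lh_ob ⊗ lh_ob) lh_ob;
  lh_one : mor 𝟙 lh_ob;
  lh_comul : mor lh_ob (lh_ob ⊗ lh_ob);
  lh_counit : mor lh_ob 𝟙;
  lh_antipode : mor lh_ob lh_ob;
  lh_tauP : is_lax_half_braiding lh_tau;
  lh_mul_central : central_mor (tensor_braiding lh_tau lh_tau) lh_tau lh_mul;
  lh_one_central : central_mor unit_braiding lh_tau lh_one;
  lh_comul_central : central_mor lh_tau (tensor_braiding lh_tau lh_tau) lh_comul;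
  lh_counit_central : central_mor lh_tau unit_braiding lh_counit;
  lh_antipode_central : central_mor lh_tau lh_tau lh_antipode;
  lh_monoid : is_monoid lh_mul lh_one;
  lh_comonoid : is_comonoid lh_comul lh_counit;
  lh_comul_mul : lh_comul ∘ lh_mul =
    (lh_mul ⊗₁ lh_mul) ∘ exchange lh_tau lh_ob lh_ob lh_ob ∘ (lh_comul ⊗₁ lh_comul);
  lh_comul_one : lh_comul ∘ lh_one = (lh_one ⊗₁ lh_one) ∘ luni 𝟙;
  lh_counit_mul : lh_counit ∘ lh_mul = lun 𝟙 ∘ (lh_counit ⊗₁ lh_counit);
  lh_counit_one : lh_counit ∘ lh_one = idm 𝟙;
  lh_antipode_l : lh_mul ∘ (idm lh_ob ⊗₁ lh_antipode) ∘ lh_comul = lh_one ∘ lh_counit;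
  lh_antipode_r : lh_mul ∘ (lh_antipode ⊗₁ idm lh_ob) ∘ lh_comul = lh_one ∘ lh_counit
}.
End LaxCenter.

Section Bimonads.
Variable C : monoidal.

Record bimonad_data := BimonadData {
  bm_ob :> C -> C;
  bm_mor : forall X Y : C, mor X Y -> mor (bm_ob X) (bm_ob Y);
  bm_mu : forall X, mor (bm_ob (bm_ob X)) (bm_ob X);
  bm_eta : forall X, mor X (bm_ob X);
  bm_T2 : forall X Y, mor (bm_ob (X ⊗ Y)) (bm_ob X ⊗ bm_ob Y);
  bm_T0 : mor (bm_ob 𝟙) 𝟙
}.

Definition is_monad (T : bimonad_data) : Prop :=
  (forall X, bm_mor T (idm X) = idm (T X)) /\
  (forall X Y Z (g : mor Y Z) (f : mor X Y),
     bm_mor T (g ∘ f) = bm_mor T g ∘ bm_mor T f) /\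
  (forall X Y (f : mor X Y),
     bm_mor T f ∘ bm_mu T X = bm_mu T Y ∘ bm_mor T (bm_mor T f)) /\
  (forall X Y (f : mor X Y), bm_mor T f ∘ bm_eta T X = bm_eta T Y ∘ f) /\
  (forall X, bm_mu T X ∘ bm_mor T (bm_mu T X) = bm_mu T X ∘ bm_mu T (T X)) /\
  (forall X, bm_mu T X ∘ bm_mor T (bm_eta T X) = idm (T X)) /\
  (forall X, bm_mu T X ∘ bm_eta T (T X) = idm (T X)).

Definition is_comonoidal (T : bimonad_data) : Prop :=
  (forall X X' Y Y' (f : mor X X') (g : mor Y Y'),
     bm_T2 T X' Y' ∘ bm_mor T (f ⊗₁ g) = (bm_mor T f ⊗₁ bm_mor T g) ∘ bm_T2 T X Y) /\
  (forall X Y Z,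
     asc (T X) (T Y) (T Z) ∘ (bm_T2 T X Y ⊗₁ idm (T Z)) ∘ bm_T2 T (X ⊗ Y) Z =
     (idm (T X) ⊗₁ bm_T2 T Y Z) ∘ bm_T2 T X (Y ⊗ Z) ∘ bm_mor T (asc X Y Z)) /\
  (forall X, lun (T X) ∘ (bm_T0 T ⊗₁ idm (T X)) ∘ bm_T2 T 𝟙 X = bm_mor T (lun X)) /\
  (forall X, run (T X) ∘ (idm (T X) ⊗₁ bm_T0 T) ∘ bm_T2 T X 𝟙 = bm_mor T (run X)).

Definition is_bimonad (T : bimonad_data) : Prop :=
  is_monad T /\ is_comonoidal T /\
  (forall X Y, bm_T2 T X Y ∘ bm_mu T (X ⊗ Y) =
     (bm_mu T X ⊗₁ bm_mu T Y) ∘ bm_T2 T (T X) (T Y) ∘ bm_mor T (bm_T2 T X Y)) /\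
  bm_T0 T ∘ bm_mu T 𝟙 = bm_T0 T ∘ bm_mor T (bm_T0 T) /\
  (forall X Y, bm_T2 T X Y ∘ bm_eta T (X ⊗ Y) = bm_eta T X ⊗₁ bm_eta T Y) /\
  bm_T0 T ∘ bm_eta T 𝟙 = idm 𝟙.

Definition left_fusion (T : bimonad_data) (X Y : C) : mor (T (X ⊗ T Y)) (T X ⊗ T Y) :=
  (idm (T X) ⊗₁ bm_mu T Y) ∘ bm_T2 T X (T Y).

Definition right_fusion (T : bimonad_data) (X Y : C) : mor (T (T X ⊗ Y)) (T X ⊗ T Y) :=
  (bm_mu T X ⊗₁ idm (T Y)) ∘ bm_T2 T (T X) Y.

Definition left_hopf_monad (T : bimonad_data) : Prop :=
  is_bimonad T /\ forall X Y, is_iso (left_fusion T X Y).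

Definition hopf_monad (T : bimonad_data) : Prop :=
  [/\ is_bimonad T, forall X Y, is_iso (left_fusion T X Y) &
      forall X Y, is_iso (right_fusion T X Y)].

Definition bimonad_iso (S T : bimonad_data) (t : forall X, mor (S X) (T X)) : Prop :=
  (forall X, is_iso (t X)) /\
  (forall X Y (f : mor X Y), t Y ∘ bm_mor S f = bm_mor T f ∘ t X) /\
  (forall X, t X ∘ bm_mu S X = bm_mu T X ∘ bm_mor T (t X) ∘ t (S X)) /\
  (forall X, t X ∘ bm_eta S X = bm_eta T X) /\
  (forall X Y, bm_T2 T X Y ∘ t (X ⊗ Y) = (t X ⊗₁ t Y) ∘ bm_T2 S X Y) /\
  bm_T0 T ∘ t 𝟙 = bm_T0 S.

Definition id_bimonad : bimonad_data :=
  @BimonadData (fun X => X) (fun X Y f => f) (fun X => idm X) (fun X => idm X)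
    (fun X Y => idm (X ⊗ Y)) (idm 𝟙).

(* the bimonad B (x) - of a bialgebra B in the lax center *)
Definition tensor_bimonad (B : lax_central_hopf C) : bimonad_data :=
  @BimonadData (fun X => lh_ob B ⊗ X)
    (fun X Y f => idm (lh_ob B) ⊗₁ f)
    (fun X => (lh_mul B ⊗₁ idm X) ∘ asci (lh_ob B) (lh_ob B) X)
    (fun X => (lh_one B ⊗₁ idm X) ∘ luni X)
    (fun X Y => exchange (lh_tau B) (lh_ob B) X Y
                  ∘ (lh_comul B ⊗₁ idm (X ⊗ Y)))
    (lh_counit B ∘ run (lh_ob B)).
End Bimonads.

(* The data of an adjunction [F -| U] with [F] and [U] comonoidal. *)
Record comonoidal_adjunction_data (C D : monoidal) := ComonoidalAdjunctionData {
  adj_F : C -> D;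
  adj_Fmor : forall X Y : C, mor X Y -> mor (adj_F X) (adj_F Y);
  adj_U : D -> C;
  adj_Umor : forall X Y : D, mor X Y -> mor (adj_U X) (adj_U Y);
  adj_unit : forall X : C, mor X (adj_U (adj_F X));
  adj_counit : forall Y : D, mor (adj_F (adj_U Y)) Y;
  adj_F2 : forall X Y : C, mor (adj_F (X ⊗ Y)) (adj_F X ⊗ adj_F Y);
  adj_F0 : mor (adj_F 𝟙) 𝟙;
  adj_U2 : forall X Y : D, mor (adj_U (X ⊗ Y)) (adj_U X ⊗ adj_U Y);
  adj_U0 : mor (adj_U 𝟙) 𝟙
}.

(* the cross product U Q F of a bimonad Q on D with the bimonad U F on C *)
Definition cross_product (C D : monoidal) (a : comonoidal_adjunction_data C D)
    (Q : bimonad_data D) : bimonad_data C :=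
  @BimonadData C (fun X => adj_U a (Q (adj_F a X)))
    (fun X Y f => adj_Umor a (bm_mor Q (adj_Fmor a f)))
    (fun X => adj_Umor a (bm_mu Q (adj_F a X)
                ∘ bm_mor Q (adj_counit a (Q (adj_F a X)))))
    (fun X => adj_Umor a (bm_eta Q (adj_F a X)) ∘ adj_unit a X)
    (fun X Y => adj_U2 a (Q (adj_F a X)) (Q (adj_F a Y))
                ∘ adj_Umor a (bm_T2 Q (adj_F a X) (adj_F a Y)
                              ∘ bm_mor Q (adj_F2 a X Y)))
    (adj_U0 a ∘ adj_Umor a (bm_T0 Q ∘ bm_mor Q (adj_F0 a))).

Section EnvelopingAlgebra.
Variables (K : fieldType) (A : algType K).

Definition env : Type := tens (fun (k : K) (a : A) => k *: a) (fun (k : K) (b : A) => k *: b).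
HB.instance Definition _ := GRing.Zmodule.on env.

(* the element [a \overline{b}] of A^e *)
Definition envp (a b : A) : env := pure _ _ a b.

Lemma envpDl a a' b : envp (a + a') b = envp a b + envp a' b.
Proof. exact: pureDl. Qed.
Lemma envpDr a b b' : envp a (b + b') = envp a b + envp a b'.
Proof. exact: pureDr. Qed.
Lemma envpZ k a b : envp (k *: a) b = envp a (k *: b).
Proof. exact: pure_bal. Qed.

Let mul1 (a b : A) : A -> A -> env := fun a' b' => envp (a * a') (b' * b).
Let mul1_bal a b : balanced (fun (k : K) (a : A) => k *: a) (fun (k : K) (b : A) => k *: b) (mul1 a b).
Proof.
split=> *; rewrite /mul1 ?mulrDr ?mulrDl ?envpDl ?envpDr //.
by rewrite -scalerAr -scalerAl envpZ.
Qed.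
Let mul2 (y : env) : A -> A -> env := fun a b => tlift (mul1_bal a b) y.
Let mul2_bal y : balanced (fun (k : K) (a : A) => k *: a) (fun (k : K) (b : A) => k *: b) (mul2 y).
Proof.
split=> [a a' b|a b b'|k a b]; rewrite /mul2; elim/tens_ind: y => [|x y hx hy|c d];
  rewrite ?raddf0 ?addr0 // ?raddfD /= ?hx ?hy ?tlift_pure /mul1.
- by rewrite addrACA.
- by rewrite mulrDl envpDl.
- by rewrite addrACA.
- by rewrite mulrDr envpDr.
- by [].
- by rewrite -scalerAl -scalerAr envpZ.
Qed.
Definition env_mul (x y : env) : env := tlift (mul2_bal y) x.

Let env_mulp a b a' b' : env_mul (envp a b) (envp a' b') = envp (a * a') (b' * b).
Proof. by rewrite /env_mul tlift_pure /mul2 tlift_pure. Qed.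

Let env_mulDl : left_distributive env_mul +%R.
Proof. by move=> x y z; rewrite /env_mul raddfD. Qed.
Let env_mulDr : right_distributive env_mul +%R.
Proof.
move=> x y z; elim/tens_ind: x => [|x x' hx hx'|a b]; rewrite /env_mul.
- by rewrite !raddf0 addr0.
- by rewrite !raddfD /= addrACA; congr (_ + _).
- by rewrite !tlift_pure /mul2 raddfD.
Qed.
Let env_mul0l y : env_mul 0 y = 0.
Proof. by rewrite /env_mul raddf0. Qed.
Let env_mul0r x : env_mul x 0 = 0.
Proof. by apply: (@addrI _ (env_mul x 0)); rewrite -env_mulDr !addr0. Qed.

Let env_mulA : associative env_mul.
Proof.
elim/tens_ind=> [|x x' hx hx'|a b] y z.
- by rewrite !env_mul0l.
- by rewrite !env_mulDl hx hx'.
elim/tens_ind: y => [|y y' hy hy'|a' b'].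
- by rewrite !(env_mul0l, env_mul0r).
- by rewrite !(env_mulDl, env_mulDr) hy hy'.
elim/tens_ind: z => [|z z' hz hz'|a'' b''].
- by rewrite !env_mul0r.
- by rewrite !env_mulDr hz hz'.
by rewrite -!/(envp _ _) !env_mulp !mulrA.
Qed.
Let env_mul1l : left_id (envp 1 1) env_mul.
Proof.
elim/tens_ind=> [|x x' hx hx'|a b].
- by rewrite env_mul0r.
- by rewrite env_mulDr hx hx'.
by rewrite -!/(envp _ _) env_mulp mul1r mulr1.
Qed.
Let env_mul1r : right_id (envp 1 1) env_mul.
Proof.
elim/tens_ind=> [|x x' hx hx'|a b].
- by rewrite env_mul0l.
- by rewrite env_mulDl hx hx'.
by rewrite -!/(envp _ _) env_mulp mul1r mulr1.
Qed.
Let prod_bal : balanced (fun (k : K) (a : A) => k *: a) (fun (k : K) (b : A) => k *: b)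
  (fun a b : A => a * b).
Proof.
by split=> *; rewrite ?mulrDl ?mulrDr // -scalerAr -scalerAl.
Qed.
Let env_1neq0 : envp 1 1 != 0.
Proof.
apply/eqP => /(congr1 (tlift prod_bal)); rewrite tlift_pure raddf0 mulr1.
by apply/eqP; exact: oner_neq0.
Qed.
HB.instance Definition _ := GRing.Zmodule_isNzRing.Build env
  env_mulA env_mul1l env_mul1r env_mulDl env_mulDr env_1neq0.

Let env_scale (k : K) (x : env) : env := envp (k *: 1) 1 * x.
Let envkM j k : envp (j *: 1) 1 * envp (k *: 1) 1 = envp ((j * k) *: 1) 1.
Proof. by rewrite [LHS]env_mulp mulr1 -scalerAl mul1r scalerA. Qed.
Let env_scaleA a b v : env_scale a (env_scale b v) = env_scale (a * b) v.
Proof. by rewrite /env_scale mulrA envkM. Qed.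
Let env_scale1 : left_id 1 env_scale.
Proof. by move=> x; rewrite /env_scale scale1r [LHS]mul1r. Qed.
Let env_scaleDr : right_distributive env_scale +%R.
Proof. by move=> k x y; rewrite /env_scale mulrDr. Qed.
Let env_scaleDl v : {morph env_scale^~ v : a b / a + b}.
Proof. by move=> a b; rewrite /env_scale scalerDl envpDl mulrDl. Qed.
HB.instance Definition _ := GRing.Zmodule_isLmodule.Build K env
  env_scaleA env_scale1 env_scaleDr env_scaleDl.

Lemma envpM a b a' b' : envp a b * envp a' b' = envp (a * a') (b' * b).
Proof. exact: env_mulp. Qed.

Lemma env_ind (P : env -> Prop) : P 0 -> (forall x y, P x -> P y -> P (x + y)) ->
  (forall a b, P (envp a b)) -> forall x, P x.
Proof. exact: tens_ind. Qed.

Let env_scaleAl (k : K) (x y : env) : k *: (x * y) = (k *: x) * y.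
Proof. exact: mulrA. Qed.
HB.instance Definition _ := GRing.Lmodule_isLalgebra.Build K env env_scaleAl.
Let env_scaleAr (k : K) (x y : env) : k *: (x * y) = x * (k *: y).
Proof.
rewrite -[LHS]/(envp (k *: 1) 1 * (x * y)) -[k *: y]/(envp (k *: 1) 1 * y) !mulrA.
congr (_ * _); elim/env_ind: x => [|x x' hx hx'|a b]; rewrite ?mulr0 ?mul0r //.
  by rewrite mulrDl mulrDr hx hx'.
by rewrite !envpM -scalerAl -scalerAr !mulr1 !mul1r.
Qed.
HB.instance Definition _ := GRing.Lalgebra_isAlgebra.Build K env env_scaleAr.
End EnvelopingAlgebra.
Arguments envp {K A} a b.

(* A-bimodules are left A^e-modules; these are the two actions of A.          *)
Section BimoduleActions.
Variables (K : fieldType) (A : algType K) (M : lmodType (env A)).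
Definition lact (a : A) (m : M) : M := envp a 1 *: m.
Definition ract (a : A) (m : M) : M := envp 1 a *: m.

Lemma actDl a b x y : envp a b *: (x + y) = envp a b *: x + envp a b *: y :> M.
Proof. exact: scalerDr. Qed.
Lemma env_act a b m : envp a b *: m = lact a (ract b m).
Proof. by rewrite /lact /ract scalerA envpM !mulr1. Qed.
Lemma lact_ract a b m : lact a (ract b m) = ract b (lact a m).
Proof. by rewrite /lact /ract !scalerA !envpM !mul1r !mulr1. Qed.
Lemma lactD a : {morph lact a : m n / m + n}.
Proof. by move=> m n; apply: scalerDr. Qed.
Lemma ractD a : {morph ract a : m n / m + n}.
Proof. by move=> m n; apply: scalerDr. Qed.
Lemma lact0 a : lact a 0 = 0. Proof. exact: scaler0. Qed.
Lemma ract0 a : ract a 0 = 0. Proof. exact: scaler0. Qed.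
Lemma lactDl a b m : lact (a + b) m = lact a m + lact b m.
Proof. by rewrite /lact envpDl scalerDl. Qed.
Lemma ractDl a b m : ract (a + b) m = ract a m + ract b m.
Proof. by rewrite /ract envpDr scalerDl. Qed.
Lemma lactA a b m : lact a (lact b m) = lact (a * b) m.
Proof. by rewrite /lact scalerA envpM mulr1. Qed.
Lemma ractA a b m : ract a (ract b m) = ract (b * a) m.
Proof. by rewrite /ract scalerA envpM mulr1. Qed.
Lemma lact1 m : lact 1 m = m. Proof. exact: scale1r. Qed.
Lemma ract1 m : ract 1 m = m. Proof. exact: scale1r. Qed.
Lemma lactZ (k : K) a m : lact (k *: a) m = ract (k *: 1) (lact a m).
Proof.
by rewrite /ract /lact scalerA envpM !mul1r envpZ.
Qed.
Lemma ractZ (k : K) a m : ract (k *: a) m = ract (k *: 1) (ract a m).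
Proof. by rewrite ractA -scalerAr mulr1. Qed.
End BimoduleActions.

Lemma bimod_linear (K : fieldType) (A : algType K) (M N : lmodType (env A)) (f : M -> N) :
  {morph f : x y / x + y} -> (forall a m, f (lact a m) = lact a (f m)) ->
  (forall a m, f (ract a m) = ract a (f m)) -> linear f.
Proof.
move=> fD fl fr; have f0 : f 0 = 0 by apply: (@addrI _ (f 0)); rewrite -fD !addr0.
move=> x m n; rewrite fD; congr (_ + _).
elim/env_ind: x => [|x y hx hy|a b]; first by rewrite !scale0r.
  by rewrite !scalerDl fD hx hy.
by rewrite !env_act fl fr.
Qed.

(* The tensor product of bimodules over A, with outer A^e-action.             *)
Section BimoduleTensor.
Variables (K : fieldType) (A : algType K) (M N : lmodType (env A)).

Definition btens : Type := tens (fun (a : A) (m : M) => ract a m) (fun (a : A) (n : N) => lact a n).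
HB.instance Definition _ := GRing.Zmodule.on btens.

Definition bpure (m : M) (n : N) : btens := pure _ _ m n.

Lemma bpureDl m m' n : bpure (m + m') n = bpure m n + bpure m' n.
Proof. exact: pureDl. Qed.
Lemma bpureDr m n n' : bpure m (n + n') = bpure m n + bpure m n'.
Proof. exact: pureDr. Qed.
Lemma bpure_bal a m n : bpure (ract a m) n = bpure m (lact a n).
Proof. exact: pure_bal. Qed.
Lemma bpure0l n : bpure 0 n = 0. Proof. exact: pure0l. Qed.
Lemma bpure0r m : bpure m 0 = 0. Proof. exact: pure0r. Qed.
Lemma btens_ind (P : btens -> Prop) :
  P 0 -> (forall x y, P x -> P y -> P (x + y)) -> (forall m n, P (bpure m n)) ->
  forall t, P t.
Proof. exact: tens_ind. Qed.

Let act1_bal (a b : A) : balanced (fun (a : A) (m : M) => ract a m) (fun (a : A) (n : N) => lact a n)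
  (fun m n => bpure (lact a m) (ract b n)).
Proof.
split=> *; rewrite ?lactD ?ractD ?bpureDl ?bpureDr //.
by rewrite lact_ract bpure_bal lact_ract.
Qed.
Let act1 (t : btens) (a b : A) : btens := tlift (act1_bal a b) t.
Let act1_bal2 t : balanced (fun (k : K) (a : A) => k *: a) (fun (k : K) (b : A) => k *: b) (act1 t).
Proof.
split=> [a a' b|a b b'|k a b]; rewrite /act1; elim/btens_ind: t => [|x y hx hy|m n];
  rewrite ?raddf0 ?addr0 // ?raddfD /= ?hx ?hy ?tlift_pure.
- by rewrite addrACA.
- by rewrite lactDl bpureDl.
- by rewrite addrACA.
- by rewrite ractDl bpureDr.
- by [].
- rewrite lactZ bpure_bal; congr bpure.
  by rewrite /lact /ract scalerA envpM !mulr1 envpZ.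
Qed.
Let bact (x : env A) (t : btens) : btens := tlift (act1_bal2 t) x.
Let bactp a b m n : bact (envp a b) (bpure m n) = bpure (lact a m) (ract b n).
Proof. by rewrite /bact tlift_pure /act1 tlift_pure. Qed.
Let bactDl t : {morph bact^~ t : x y / x + y}.
Proof. by move=> x y; rewrite /bact raddfD. Qed.
Let bactDr : right_distributive bact +%R.
Proof.
move=> x t u; elim/env_ind: x => [|x x' hx hx'|a b]; rewrite /bact.
- by rewrite !raddf0 addr0.
- by rewrite !raddfD /= addrACA; congr (_ + _).
by rewrite !tlift_pure /act1 raddfD.
Qed.
Let bact0l t : bact 0 t = 0. Proof. by rewrite /bact raddf0. Qed.
Let bact0r x : bact x 0 = 0.
Proof. by apply: (@addrI _ (bact x 0)); rewrite -bactDr !addr0. Qed.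
Let bactA x y t : bact x (bact y t) = bact (x * y) t.
Proof.
elim/btens_ind: t => [|t u ht hu|m n]; first by rewrite !bact0r.
  by rewrite !bactDr ht hu.
elim/env_ind: x => [|x x' hx hx'|a b]; first by rewrite mul0r !bact0l.
  by rewrite mulrDl !bactDl hx hx'.
elim/env_ind: y => [|y y' hy hy'|a' b']; first by rewrite mulr0 !bact0l bact0r.
  by rewrite mulrDr !bactDl bactDr hy hy'.
by rewrite envpM !bactp lactA ractA.
Qed.
Let bact1 : left_id 1 bact.
Proof.
move=> t; elim/btens_ind: t => [|t u ht hu|m n]; first by rewrite bact0r.
  by rewrite bactDr ht hu.
by rewrite -[1]/(envp 1 1) bactp lact1 ract1.
Qed.
HB.instance Definition _ := GRing.Zmodule_isLmodule.Build (env A) btens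
  bactA bact1 bactDr bactDl.

Lemma lact_pure a m n : lact a (bpure m n) = bpure (lact a m) n.
Proof. by rewrite -[LHS]/(bact _ _) bactp ract1. Qed.
Lemma ract_pure a m n : ract a (bpure m n) = bpure m (ract a n).
Proof. by rewrite -[LHS]/(bact _ _) bactp lact1. Qed.

Lemma btens_ext (P : zmodType) (f g : {additive btens -> P}) :
  (forall m n, f (bpure m n) = g (bpure m n)) -> forall t, f t = g t.
Proof. exact: tens_ext. Qed.
End BimoduleTensor.
Arguments bpure {K A M N} m n.

Definition bbalanced (K : fieldType) (A : algType K) (M N : lmodType (env A)) (P : zmodType)
    (f : M -> N -> P) :=
  balanced (fun (a : A) (m : M) => ract a m) (fun (a : A) (n : N) => lact a n) f.

Section BimoduleLift.
Variables (K : fieldType) (A : algType K) (M N : lmodType (env A)) (P : zmodType).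
Variables (f : M -> N -> P) (hf : bbalanced f).
Definition blift : btens M N -> P := tlift hf.
HB.instance Definition _ := GRing.Additive.copy blift (tlift hf).
Lemma blift_pure m n : blift (bpure m n) = f m n.
Proof. exact: tlift_pure. Qed.
End BimoduleLift.

Section RegularBimodule.
Variables (K : fieldType) (A : algType K).
Definition regb : Type := A.
HB.instance Definition _ := GRing.Zmodule.on regb.

Let act_bal (c : A) : balanced (fun (k : K) (a : A) => k *: a) (fun (k : K) (b : A) => k *: b)
  (fun a b : A => a * c * b).
Proof.
split=> *; rewrite ?mulrDl ?mulrDr //.
by rewrite -scalerAr -!scalerAl.
Qed.
Let ract_ (x : env A) (c : regb) : regb := tlift (act_bal c) x.
Let actp a b c : ract_ (envp a b) c = a * c * b.
Proof. exact: tlift_pure. Qed.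
Let actDl c : {morph ract_^~ c : x y / x + y}.
Proof. by move=> x y; rewrite /ract_ raddfD. Qed.
Let act0l c : ract_ 0 c = 0.
Proof. exact: raddf0. Qed.
Let actDr : right_distributive ract_ +%R.
Proof.
move=> x c d; elim/env_ind: x => [|x y hx hy|a b]; first by rewrite !act0l addr0.
  by rewrite !actDl hx hy addrACA.
by rewrite !actp mulrDr mulrDl.
Qed.
Let act0r x : ract_ x 0 = 0.
Proof. by apply: (@addrI _ (ract_ x 0)); rewrite -actDr !addr0. Qed.
Let actA x y c : ract_ x (ract_ y c) = ract_ (x * y) c.
Proof.
elim/env_ind: x => [|x x' hx hx'|a b]; first by rewrite mul0r !act0l.
  by rewrite mulrDl !actDl hx hx'.
elim/env_ind: y => [|y y' hy hy'|a' b']; first by rewrite mulr0 !act0l act0r.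
  by rewrite mulrDr !actDl actDr hy hy'.
by rewrite envpM !actp !mulrA.
Qed.
Let act1 : left_id 1 ract_.
Proof. by move=> c; rewrite -[1]/(envp 1 1) actp mul1r mulr1. Qed.
HB.instance Definition _ := GRing.Zmodule_isLmodule.Build (env A) regb
  actA act1 actDr actDl.

Lemma regb_act a b (c : regb) : envp a b *: c = (a * c * b : A).
Proof. exact: actp. Qed.
Lemma regb_lact a (c : regb) : lact a c = (a * c : A).
Proof. by rewrite /lact regb_act mulr1. Qed.
Lemma regb_ract a (c : regb) : ract a c = (c * a : A).
Proof. by rewrite /ract regb_act mul1r. Qed.
End RegularBimodule.

Section LinearBimod.
Variables (K : fieldType) (A : algType K).
Implicit Types M N P Q : lmodType (env A).

Lemma lin_lact M N (f : {linear M -> N}) a m : f (lact a m) = lact a (f m).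
Proof. exact: linearZ. Qed.
Lemma lin_ract M N (f : {linear M -> N}) a m : f (ract a m) = ract a (f m).
Proof. exact: linearZ. Qed.

Lemma btens_linear M N P (f : {additive btens M N -> P}) :
  (forall a m n, f (bpure (lact a m) n) = lact a (f (bpure m n))) ->
  (forall a m n, f (bpure m (ract a n)) = ract a (f (bpure m n))) -> linear f.
Proof.
move=> fl fr; apply: bimod_linear; first exact: raddfD.
  move=> a; elim/btens_ind=> [|x y hx hy|m n]; last by rewrite lact_pure fl.
    by rewrite !(lact0, raddf0).
  by rewrite lactD !raddfD /= hx hy lactD.
move=> a; elim/btens_ind=> [|x y hx hy|m n]; last by rewrite ract_pure fr.
  by rewrite !(ract0, raddf0).
by rewrite ractD !raddfD /= hx hy ractD.
Qed.

Lemma btens_linext M N P (f g : {linear btens M N -> P}) :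
  (forall m n, f (bpure m n) = g (bpure m n)) -> f = g.
Proof. by move=> fg; apply: linext; apply: btens_ext. Qed.

Lemma btens_linext3 M N P Q (f g : {linear btens (btens M N) P -> Q}) :
  (forall m n p, f (bpure (bpure m n) p) = g (bpure (bpure m n) p)) -> f = g.
Proof.
move=> fg; apply: btens_linext => t p; elim/btens_ind: t => [|x y hx hy|m n //].
  by rewrite bpure0l !raddf0.
by rewrite bpureDl !raddfD /= hx hy.
Qed.

Lemma btens_linext3r M N P Q (f g : {linear btens M (btens N P) -> Q}) :
  (forall m n p, f (bpure m (bpure n p)) = g (bpure m (bpure n p))) -> f = g.
Proof.
move=> fg; apply: btens_linext => m t; elim/btens_ind: t => [|x y hx hy|n p //].
  by rewrite bpure0r !raddf0.
by rewrite bpureDr !raddfD /= hx hy.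
Qed.

Section Tmor.
Variables (M M' N N' : lmodType (env A)) (f : {linear M -> M'}) (g : {linear N -> N'}).
Let tm (m : M) (n : N) := bpure (f m) (g n).
Let tm_bal : bbalanced tm.
Proof.
by split=> *; rewrite /tm ?raddfD ?bpureDl ?bpureDr // lin_ract bpure_bal lin_lact.
Qed.
Let tm_lin : linear (blift tm_bal).
Proof.
apply: btens_linear => a m n /=; rewrite !blift_pure /tm ?lin_lact ?lin_ract.
  by rewrite lact_pure.
by rewrite ract_pure.
Qed.
Definition btmor : {linear btens M N -> btens M' N'} := mklin tm_lin.
Lemma btmorE m n : btmor (bpure m n) = bpure (f m) (g n).
Proof. exact: blift_pure. Qed.
End Tmor.

Section Assoc.
Variables M N P : lmodType (env A).
Let as1 (p : P) (m : M) (n : N) := bpure m (bpure n p).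
Let as1_bal p : bbalanced (as1 p).
Proof.
split=> *; rewrite /as1 ?bpureDl ?bpureDr // bpure_bal lact_pure //.
Qed.
Let as2 (t : btens M N) (p : P) := blift (as1_bal p) t.
Let as2_bal : bbalanced as2.
Proof.
split=> [t t' p|t p p'|a t p]; rewrite /as2 ?raddfD //;
  elim/btens_ind: t => [|x y hx hy|m n].
- by rewrite !raddf0 addr0.
- by rewrite !raddfD /= hx hy addrACA.
- by rewrite !blift_pure /as1 !bpureDr.
- by rewrite ract0 !raddf0.
- by rewrite ractD !raddfD /= hx hy.
by rewrite ract_pure !blift_pure /as1 bpure_bal.
Qed.
Let as2_lin : linear (blift as2_bal).
Proof.
apply: btens_linear => a t p /=; rewrite !blift_pure /as2;
  elim/btens_ind: t => [|x y hx hy|m n].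
- by rewrite lact0 !raddf0 lact0.
- by rewrite lactD !raddfD /= hx hy lactD.
- by rewrite lact_pure !blift_pure /as1 lact_pure.
- by rewrite !raddf0 ract0.
- by rewrite !raddfD /= hx hy ractD.
by rewrite !blift_pure /as1 !ract_pure.
Qed.
Definition basc : {linear btens (btens M N) P -> btens M (btens N P)} := mklin as2_lin.
Lemma bascE m n p : basc (bpure (bpure m n) p) = bpure m (bpure n p).
Proof. by rewrite [LHS]blift_pure [LHS]blift_pure. Qed.

Let ai1 (m : M) (n : N) (p : P) := bpure (bpure m n) p.
Let ai1_bal m : bbalanced (ai1 m).
Proof.
by split=> *; rewrite /ai1 ?bpureDr ?bpureDl // -ract_pure bpure_bal.
Qed.
Let ai2 (m : M) (t : btens N P) := blift (ai1_bal m) t.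
Let ai2_bal : bbalanced ai2.
Proof.
split=> [m m' t|m t t'|a m t]; rewrite /ai2 ?raddfD //;
  elim/btens_ind: t => [|x y hx hy|n p].
- by rewrite !raddf0 addr0.
- by rewrite !raddfD /= hx hy addrACA.
- by rewrite !blift_pure /ai1 !bpureDl.
- by rewrite lact0 !raddf0.
- by rewrite lactD !raddfD /= hx hy.
by rewrite lact_pure !blift_pure /ai1 bpure_bal.
Qed.
Let ai2_lin : linear (blift ai2_bal).
Proof.
apply: btens_linear => a m t /=; rewrite !blift_pure /ai2;
  elim/btens_ind: t => [|x y hx hy|n p].
- by rewrite !raddf0 lact0.
- by rewrite !raddfD /= hx hy lactD.
- by rewrite !blift_pure /ai1 !lact_pure.
- by rewrite ract0 !raddf0 ract0.
- by rewrite ractD !raddfD /= hx hy ractD.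
by rewrite ract_pure !blift_pure /ai1 ract_pure.
Qed.
Definition basci : {linear btens M (btens N P) -> btens (btens M N) P} := mklin ai2_lin.
Lemma basciE m n p : basci (bpure m (bpure n p)) = bpure (bpure m n) p.
Proof. by rewrite [LHS]blift_pure [LHS]blift_pure. Qed.
End Assoc.

Section Unitors.
Variable M : lmodType (env A).
Let lu (c : regb A) (m : M) := lact (c : A) m.
Let lu_bal : bbalanced lu.
Proof.
by split=> *; rewrite /lu ?lactDl ?lactD // regb_ract lactA.
Qed.
Let lu_lin : linear (blift lu_bal).
Proof.
apply: btens_linear => a c m /=; rewrite !blift_pure /lu ?regb_lact ?lactA //.
by rewrite lact_ract.
Qed.
Definition blun : {linear btens (regb A) M -> M} := mklin lu_lin.
Lemma blunE (c : regb A) m : blun (bpure c m) = lact (c : A) m.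
Proof. exact: blift_pure. Qed.

Let lui (m : M) : btens (regb A) M := bpure (1 : regb A) m.
Let lui_lin : linear lui.
Proof.
apply: bimod_linear => [m n|a m|a m]; rewrite /lui ?bpureDr //.
  by rewrite lact_pure -bpure_bal regb_ract regb_lact mulr1 mul1r.
by rewrite ract_pure.
Qed.
Definition bluni : {linear M -> btens (regb A) M} := mklin lui_lin.
Lemma bluniE m : bluni m = bpure (1 : regb A) m. Proof. by []. Qed.

Let ru (m : M) (c : regb A) := ract (c : A) m.
Let ru_bal : bbalanced ru.
Proof.
by split=> *; rewrite /ru ?ractDl ?ractD // regb_lact ractA.
Qed.
Let ru_lin : linear (blift ru_bal).
Proof.
apply: btens_linear => a m c /=; rewrite !blift_pure /ru ?regb_ract ?ractA //.
by rewrite lact_ract.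
Qed.
Definition brun : {linear btens M (regb A) -> M} := mklin ru_lin.
Lemma brunE m (c : regb A) : brun (bpure m c) = ract (c : A) m.
Proof. exact: blift_pure. Qed.

Let rui (m : M) : btens M (regb A) := bpure m (1 : regb A).
Let rui_lin : linear rui.
Proof.
apply: bimod_linear => [m n|a m|a m]; rewrite /rui ?bpureDl //.
  by rewrite lact_pure.
by rewrite ract_pure bpure_bal regb_ract regb_lact mulr1 mul1r.
Qed.
Definition bruni : {linear M -> btens M (regb A)} := mklin rui_lin.
Lemma bruniE m : bruni m = bpure m (1 : regb A). Proof. by []. Qed.
End Unitors.
End LinearBimod.

Definition lincomp (R : pzRingType) (M N P : lmodType R) (g : {linear N -> P})
  (f : {linear M -> N}) : {linear M -> P} := g \o f.
Definition linid (R : pzRingType) (M : lmodType R) : {linear M -> M} := idfun.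

Definition lmod_cat (R : pzRingType) : category.
Proof.
by refine (@Category (lmodType R) (fun M N => {linear M -> N}) (@linid R) (@lincomp R) _ _ _);
  intros; apply: linext.
Defined.

Section Bimod.
Variables (K : fieldType) (A : algType K).
Implicit Types M N P Q : lmodType (env A).

Lemma lincompE (R : pzRingType) (X Y Z : lmodType R) (g : {linear Y -> Z})
  (f : {linear X -> Y}) x : lincomp g f x = g (f x).
Proof. by []. Qed.

Lemma btmor1 M N : btmor (linid M) (linid N) = linid (btens M N).
Proof. by apply: btens_linext => m n; rewrite btmorE. Qed.
Lemma btmor_comp M M' M'' N N' N'' (f' : {linear M' -> M''}) (f : {linear M -> M'})
  (g' : {linear N' -> N''}) (g : {linear N -> N'}) :
  btmor (lincomp f' f) (lincomp g' g) = lincomp (btmor f' g') (btmor f g).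
Proof. by apply: btens_linext => m n; rewrite lincompE !btmorE. Qed.
Lemma bascK M N P : lincomp (basci M N P) (basc M N P) = linid _.
Proof. by apply: btens_linext3 => m n p; rewrite lincompE bascE basciE. Qed.
Lemma basciK M N P : lincomp (basc M N P) (basci M N P) = linid _.
Proof. by apply: btens_linext3r => m n p; rewrite lincompE basciE bascE. Qed.
Lemma blunK M : lincomp (bluni M) (blun M) = linid _.
Proof.
apply: btens_linext => c m; rewrite lincompE blunE bluniE -bpure_bal.
by rewrite regb_ract mul1r.
Qed.
Lemma bluniK M : lincomp (blun M) (bluni M) = linid _.
Proof. by apply: linext => m; rewrite lincompE bluniE blunE lact1. Qed.
Lemma brunK M : lincomp (bruni M) (brun M) = linid _.
Proof.
apply: btens_linext => m c; rewrite lincompE brunE bruniE bpure_bal.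
by rewrite regb_lact mulr1.
Qed.
Lemma bruniK M : lincomp (brun M) (bruni M) = linid _.
Proof. by apply: linext => m; rewrite lincompE bruniE brunE ract1. Qed.
Lemma basc_nat M M' N N' P P' (f : {linear M -> M'}) (g : {linear N -> N'})
  (h : {linear P -> P'}) :
  lincomp (btmor f (btmor g h)) (basc M N P) = lincomp (basc M' N' P') (btmor (btmor f g) h).
Proof. by apply: btens_linext3 => m n p; rewrite !lincompE bascE !btmorE bascE. Qed.
Lemma blun_nat M N (f : {linear M -> N}) :
  lincomp f (blun M) = lincomp (blun N) (btmor (linid _) f).
Proof. by apply: btens_linext => c m; rewrite !lincompE btmorE !blunE lin_lact. Qed.
Lemma brun_nat M N (f : {linear M -> N}) :
  lincomp f (brun M) = lincomp (brun N) (btmor f (linid _)).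
Proof. by apply: btens_linext => m c; rewrite !lincompE btmorE !brunE lin_ract. Qed.
Lemma btriangle M N :
  lincomp (btmor (linid M) (blun N)) (basc M (regb A) N) = btmor (brun M) (linid N).
Proof.
apply: btens_linext3 => m c n.
by rewrite lincompE bascE !btmorE blunE brunE bpure_bal.
Qed.
Lemma bpentagon M N P Q :
  lincomp (basc M N (btens P Q)) (basc (btens M N) P Q) =
  lincomp (lincomp (btmor (linid M) (basc N P Q)) (basc M (btens N P) Q))
    (btmor (basc M N P) (linid Q)).
Proof.
apply: btens_linext3 => t p q.
elim/btens_ind: t => [|x y hx hy|m n]; first by rewrite !bpure0l !raddf0.
  by rewrite !bpureDl [LHS]raddfD [RHS]raddfD; congr (_ + _).
by rewrite !lincompE btmorE !bascE btmorE bascE.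
Qed.

Definition Bimod : monoidal :=
  @Monoidal (lmod_cat (env A)) (@btens K A) (@btmor K A) (regb A)
    (@basc K A) (@basci K A) (@blun K A) (@bluni K A) (@brun K A) (@bruni K A)
    btmor1 btmor_comp bascK basciK blunK bluniK brunK bruniK basc_nat blun_nat
    brun_nat btriangle bpentagon.
End Bimod.

Section RestrictionOfScalars.
Variables (R S : pzRingType).
Definition res (f : {rmorphism R -> S}) (M : lmodType S) : Type := M.
Variables (f : {rmorphism R -> S}) (M : lmodType S).
HB.instance Definition _ := GRing.Zmodule.on (res f M).
Let rscale (x : R) (m : res f M) : res f M := f x *: (m : M).
Let rscaleA x y m : rscale x (rscale y m) = rscale (x * y) m.
Proof. by rewrite /rscale scalerA rmorphM. Qed.
Let rscale1 : left_id 1 rscale.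
Proof. by move=> m; rewrite /rscale rmorph1 scale1r. Qed.
Let rscaleDr : right_distributive rscale +%R.
Proof. by move=> x m n; rewrite /rscale scalerDr. Qed.
Let rscaleDl m : {morph rscale^~ m : x y / x + y}.
Proof. by move=> x y; rewrite /rscale rmorphD scalerDl. Qed.
HB.instance Definition _ := GRing.Zmodule_isLmodule.Build R (res f M)
  rscaleA rscale1 rscaleDr rscaleDl.
Lemma resE x (m : res f M) : x *: m = f x *: (m : M) :> M.
Proof. by []. Qed.
End RestrictionOfScalars.

(* An A^e-bimodule D whose actions come from an algebra map A^e -> D.         *)
Section UnderlyingBimodule.
Variables (K : fieldType) (A : algType K) (D : algType K).
Variable eta : {lrmorphism env A -> D}.

(* |D, D as an A-bimodule through its left A^e-action *)
Definition lbimod : lmodType (env A) := res eta D^o.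

(* d (x)_A d' in |D (x)_A |D *)
Definition dpure (d d' : D) : btens lbimod lbimod := @bpure K A lbimod lbimod d d'.
End UnderlyingBimodule.

(* Identities in Sweedler notation are required for every expression of the  *)
(* tensors involved as a sum of pure tensors, so that the right-hand sides    *)
(* are part of the requirement to be well defined; for the multiplicativity  *)
(* of the comultiplication this is the Takeuchi condition (see [takeuchi]).   *)
Record bialgebroid (K : fieldType) (A : algType K) := Bialgebroid {
  bd_alg :> algType K;
  bd_eta : {lrmorphism env A -> bd_alg};
  bd_comul : {linear lbimod bd_eta -> btens (lbimod bd_eta) (lbimod bd_eta)};
  bd_counit : {linear lbimod bd_eta -> regb A};
  bd_comonoid : @is_comonoid (Bimod A) (lbimod bd_eta) bd_comul bd_counit;
  bd_comul_act : forall (d : bd_alg) (r s : A) (w : seq (bd_alg * bd_alg)),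
    bd_comul d = \sum_(p <- w) dpure bd_eta p.1 p.2 ->
    bd_comul (d * bd_eta (envp r s)) =
      \sum_(p <- w) dpure bd_eta (p.1 * bd_eta (envp r 1)) (p.2 * bd_eta (envp 1 s));
  bd_counit_act : forall (d : bd_alg) (r : A),
    bd_counit (d * bd_eta (envp r 1)) = bd_counit (d * bd_eta (envp 1 r));
  bd_comulM : forall (d d' : bd_alg) (w w' : seq (bd_alg * bd_alg)),
    bd_comul d = \sum_(p <- w) dpure bd_eta p.1 p.2 ->
    bd_comul d' = \sum_(q <- w') dpure bd_eta q.1 q.2 ->
    bd_comul (d * d') =
      \sum_(p <- w) \sum_(q <- w') dpure bd_eta (p.1 * q.1) (p.2 * q.2);
  bd_comul1 : bd_comul (1 : bd_alg) = dpure bd_eta 1 1;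
  bd_counit1 : bd_counit (1 : bd_alg) = (1 : A);
  bd_counitM : forall d d' : bd_alg,
    bd_counit (d * d') = bd_counit (d * bd_eta (envp (bd_counit d' : A) 1));
  bd_counitMop : forall d d' : bd_alg,
    bd_counit (d * d') = bd_counit (d * bd_eta (envp 1 (bd_counit d' : A)))
}.

Section Bialgebroid.
Variables (K : fieldType) (A : algType K) (D : bialgebroid A).

Notation eta := (bd_eta D).
Definition bd_src (a : A) : D := eta (envp a 1).
Definition bd_tgt (a : A) : D := eta (envp 1 a).
Definition bd_bimod : lmodType (env A) := lbimod eta.
Definition bd_pure (d d' : D) : btens bd_bimod bd_bimod := dpure eta d d'.
Definition bd_Delta (d : D) : btens bd_bimod bd_bimod := bd_comul D d.
Definition bd_eps (d : D) : A := bd_counit D d.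

Lemma bd_pureDl d d' e : bd_pure (d + d') e = bd_pure d e + bd_pure d' e.
Proof. exact: bpureDl. Qed.
Lemma bd_pureDr d e e' : bd_pure d (e + e') = bd_pure d e + bd_pure d e'.
Proof. exact: bpureDr. Qed.
Lemma bd_pure_bal a d e : bd_pure (bd_tgt a * d) e = bd_pure d (bd_src a * e).
Proof. exact: bpure_bal. Qed.
Lemma bd_ind (P : btens bd_bimod bd_bimod -> Prop) :
  P 0 -> (forall x y, P x -> P y -> P (x + y)) -> (forall d e, P (bd_pure d e)) ->
  forall t, P t.
Proof. exact: btens_ind. Qed.
Lemma bd_sum t : exists w : seq (D * D), t = \sum_(p <- w) bd_pure p.1 p.2.
Proof. by exists (repr t); exact: tens_sum. Qed.
Lemma bd_DeltaD : {morph bd_Delta : d e / d + e}.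
Proof. exact: (raddfD (bd_comul D)). Qed.
Lemma bd_epsD : {morph bd_eps : d e / d + e}.
Proof. exact: (raddfD (bd_counit D)). Qed.

Lemma bd_etaE a b : eta (envp a b) = bd_src a * bd_tgt b.
Proof. by rewrite /bd_src /bd_tgt -rmorphM envpM !mulr1. Qed.
Lemma bd_src1 : bd_src 1 = 1. Proof. exact: rmorph1. Qed.
Lemma bd_tgt1 : bd_tgt 1 = 1. Proof. exact: rmorph1. Qed.
Lemma bd_src_tgt a b : bd_src a * bd_tgt b = bd_tgt b * bd_src a.
Proof. by rewrite /bd_src /bd_tgt -!rmorphM !envpM !mulr1 !mul1r. Qed.
Lemma bd_eps_src a d : bd_eps (bd_src a * d) = a * bd_eps d.
Proof.
rewrite -[LHS]/(bd_counit D (lact a (d : bd_bimod))) lin_lact.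
exact: regb_lact.
Qed.
Lemma bd_eps_tgt a d : bd_eps (bd_tgt a * d) = bd_eps d * a.
Proof.
rewrite -[LHS]/(bd_counit D (ract a (d : bd_bimod))) lin_ract.
exact: regb_ract.
Qed.

Section Map.
Variables (P : zmodType) (f : D -> D -> P).
Hypotheses (fDl : forall d d' e, f (d + d') e = f d e + f d' e)
  (fDr : forall d e e', f d (e + e') = f d e + f d e')
  (fb : forall a d e, f (bd_tgt a * d) e = f d (bd_src a * e)).
Lemma bd_map_bal : bbalanced (fun (d e : bd_bimod) => f d e).
Proof. by split; [exact: fDl|exact: fDr|exact: fb]. Qed.
Definition bd_map : btens bd_bimod bd_bimod -> P := blift bd_map_bal.
HB.instance Definition _ := GRing.Additive.copy bd_map (blift bd_map_bal).
Lemma bd_mapE d e : bd_map (bd_pure d e) = f d e.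
Proof. exact: blift_pure. Qed.
End Map.

(* x (x) y |-> x d (x) y e *)
Section RightMul.
Variables d e : D.
Let rm (x y : D) := bd_pure (x * d) (y * e).
Let rmDl x x' y : rm (x + x') y = rm x y + rm x' y.
Proof. by rewrite /rm mulrDl bd_pureDl. Qed.
Let rmDr x y y' : rm x (y + y') = rm x y + rm x y'.
Proof. by rewrite /rm mulrDl bd_pureDr. Qed.
Let rmb a x y : rm (bd_tgt a * x) y = rm x (bd_src a * y).
Proof. by rewrite /rm -!mulrA bd_pure_bal. Qed.
Definition bd_rmul : btens bd_bimod bd_bimod -> btens bd_bimod bd_bimod :=
  bd_map rmDl rmDr rmb.
HB.instance Definition _ := GRing.Additive.copy bd_rmul (bd_map rmDl rmDr rmb).
Lemma bd_rmulE x y : bd_rmul (bd_pure x y) = bd_pure (x * d) (y * e).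
Proof. exact: bd_mapE. Qed.
Lemma bd_rmul_sum (w : seq (D * D)) : bd_rmul (\sum_(p <- w) bd_pure p.1 p.2) =
  \sum_(p <- w) bd_pure (p.1 * d) (p.2 * e).
Proof. by rewrite raddf_sum; apply: eq_bigr => p _; exact: bd_rmulE. Qed.
End RightMul.

Lemma bd_rmulM d e d' e' z : bd_rmul d' e' (bd_rmul d e z) = bd_rmul (d * d') (e * e') z.
Proof.
elim/bd_ind: z => [|x y hx hy|x y]; first by rewrite !raddf0.
  by rewrite !raddfD /= hx hy.
by rewrite !bd_rmulE !mulrA.
Qed.

Lemma bd_Delta_act d r s :
  bd_Delta (d * (bd_src r * bd_tgt s)) = bd_rmul (bd_src r) (bd_tgt s) (bd_Delta d).
Proof.
have [w hw] := bd_sum (bd_Delta d).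
by rewrite -bd_etaE [LHS](bd_comul_act r s hw) hw bd_rmul_sum.
Qed.

(* d_1 \bar{a} (x) d_2 = d_1 (x) d_2 a *)
Lemma takeuchi a d : bd_rmul (bd_tgt a) 1 (bd_Delta d) = bd_rmul 1 (bd_src a) (bd_Delta d).
Proof.
have [w hw] := bd_sum (bd_Delta d).
have h1 : bd_Delta 1 =
    \sum_(q <- [:: (1, 1); (bd_tgt a, 1); (- 1, bd_src a)]) bd_pure q.1 q.2.
  rewrite !big_cons big_nil /= addr0 [LHS]bd_comul1 -[LHS]addr0; congr (_ + _).
  have := bd_pure_bal a 1 1; rewrite !mulr1 => ->.
  by rewrite -bd_pureDl subrr [RHS]pure0l.
have h2 : bd_Delta 1 = \sum_(q <- [:: (1, 1)]) bd_pure q.1 q.2.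
  by rewrite big_seq1 [LHS]bd_comul1.
have := bd_comulM hw h1; rewrite (bd_comulM hw h2).
under eq_bigr do rewrite big_seq1 /= !mulr1.
under [RHS]eq_bigr do rewrite !big_cons big_nil /= addr0 !mulr1.
rewrite !big_split /= -[X in X = _ -> _]addr0 => /addrI /esym/(canRL (addrK _)).
rewrite sub0r hw !bd_rmul_sum => e.
under eq_bigr do rewrite mulr1.
under [RHS]eq_bigr do rewrite mulr1.
rewrite [LHS]e -sumrN; apply: eq_bigr => p _.
by rewrite mulrN mulr1 [dpure _ _ _]pureNl opprK.
Qed.
End Bialgebroid.

Section ModuleTensor.
Variables (K : fieldType) (A : algType K) (H : bialgebroid A).
Notation "'|' M" := (res (bd_eta H) M) (at level 20, only parsing).

Section Def.
Variables M N : lmodType H.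

(* M (x)_A N, with the H-action h (m (x) n) = h_1 m (x) h_2 n *)
Definition htens : Type := btens (| M) (| N).
HB.instance Definition _ := GRing.Zmodule.on htens.

Definition hpure (m : M) (n : N) : htens := @bpure K A (| M) (| N) m n.

Lemma hpureDl m m' n : hpure (m + m') n = hpure m n + hpure m' n.
Proof. exact: bpureDl. Qed.
Lemma hpureDr m n n' : hpure m (n + n') = hpure m n + hpure m n'.
Proof. exact: bpureDr. Qed.
Lemma hpure0l n : hpure 0 n = 0. Proof. exact: bpure0l. Qed.
Lemma hpure0r m : hpure m 0 = 0. Proof. exact: bpure0r. Qed.
Lemma hpure_bal a m n : hpure (bd_tgt H a *: m) n = hpure m (bd_src H a *: n).
Proof. exact: bpure_bal. Qed.
Lemma htens_ind (P : htens -> Prop) :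
  P 0 -> (forall x y, P x -> P y -> P (x + y)) -> (forall m n, P (hpure m n)) ->
  forall t, P t.
Proof. exact: btens_ind. Qed.

Section Act2.
Variables (m : M) (n : N).
Let f (x y : H) := hpure (x *: m) (y *: n).
Let fDl x x' y : f (x + x') y = f x y + f x' y.
Proof. by rewrite /f scalerDl hpureDl. Qed.
Let fDr x y y' : f x (y + y') = f x y + f x y'.
Proof. by rewrite /f scalerDl hpureDr. Qed.
Let fb a x y : f (bd_tgt H a * x) y = f x (bd_src H a * y).
Proof. by rewrite /f -!scalerA hpure_bal. Qed.
Definition hact2 : btens (bd_bimod H) (bd_bimod H) -> htens := bd_map fDl fDr fb.
HB.instance Definition _ := GRing.Additive.copy hact2 (bd_map fDl fDr fb).
Lemma hact2E x y : hact2 (bd_pure x y) = hpure (x *: m) (y *: n).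
Proof. exact: bd_mapE. Qed.
Lemma hact2_sum (w : seq (H * H)) : hact2 (\sum_(p <- w) bd_pure p.1 p.2) =
  \sum_(p <- w) hpure (p.1 *: m) (p.2 *: n).
Proof. by rewrite raddf_sum; apply: eq_bigr => p _; exact: hact2E. Qed.
End Act2.

Lemma hact2_rmul d e m n z : hact2 m n (bd_rmul d e z) = hact2 (d *: m) (e *: n) z.
Proof.
have [w ->] := bd_sum z.
by rewrite bd_rmul_sum !raddf_sum; apply: eq_bigr => p _; rewrite /= !hact2E !scalerA.
Qed.

Let ha (h : H) (m : (| M)) (n : (| N)) : htens := hact2 m n (bd_Delta h).
Let ha_bal h : bbalanced (ha h).
Proof.
split=> [m m' n|m n n'|a m n]; rewrite /ha.
- have [w ->] := bd_sum (bd_Delta h); rewrite !hact2_sum -big_split.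
  by apply: eq_bigr => p _ /=; rewrite -hpureDl -scalerDr.
- have [w ->] := bd_sum (bd_Delta h); rewrite !hact2_sum -big_split.
  by apply: eq_bigr => p _ /=; rewrite -hpureDr -scalerDr.
have := congr1 (hact2 m n) (takeuchi a h).
by rewrite !hact2_rmul !scale1r.
Qed.
Definition hact (h : H) (t : htens) : htens := blift (ha_bal h) t.
Lemma hact_pure h m n : hact h (hpure m n) = hact2 m n (bd_Delta h).
Proof. exact: blift_pure. Qed.
Let hactDr : right_distributive hact +%R.
Proof. by move=> h t u; rewrite /hact raddfD. Qed.
Let hact0r h : hact h 0 = 0.
Proof. by rewrite /hact raddf0. Qed.
Let hactDl t : {morph hact^~ t : h h' / h + h'}.
Proof.
move=> h h'; elim/htens_ind: t => [|t u ht hu|m n]; first by rewrite !hact0r addr0.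
  by rewrite !hactDr ht hu addrACA.
by rewrite !hact_pure bd_DeltaD raddfD.
Qed.
Let hact_sum h (w : seq (H * H)) m n : bd_Delta h = \sum_(p <- w) bd_pure p.1 p.2 ->
  hact h (hpure m n) = \sum_(p <- w) hpure (p.1 *: m) (p.2 *: n).
Proof. by move=> hw; rewrite hact_pure hw hact2_sum. Qed.
Let hactA h h' t : hact h (hact h' t) = hact (h * h') t.
Proof.
elim/htens_ind: t => [|t u ht hu|m n]; first by rewrite !hact0r.
  by rewrite !hactDr ht hu.
have [w hw] := bd_sum (bd_Delta h); have [w' hw'] := bd_sum (bd_Delta h').
rewrite [RHS]hact_pure [bd_Delta _](bd_comulM hw hw') raddf_sum (hact_sum m n hw').
rewrite (big_morph _ (hactDr h) (hact0r h)).
under eq_bigr do rewrite (hact_sum _ _ hw).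
rewrite exchange_big; apply: eq_bigr => p _ /=; rewrite raddf_sum; apply: eq_bigr => q _ /=.
by rewrite [RHS]hact2E !scalerA.
Qed.
Let hact1 : left_id 1 hact.
Proof.
move=> t; elim/htens_ind: t => [|t u ht hu|m n]; first by rewrite !hact0r.
  by rewrite !hactDr ht hu.
by rewrite hact_pure [bd_Delta _]bd_comul1 [LHS]hact2E !scale1r.
Qed.
HB.instance Definition _ := GRing.Zmodule_isLmodule.Build H htens
  hactA hact1 hactDr hactDl.

Lemma hscale_pure h m n : h *: hpure m n = hact2 m n (bd_Delta h).
Proof. exact: hact_pure. Qed.
Lemma hscale_sum h (w : seq (H * H)) m n : bd_Delta h = \sum_(p <- w) bd_pure p.1 p.2 ->
  h *: hpure m n = \sum_(p <- w) hpure (p.1 *: m) (p.2 *: n).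
Proof. exact: hact_sum. Qed.
Lemma hscale_eta a b m n :
  bd_eta H (envp a b) *: hpure m n = hpure (bd_src H a *: m) (bd_tgt H b *: n).
Proof.
rewrite hscale_pure bd_etaE -[_ * _]mul1r bd_Delta_act [bd_Delta _]bd_comul1.
by rewrite hact2_rmul [LHS]hact2E !scale1r.
Qed.
(* Restricting the H-action to A^e gives back the action on the tensor        *)
(* product of bimodules.                                                      *)
Lemma hscale_env x (t : htens) : bd_eta H x *: t = x *: (t : btens (| M) (| N)) :> htens.
Proof.
elim/htens_ind: t => [|t u ht hu|m n].
- by rewrite scaler0; symmetry; exact: (@scaler0 _ (btens (| M) (| N))).
- by rewrite scalerDr ht hu; symmetry; exact: (@scalerDr _ (btens (| M) (| N))).
elim/env_ind: x => [|x y hx hy|a b].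
- by rewrite raddf0 scale0r; symmetry; exact: (@scale0r _ (btens (| M) (| N))).
- by rewrite raddfD scalerDl hx hy; symmetry; exact: (@scalerDl _ (btens (| M) (| N))).
rewrite hscale_eta (@env_act _ _ (btens (| M) (| N))).
by rewrite [ract b _]ract_pure [lact a _]lact_pure.
Qed.
End Def.
Arguments hpure {M N} m n.

Lemma htens_linear (M N P : lmodType H) (f : {additive htens M N -> P}) :
  (forall h m n, f (h *: hpure m n) = h *: f (hpure m n)) -> linear f.
Proof.
move=> fl h t u; rewrite raddfD; congr (_ + _).
elim/htens_ind: t => [|x y hx hy|m n //]; first by rewrite !(scaler0, raddf0).
by rewrite !raddfD /= hx hy.
Qed.
Lemma htens_linext (M N P : lmodType H) (f g : {linear htens M N -> P}) :
  (forall m n, f (hpure m n) = g (hpure m n)) -> f = g.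
Proof. by move=> fg; apply: linext; apply: (@btens_ext _ _ (| M) (| N) P f g). Qed.
Lemma htens_linext3 (M N P Q : lmodType H) (f g : {linear htens (htens M N) P -> Q}) :
  (forall m n p, f (hpure (hpure m n) p) = g (hpure (hpure m n) p)) -> f = g.
Proof.
move=> fg; apply: htens_linext => t p; elim/htens_ind: t => [|x y hx hy|m n //].
  by rewrite hpure0l !raddf0.
by rewrite hpureDl !raddfD /= hx hy.
Qed.
Lemma htens_linext3r (M N P Q : lmodType H) (f g : {linear htens M (htens N P) -> Q}) :
  (forall m n p, f (hpure m (hpure n p)) = g (hpure m (hpure n p))) -> f = g.
Proof.
move=> fg; apply: htens_linext => m t; elim/htens_ind: t => [|x y hx hy|n p //].
  by rewrite hpure0r !raddf0.
by rewrite hpureDr !raddfD /= hx hy.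
Qed.

Section ResMor.
Variables (M N : lmodType H) (f : {linear M -> N}).
Let fr (m : (| M)) : (| N) := f m.
Let fr_lin : linear fr.
Proof. by move=> x m n; exact: (linearP f (bd_eta H x)). Qed.
Definition res_mor : {linear (| M) -> (| N)} := mklin fr_lin.
Lemma res_morE m : res_mor m = f m. Proof. by []. Qed.
End ResMor.

Section ResTens.
Variables M N : lmodType H.
Let i1 (t : (| (htens M N))) : btens (| M) (| N) := t.
Let i2 (t : btens (| M) (| N)) : (| (htens M N)) := t.
Let i1_lin : linear i1.
Proof. by move=> x t u; rewrite /i1 resE hscale_env. Qed.
Let i2_lin : linear i2.
Proof. by move=> x t u; rewrite /i2 resE hscale_env. Qed.
(* both are the identity *)
Definition res_tens : {linear (| (htens M N)) -> btens (| M) (| N)} := mklin i1_lin.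
Definition res_tensi : {linear btens (| M) (| N) -> (| (htens M N))} := mklin i2_lin.
End ResTens.

(* A as an H-module, h . a = epsilon (h a) *)
Definition htriv of bialgebroid A : Type := A.
HB.instance Definition _ := GRing.Zmodule.on (htriv H).
Let tscale (h : H) (a : htriv H) : htriv H := bd_eps (h * bd_src H a).
Let tscaleA h h' a : tscale h (tscale h' a) = tscale (h * h') a.
Proof. by rewrite /tscale -mulrA; symmetry; exact: bd_counitM. Qed.
Let tscale1 : left_id 1 tscale.
Proof.
by move=> a; rewrite /tscale mul1r -[X in bd_eps X]mulr1 bd_eps_src [bd_eps _]bd_counit1 mulr1.
Qed.
Let bd_srcD a b : bd_src H (a + b) = bd_src H a + bd_src H b.
Proof. by rewrite /bd_src envpDl rmorphD. Qed.
Let tscaleDr : right_distributive tscale +%R.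
Proof. by move=> h a b; rewrite /tscale bd_srcD mulrDr bd_epsD. Qed.
Let tscaleDl a : {morph tscale^~ a : g h / g + h}.
Proof. by move=> g h; rewrite /tscale mulrDl bd_epsD. Qed.
HB.instance Definition _ := GRing.Zmodule_isLmodule.Build H (htriv H)
  tscaleA tscale1 tscaleDr tscaleDl.
Lemma htrivE h (a : htriv H) : h *: a = bd_eps (h * bd_src H a) :> A.
Proof. by []. Qed.

Let t1 (a : (| (htriv H))) : regb A := a.
Let t2 (a : regb A) : (| (htriv H)) := a.
Let htriv_env x (a : A) : bd_eta H x *: (a : htriv H) = x *: (a : regb A) :> A.
Proof.
elim/env_ind: x => [|x y hx hy|b c].
- by rewrite raddf0 !scale0r.
- by rewrite raddfD !scalerDl -hx -hy.
rewrite htrivE bd_etaE -mulrA bd_eps_src bd_eps_tgt -[bd_src H a]mulr1 bd_eps_src.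
by rewrite [bd_eps _]bd_counit1 mulr1 regb_act mulrA.
Qed.
Let t1_lin : linear t1.
Proof. by move=> x a b; rewrite /t1 resE; congr (_ + _); exact: htriv_env. Qed.
Let t2_lin : linear t2.
Proof. by move=> x a b; rewrite /t2; congr (_ + _); symmetry; exact: htriv_env. Qed.
(* both are the identity *)
Definition res_triv : {linear (| (htriv H)) -> regb A} := mklin t1_lin.
Definition res_trivi : {linear regb A -> (| (htriv H))} := mklin t2_lin.

Section Hmor.
Variables (M M' N N' : lmodType H) (f : {linear M -> M'}) (g : {linear N -> N'}).
Let fg (t : htens M N) : htens M' N' := btmor (res_mor f) (res_mor g) t.
Let fg_pure m n : fg (hpure m n) = hpure (f m) (g n).
Proof. exact: btmorE. Qed.
Let fgD : {morph fg : t u / t + u}.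
Proof. by move=> t u; exact: (raddfD (btmor _ _)). Qed.
Let fg0 : fg 0 = 0.
Proof. exact: (raddf0 (btmor _ _)). Qed.
Let fg_lin : linear fg.
Proof.
move=> h t u; rewrite fgD; congr (_ + _).
elim/htens_ind: t => [|x y hx hy|m n]; first by rewrite scaler0 fg0 scaler0.
  by rewrite scalerDr !fgD hx hy scalerDr.
have [w hw] := bd_sum (bd_Delta h).
rewrite fg_pure !(hscale_sum _ _ hw) (big_morph _ fgD fg0).
by apply: eq_bigr => p _; rewrite fg_pure !linearZ.
Qed.
Definition hmor : {linear htens M N -> htens M' N'} := mklin fg_lin.
Lemma hmorE m n : hmor (hpure m n) = hpure (f m) (g n).
Proof. exact: fg_pure. Qed.
End Hmor.
End ModuleTensor.
Arguments hpure {K A H M N} m n.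

Section ModuleMonoidal.
Variables (K : fieldType) (A : algType K) (H : bialgebroid A).
Notation "'|' M" := (res (bd_eta H) M) (at level 20, only parsing).

Lemma hact2_src_tgt (M N : lmodType H) a b (m : M) (n : N) z :
  hact2 m n (envp a b *: z) = bd_eta H (envp a b) *: hact2 m n z.
Proof.
have [w ->] := bd_sum z.
rewrite scaler_sumr raddf_sum hact2_sum scaler_sumr; apply: eq_bigr => p _.
rewrite hscale_eta !scalerA -[RHS]hact2E; congr (hact2 _ _ _).
by rewrite env_act [ract b _]ract_pure [lact a _]lact_pure.
Qed.

Section Assoc.
Variables M N P : lmodType H.

Let as_env : {linear btens (btens (| M) (| N)) (| P) -> btens (| M) (btens (| N) (| P))} :=
  basc _ _ _.
Let ha : {linear btens (| (htens M N)) (| P) -> btens (| M) (| (htens N P))} :=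
  lincomp (btmor (linid (| M)) (res_tensi N P))
    (lincomp as_env (btmor (res_tens M N) (linid (| P)))).
Let hf (t : htens (htens M N) P) : htens M (htens N P) := ha t.
Let hfE m n p : hf (hpure (hpure m n) p) = hpure m (hpure n p).
Proof. by rewrite /hf /ha !lincompE [btmor (res_tens _ _) _ _]btmorE [as_env _]bascE [LHS]btmorE. Qed.
Let hfD : {morph hf : x y / x + y}.
Proof. by move=> x y; exact: (raddfD ha). Qed.
Let hf0 : hf 0 = 0. Proof. exact: (raddf0 ha). Qed.

(* x (x) (y (x) z) |-> x m (x) (y n (x) z p) *)
Section Phi.
Variables (m : M) (n : N) (p : P).
Let phi0 (x : bd_bimod H) (t : btens (bd_bimod H) (bd_bimod H)) : htens M (htens N P) :=
  hpure ((x : H) *: m) (hact2 n p t).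
Let phi0_bal : bbalanced phi0.
Proof.
split=> [x y t|x t u|a x t]; rewrite /phi0.
- by rewrite scalerDl hpureDl.
- by rewrite raddfD hpureDr.
by rewrite [lact a t]/lact hact2_src_tgt -hpure_bal scalerA.
Qed.
Let phi := blift phi0_bal.
Let phiE x t : phi (bpure x t) = hpure ((x : H) *: m) (hact2 n p t).
Proof. exact: blift_pure. Qed.

Let phi_asc t (z : bd_bimod H) :
  phi (basc _ _ _ (bpure t z)) = hf (hpure (hact2 m n t) ((z : H) *: p)).
Proof.
elim/bd_ind: t => [|x y hx hy|x y].
- by rewrite [hact2 _ _ _]raddf0 hpure0l hf0 [bpure _ _]bpure0l raddf0; exact: (raddf0 (blift phi0_bal)).
- rewrite [hact2 _ _ _]raddfD hpureDl hfD -hx -hy [bpure _ _]bpureDl raddfD; exact: (raddfD (blift phi0_bal)).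
by rewrite [hact2 _ _ _]hact2E hfE [basc _ _ _ _]bascE phiE; congr hpure; exact: hact2E.
Qed.

Lemma hact_asc h : hf (h *: hpure (hpure m n) p) = h *: hpure m (hpure n p).
Proof.
have [w hw] := bd_sum (bd_Delta h).
have [ca _ _] := bd_comonoid H.
have phi_D : {morph phi : x y / x + y} by move=> x y; exact: (raddfD (blift phi0_bal)).
have phi_0 : phi 0 = 0 by exact: (raddf0 (blift phi0_bal)).
have : phi (basc _ _ _ (btmor (bd_comul H) (linid _) (bd_Delta h))) =
    phi (btmor (linid _) (bd_comul H) (bd_Delta h)).
  by congr phi; exact: (congr1 (fun f : {linear bd_bimod H -> _} => f (h : bd_bimod H)) ca).
rewrite hw (raddf_sum (btmor _ _)) (raddf_sum (basc _ _ _)) (raddf_sum (btmor _ _)).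
rewrite !(big_morph _ phi_D phi_0) (hscale_sum _ _ hw) => e.
rewrite (big_morph _ hfD hf0) (hscale_sum _ _ hw).
transitivity (\sum_(q <- w) phi (basc _ _ _ (bpure (bd_Delta q.1) (q.2 : bd_bimod H)))).
  by apply: eq_bigr => q _; rewrite phi_asc [q.1 *: _]hscale_pure.
transitivity (\sum_(q <- w) phi (bpure (q.1 : bd_bimod H) (bd_Delta q.2))); last first.
  by apply: eq_bigr => q _; rewrite phiE [q.2 *: _]hscale_pure.
have e1 q : btmor (bd_comul H) (linid (bd_bimod H)) (bd_pure q.1 q.2) =
    bpure (bd_Delta q.1) (q.2 : bd_bimod H) by exact: btmorE.
have e2 q : btmor (linid (bd_bimod H)) (bd_comul H) (bd_pure q.1 q.2) =
    bpure (q.1 : bd_bimod H) (bd_Delta q.2) by exact: btmorE.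
under eq_bigr do rewrite -e1.
under [RHS]eq_bigr do rewrite -e2.
exact: e.
Qed.
End Phi.

Let hf_lin : linear hf.
Proof.
move=> h t u; rewrite hfD; congr (_ + _).
elim/htens_ind: t => [|x y hx hy|t p]; first by rewrite scaler0 hf0 scaler0.
  by rewrite scalerDr !hfD hx hy scalerDr.
elim/htens_ind: t => [|x y hx hy|m n]; first by rewrite hpure0l scaler0 hf0 scaler0.
  by rewrite hpureDl scalerDr !hfD hx hy scalerDr.
by rewrite hact_asc hfE.
Qed.
Definition hasc : {linear htens (htens M N) P -> htens M (htens N P)} := mklin hf_lin.
Lemma hascE m n p : hasc (hpure (hpure m n) p) = hpure m (hpure n p).
Proof. exact: hfE. Qed.

Let hai : {linear btens (| M) (| (htens N P)) -> btens (| (htens M N)) (| P)} :=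
  lincomp (btmor (res_tensi M N) (linid (| P)))
    (lincomp (basci _ _ _) (btmor (linid (| M)) (res_tens N P))).
Let hfi (t : htens M (htens N P)) : htens (htens M N) P := hai t.
Let hfiE m n p : hfi (hpure m (hpure n p)) = hpure (hpure m n) p.
Proof.
rewrite /hfi /hai !lincompE [btmor (linid _) (res_tens _ _) _]btmorE.
by rewrite [basci _ _ _ _]basciE [LHS]btmorE.
Qed.
Let hfiK : cancel hasc hfi.
Proof.
have hai_D : {morph hfi : x y / x + y} by move=> x y; exact: (raddfD hai).
have hai_0 : hfi 0 = 0 by exact: (raddf0 hai).
elim/htens_ind=> [|x y hx hy|t p]; first by rewrite raddf0 hai_0.
  by rewrite raddfD hai_D hx hy.
elim/htens_ind: t => [|x y hx hy|m n]; first by rewrite hpure0l raddf0 hai_0.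
  by rewrite hpureDl raddfD hai_D hx hy.
by rewrite hascE hfiE.
Qed.
Let hfKi : cancel hfi hasc.
Proof.
have hai_D : {morph hfi : x y / x + y} by move=> x y; exact: (raddfD hai).
have hai_0 : hfi 0 = 0 by exact: (raddf0 hai).
elim/htens_ind=> [|x y hx hy|m t]; first by rewrite hai_0 raddf0.
  by rewrite hai_D [LHS]raddfD; congr (_ + _).
elim/htens_ind: t => [|x y hx hy|n p]; first by rewrite hpure0r hai_0 raddf0.
  by rewrite hpureDr hai_D [LHS]raddfD; congr (_ + _).
by rewrite hfiE hascE.
Qed.
Definition hasci : {linear htens M (htens N P) -> htens (htens M N) P} :=
  mklin (can2_linear hfiK hfKi).
Lemma hasciE m n p : hasci (hpure m (hpure n p)) = hpure (hpure m n) p.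
Proof. exact: hfiE. Qed.
End Assoc.

Section Unitors.
Variable M : lmodType H.
Let hl : {linear btens (| (htriv H)) (| M) -> (| M)} :=
  lincomp (blun (| M)) (btmor (res_triv H) (linid (| M))).
Let lu (t : htens (htriv H) M) : M := hl t.
Let luE (c : htriv H) m : lu (hpure c m) = bd_src H c *: m.
Proof. by rewrite /lu /hl lincompE [btmor _ _ _]btmorE [LHS]blunE. Qed.
Let luD : {morph lu : t u / t + u}. Proof. by move=> t u; exact: (raddfD hl). Qed.
Let lu0 : lu 0 = 0. Proof. exact: (raddf0 hl). Qed.
Let counit_l (d : H) w : bd_Delta d = \sum_(p <- w) bd_pure p.1 p.2 ->
  \sum_(p <- w) bd_src H (bd_eps p.1) * p.2 = d.
Proof.
move=> hw; have [_ cl _] := bd_comonoid H.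
have : blun _ (btmor (bd_counit H) (linid _) (bd_Delta d)) = d.
  exact: (congr1 (fun f : {linear bd_bimod H -> _} => f (d : bd_bimod H)) cl).
rewrite hw (raddf_sum (btmor _ _)) (raddf_sum (blun _)) => e; rewrite -[RHS]e; apply: eq_bigr => p _.
by transitivity (blun _ (btmor (bd_counit H) (linid (bd_bimod H)) (bd_pure p.1 p.2))); [rewrite [btmor _ _ _]btmorE [RHS]blunE|].
Qed.
Let counit_r (d : H) w : bd_Delta d = \sum_(p <- w) bd_pure p.1 p.2 ->
  \sum_(p <- w) bd_tgt H (bd_eps p.2) * p.1 = d.
Proof.
move=> hw; have [_ _ cr] := bd_comonoid H.
have : brun _ (btmor (linid _) (bd_counit H) (bd_Delta d)) = d.
  exact: (congr1 (fun f : {linear bd_bimod H -> _} => f (d : bd_bimod H)) cr).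
rewrite hw (raddf_sum (btmor _ _)) (raddf_sum (brun _)) => e; rewrite -[RHS]e; apply: eq_bigr => p _.
by transitivity (brun _ (btmor (linid (bd_bimod H)) (bd_counit H) (bd_pure p.1 p.2))); [rewrite [btmor _ _ _]btmorE [RHS]brunE|].
Qed.
Let lu_lin : linear lu.
Proof.
move=> h t u; rewrite luD; congr (_ + _).
elim/htens_ind: t => [|x y hx hy|c m]; first by rewrite scaler0 lu0 scaler0.
  by rewrite scalerDr !luD hx hy scalerDr.
have [w hw] := bd_sum (bd_Delta h).
rewrite luE (hscale_sum _ _ hw) (big_morph _ luD lu0) scalerA.
have hw' : bd_Delta (h * bd_src H c) =
    \sum_(p <- [seq (p.1 * bd_src H c, p.2) | p <- w]) bd_pure p.1 p.2.
  rewrite big_map -[X in h * X]mulr1 -(bd_tgt1 H) bd_Delta_act hw bd_rmul_sum.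
  by apply: eq_bigr => p _; rewrite bd_tgt1 mulr1.
rewrite -[in RHS](counit_l hw') big_map scaler_suml; apply: eq_bigr => p _.
by rewrite luE htrivE scalerA.
Qed.
Definition hlun : {linear htens (htriv H) M -> M} := mklin lu_lin.
Lemma hlunE (c : htriv H) m : hlun (hpure c m) = bd_src H c *: m.
Proof. exact: luE. Qed.
Let lui (m : M) : htens (htriv H) M := hpure ((1 : A) : htriv H) m.
Let luiK : cancel hlun lui.
Proof.
have D : {morph lui : x y / x + y} by move=> x y; exact: hpureDr.
elim/htens_ind=> [|x y hx hy|c m]; first by rewrite raddf0 /lui hpure0r.
  by rewrite raddfD D hx hy.
rewrite hlunE /lui -hpure_bal; congr hpure.
by rewrite htrivE -bd_src_tgt !bd_eps_src -[bd_tgt H c]mulr1 bd_eps_tgt [bd_eps _]bd_counit1 !mul1r.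
Qed.
Let luKi : cancel lui hlun.
Proof. by move=> m; rewrite hlunE bd_src1 scale1r. Qed.
Definition hluni : {linear M -> htens (htriv H) M} := mklin (can2_linear luiK luKi).
Lemma hluniE m : hluni m = hpure ((1 : A) : htriv H) m. Proof. by []. Qed.
Lemma hlunK : lincomp hluni hlun = linid _.
Proof. by apply: linext => m; exact: luiK. Qed.
Lemma hluniK : lincomp hlun hluni = linid _.
Proof. by apply: linext => m; exact: luKi. Qed.

Let hr : {linear btens (| M) (| (htriv H)) -> (| M)} :=
  lincomp (brun (| M)) (btmor (linid (| M)) (res_triv H)).
Let ru (t : htens M (htriv H)) : M := hr t.
Let ruE m (c : htriv H) : ru (hpure m c) = bd_tgt H c *: m.
Proof. by rewrite /ru /hr lincompE [btmor _ _ _]btmorE [LHS]brunE. Qed.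
Let ruD : {morph ru : t u / t + u}. Proof. by move=> t u; exact: (raddfD hr). Qed.
Let ru0 : ru 0 = 0. Proof. exact: (raddf0 hr). Qed.
Let ru_lin : linear ru.
Proof.
move=> h t u; rewrite ruD; congr (_ + _).
elim/htens_ind: t => [|x y hx hy|m c]; first by rewrite scaler0 ru0 scaler0.
  by rewrite scalerDr !ruD hx hy scalerDr.
have [w hw] := bd_sum (bd_Delta h).
rewrite ruE (hscale_sum _ _ hw) (big_morph _ ruD ru0) scalerA.
have hw' : bd_Delta (h * bd_tgt H c) =
    \sum_(p <- [seq (p.1, p.2 * bd_tgt H c) | p <- w]) bd_pure p.1 p.2.
  rewrite big_map -[X in h * X]mul1r -(bd_src1 H) bd_Delta_act hw bd_rmul_sum.
  by apply: eq_bigr => p _; rewrite bd_src1 mulr1.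
rewrite -[in RHS](counit_r hw') big_map scaler_suml; apply: eq_bigr => p _.
rewrite ruE htrivE scalerA /=; congr (bd_tgt H _ * _ *: _).
exact: bd_counit_act.
Qed.
Definition hrun : {linear htens M (htriv H) -> M} := mklin ru_lin.
Lemma hrunE m (c : htriv H) : hrun (hpure m c) = bd_tgt H c *: m.
Proof. exact: ruE. Qed.
Let rui (m : M) : htens M (htriv H) := hpure m ((1 : A) : htriv H).
Let ruiK : cancel hrun rui.
Proof.
have D : {morph rui : x y / x + y} by move=> x y; exact: hpureDl.
elim/htens_ind=> [|x y hx hy|m c]; first by rewrite raddf0 /rui hpure0l.
  by rewrite raddfD D hx hy.
rewrite hrunE /rui hpure_bal; congr hpure.
by rewrite htrivE -[bd_src H 1]mulr1 !bd_eps_src [bd_eps _]bd_counit1 !mulr1.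
Qed.
Let ruKi : cancel rui hrun.
Proof. by move=> m; rewrite hrunE bd_tgt1 scale1r. Qed.
Definition hruni : {linear M -> htens M (htriv H)} := mklin (can2_linear ruiK ruKi).
Lemma hruniE m : hruni m = hpure m ((1 : A) : htriv H). Proof. by []. Qed.
Lemma hrunK : lincomp hruni hrun = linid _.
Proof. by apply: linext => m; exact: ruiK. Qed.
Lemma hruniK : lincomp hrun hruni = linid _.
Proof. by apply: linext => m; exact: ruKi. Qed.
End Unitors.

Implicit Types M N P Q : lmodType H.
Lemma hmor1 M N : hmor (linid M) (linid N) = linid (htens M N).
Proof. by apply: htens_linext => m n; rewrite hmorE. Qed.
Lemma hmor_comp M M' M'' N N' N'' (f' : {linear M' -> M''}) (f : {linear M -> M'})
  (g' : {linear N' -> N''}) (g : {linear N -> N'}) :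
  hmor (lincomp f' f) (lincomp g' g) = lincomp (hmor f' g') (hmor f g).
Proof. by apply: htens_linext => m n; rewrite lincompE !hmorE. Qed.
Lemma hascK M N P : lincomp (hasci M N P) (hasc M N P) = linid _.
Proof. by apply: htens_linext3 => m n p; rewrite lincompE hascE hasciE. Qed.
Lemma hasciK M N P : lincomp (hasc M N P) (hasci M N P) = linid _.
Proof. by apply: htens_linext3r => m n p; rewrite lincompE hasciE hascE. Qed.
Lemma hasc_nat M M' N N' P P' (f : {linear M -> M'}) (g : {linear N -> N'})
  (h : {linear P -> P'}) :
  lincomp (hmor f (hmor g h)) (hasc M N P) = lincomp (hasc M' N' P') (hmor (hmor f g) h).
Proof. by apply: htens_linext3 => m n p; rewrite !lincompE hascE !hmorE hascE. Qed.
Lemma hlun_nat M N (f : {linear M -> N}) :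
  lincomp f (hlun M) = lincomp (hlun N) (hmor (linid _) f).
Proof. by apply: htens_linext => c m; rewrite !lincompE hmorE !hlunE linearZ. Qed.
Lemma hrun_nat M N (f : {linear M -> N}) :
  lincomp f (hrun M) = lincomp (hrun N) (hmor f (linid _)).
Proof. by apply: htens_linext => m c; rewrite !lincompE hmorE !hrunE linearZ. Qed.
Lemma htriangle M N :
  lincomp (hmor (linid M) (hlun N)) (hasc M (htriv H) N) = hmor (hrun M) (linid N).
Proof.
apply: htens_linext3 => m c n.
by rewrite lincompE hascE !hmorE hlunE hrunE hpure_bal.
Qed.
Lemma htens_linext4 M N P Q (R : lmodType H)
  (f g : {linear htens (htens (htens M N) P) Q -> R}) :
  (forall m n p q, f (hpure (hpure (hpure m n) p) q) = g (hpure (hpure (hpure m n) p) q)) ->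
  f = g.
Proof.
move=> fg; apply: htens_linext3 => t p q.
elim/htens_ind: t => [|x y hx hy|m n //]; first by rewrite !hpure0l !raddf0.
by rewrite !hpureDl !raddfD /= hx hy.
Qed.
Lemma hpentagon M N P Q :
  lincomp (hasc M N (htens P Q)) (hasc (htens M N) P Q) =
  lincomp (lincomp (hmor (linid M) (hasc N P Q)) (hasc M (htens N P) Q))
    (hmor (hasc M N P) (linid Q)).
Proof.
apply: htens_linext4 => m n p q.
by rewrite !lincompE hmorE !hascE hmorE hascE.
Qed.

Definition HMod : monoidal :=
  @Monoidal (lmod_cat H) (@htens K A H) (@hmor K A H) (htriv H)
    hasc hasci hlun hluni hrun hruni
    hmor1 hmor_comp hascK hasciK hlunK hluniK hrunK hruniK hasc_nat hlun_nat
    hrun_nat htriangle hpentagon.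
End ModuleMonoidal.

Section FreeModule.
Variables (K : fieldType) (A : algType K) (H : bialgebroid A).
Notation "'|' M" := (res (bd_eta H) M) (at level 20, only parsing).

Section Box.
Variable M : lmodType (env A).

(* H [x] M = H (x)_{A^e} M, as an H-module *)
Definition box : Type := tens (fun (x : env A) (d : H) => d * bd_eta H x) (fun (x : env A) (m : M) => x *: m).
HB.instance Definition _ := GRing.Zmodule.on box.
Definition boxp (d : H) (m : M) : box := pure _ _ d m.

Lemma boxpDl d d' m : boxp (d + d') m = boxp d m + boxp d' m.
Proof. exact: pureDl. Qed.
Lemma boxpDr d m m' : boxp d (m + m') = boxp d m + boxp d m'.
Proof. exact: pureDr. Qed.
Lemma boxp_bal x d m : boxp (d * bd_eta H x) m = boxp d (x *: m).
Proof. exact: pure_bal. Qed.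
Lemma box_ind (P : box -> Prop) :
  P 0 -> (forall x y, P x -> P y -> P (x + y)) -> (forall d m, P (boxp d m)) ->
  forall t, P t.
Proof. exact: tens_ind. Qed.

Let bs_bal (h : H) : balanced (fun (x : env A) (d : H) => d * bd_eta H x) (fun (x : env A) (m : M) => x *: m)
  (fun d m => boxp (h * d) m).
Proof. by split=> *; rewrite ?mulrDr ?boxpDl ?boxpDr // mulrA boxp_bal. Qed.
Let bs (h : H) (t : box) : box := tlift (bs_bal h) t.
Let bsE h d m : bs h (boxp d m) = boxp (h * d) m.
Proof. exact: tlift_pure. Qed.
Let bsDr : right_distributive bs +%R.
Proof. by move=> h t u; exact: (raddfD (tlift (bs_bal h))). Qed.
Let bs0 h : bs h 0 = 0.
Proof. exact: (raddf0 (tlift (bs_bal h))). Qed.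
Let bsA h h' t : bs h (bs h' t) = bs (h * h') t.
Proof.
elim/box_ind: t => [|x y hx hy|d m]; first by rewrite !bs0.
  by rewrite !bsDr hx hy.
by rewrite !bsE mulrA.
Qed.
Let bs1 : left_id 1 bs.
Proof.
elim/box_ind=> [|x y hx hy|d m]; first by rewrite bs0.
  by rewrite bsDr hx hy.
by rewrite bsE mul1r.
Qed.
Let bsDl t : {morph bs^~ t : g h / g + h}.
Proof.
move=> g h; elim/box_ind: t => [|x y hx hy|d m]; first by rewrite !bs0 addr0.
  by rewrite !bsDr hx hy addrACA.
by rewrite !bsE mulrDl boxpDl.
Qed.
HB.instance Definition _ := GRing.Zmodule_isLmodule.Build H box bsA bs1 bsDr bsDl.

Lemma scale_boxp h d m : h *: boxp d m = boxp (h * d) m.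
Proof. exact: bsE. Qed.
End Box.

(* the H-linear map H [x] M -> N, h (x) m |-> h f(m), of an A^e-linear f      *)
Section BoxMap.
Variables (M : lmodType (env A)) (N : lmodType H) (f : {linear M -> (| N)}).
Let g (d : H) (m : M) : N := d *: (f m : N).
Let g_bal : balanced (fun (x : env A) (d : H) => d * bd_eta H x) (fun (x : env A) (m : M) => x *: m) g.
Proof.
split=> [d d' m|d m m'|x d m]; rewrite /g ?scalerDl //.
  by rewrite raddfD; exact: scalerDr.
by rewrite linearZ -scalerA.
Qed.
Let bl (t : box M) : N := tlift g_bal t.
Let blE d m : bl (boxp d m) = d *: (f m : N). Proof. exact: tlift_pure. Qed.
Let blD : {morph bl : t u / t + u}. Proof. exact: (raddfD (tlift g_bal)). Qed.
Let bl0 : bl 0 = 0. Proof. exact: (raddf0 (tlift g_bal)). Qed.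
Let bl_lin : linear bl.
Proof.
move=> h t u; rewrite blD; congr (_ + _).
elim/box_ind: t => [|x y hx hy|d m]; first by rewrite scaler0 bl0 scaler0.
  by rewrite scalerDr !blD hx hy scalerDr.
by rewrite scale_boxp !blE scalerA.
Qed.
Definition box_lift : {linear box M -> N} := mklin bl_lin.
Lemma box_liftE d m : box_lift (boxp d m) = d *: (f m : N).
Proof. exact: blE. Qed.
End BoxMap.

Section BoxUnit.
Variable M : lmodType (env A).
Let bu (m : M) : (| (box M)) := boxp 1 m.
Let bu_lin : linear bu.
Proof.
move=> x m n; rewrite /bu boxpDr; congr (_ + _).
by rewrite resE scale_boxp mulr1 -boxp_bal mul1r.
Qed.
Definition box_unit : {linear M -> (| (box M))} := mklin bu_lin.
End BoxUnit.

Definition box_mor (M N : lmodType (env A)) (f : {linear M -> N}) :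
  {linear box M -> box N} := box_lift (lincomp (box_unit N) f).
Definition box_counit (N : lmodType H) : {linear box (| N) -> N} := box_lift (linid (| N)).

(* h (x) (m (x) n) |-> h ((1 (x) m) (x) (1 (x) n)) = (h_1 (x) m) (x) (h_2 (x) n) *)
Definition box_F2 (M N : lmodType (env A)) :
    {linear box (btens M N) -> htens (box M) (box N)} :=
  box_lift (lincomp (res_tensi (box M) (box N)) (btmor (box_unit M) (box_unit N))).
(* h (x) a |-> epsilon (h a) *)
Definition box_F0 : {linear box (regb A) -> htriv H} := box_lift (res_trivi H).

Definition free_adjunction : comonoidal_adjunction_data (Bimod A) (HMod H) :=
  @ComonoidalAdjunctionData (Bimod A) (HMod H) (fun M => box M : lmodType H) box_mor
    (fun N => (| (N : lmodType H)) : lmodType (env A)) (fun M N f => res_mor f)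
    box_unit box_counit box_F2 box_F0 (fun M N => res_tens M N) (res_triv H).

(* the bimonad H [x] - on A-bimodules *)
Definition box_bimonad : bimonad_data (Bimod A) :=
  cross_product free_adjunction (id_bimonad (HMod H)).
End FreeModule.
Arguments boxp {K A H M} d m.

Section CanonicalMaps.
Variables (K : fieldType) (A : algType K) (D : bialgebroid A).

(* D (x)_{A^op} D and D (.) D; the third quotient D <> D is |D (x)_A |D.      *)
Definition tens_op : zmodType :=
  tens (fun (s : A) (d : D) => d * bd_tgt D s) (fun (s : A) (d : D) => bd_tgt D s * d).
Definition pure_op (d d' : D) : tens_op := pure _ _ d d'.
Definition tens_dot : zmodType :=
  tens (fun (r : A) (d : D) => d * bd_src D r) (fun (r : A) (d : D) => bd_src D r * d).
Definition tens_dia : zmodType := btens (bd_bimod D) (bd_bimod D).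

Let bl (d d' : D) : tens_dia := bd_rmul 1 d' (bd_Delta d).
Let bl_bal : balanced (fun (s : A) (d : D) => d * bd_tgt D s) (fun (s : A) (d : D) => bd_tgt D s * d) bl.
Proof.
split=> [d d' e|d e e'|s d e]; rewrite /bl ?bd_DeltaD ?raddfD //.
- have [w ->] := bd_sum (bd_Delta d); rewrite !bd_rmul_sum -big_split.
  by apply: eq_bigr => p _; rewrite /= mulrDr bd_pureDr.
rewrite -[X in d * X]mul1r -[X in d * (X * _)](bd_src1 D) bd_Delta_act bd_rmulM.
by rewrite bd_src1 mulr1.
Qed.
(* d (x) d' |-> d_1 <> d_2 d' *)
Definition left_canonical : tens_op -> tens_dia := tlift bl_bal.
HB.instance Definition _ := GRing.Additive.copy left_canonical (tlift bl_bal).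
Lemma left_canonicalE d d' (w : seq (D * D)) :
  bd_Delta d = \sum_(p <- w) bd_pure p.1 p.2 ->
  left_canonical (pure_op d d') = \sum_(p <- w) bd_pure p.1 (p.2 * d').
Proof.
move=> hw; rewrite [LHS]tlift_pure /bl hw bd_rmul_sum.
by apply: eq_bigr => p _; rewrite mulr1.
Qed.

Let br (d d' : D) : tens_dia := bd_rmul d' 1 (bd_Delta d).
Let br_bal : balanced (fun (r : A) (d : D) => d * bd_src D r) (fun (r : A) (d : D) => bd_src D r * d) br.
Proof.
split=> [d d' e|d e e'|s d e]; rewrite /br ?bd_DeltaD ?raddfD //.
- have [w ->] := bd_sum (bd_Delta d); rewrite !bd_rmul_sum -big_split.
  by apply: eq_bigr => p _; rewrite /= mulrDr bd_pureDl.
rewrite -[X in d * X]mulr1 -[X in d * (_ * X)](bd_tgt1 D) bd_Delta_act bd_rmulM.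
by rewrite bd_tgt1 mulr1.
Qed.
(* d (.) d' |-> d_1 d' <> d_2 *)
Definition right_canonical : tens_dot -> tens_dia := tlift br_bal.
HB.instance Definition _ := GRing.Additive.copy right_canonical (tlift br_bal).
Lemma right_canonicalE d d' (w : seq (D * D)) :
  bd_Delta d = \sum_(p <- w) bd_pure p.1 p.2 ->
  right_canonical (pure _ _ d d') = \sum_(p <- w) bd_pure (p.1 * d') p.2.
Proof.
move=> hw; rewrite [LHS]tlift_pure /br hw bd_rmul_sum.
by apply: eq_bigr => p _; rewrite mulr1.
Qed.

Definition hopf_algebroid : Prop := bijective left_canonical /\ bijective right_canonical.
End CanonicalMaps.

(* A braided Hopf algebra B in the lax left center of the category of         *)
(* H-modules, in terms of elements.                                           *)
Section BraidedHopf.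
Variables (K : fieldType) (A : algType K) (H : bialgebroid A).
Variable B : lax_central_hopf (HMod H).

Definition bh_mod : lmodType H := lh_ob B.
Definition bh_mul (b c : bh_mod) : bh_mod :=
  (lh_mul B : {linear htens bh_mod bh_mod -> bh_mod}) (hpure b c).
Definition bh_one : bh_mod := (lh_one B : {linear htriv H -> bh_mod}) (1 : A).
Definition bh_Delta (b : bh_mod) : htens bh_mod bh_mod :=
  (lh_comul B : {linear bh_mod -> htens bh_mod bh_mod}) b.
Definition bh_eps (b : bh_mod) : A := (lh_counit B : {linear bh_mod -> htriv H}) b.
Definition bh_S (b : bh_mod) : bh_mod := (lh_antipode B : {linear bh_mod -> bh_mod}) b.
Definition bh_coact (b : bh_mod) : htens (H^o : lmodType H) bh_mod :=
  (lh_tau B (H^o : lmodType H) : {linear htens bh_mod H^o -> htens H^o bh_mod})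
    (hpure b (1 : H^o)).

(* B (x)_A H with H a left A-module by a . h = eta(a) h *)
Definition smash_carrier : lmodType (env A) := btens (res (bd_eta H) bh_mod) (bd_bimod H).
Definition smash (b : bh_mod) (h : H) : smash_carrier :=
  @bpure K A (res (bd_eta H) bh_mod) (bd_bimod H) b h.
End BraidedHopf.

(* Main.v *)
(* The composed monad is U Q F for the free-forgetful adjunction between
   A-bimodules and H-modules and Q = B (x)_A -. For any K-linear bimonad Q on
   H-modules, linear maps out of the regular module H are determined by the image
   of 1, so Q(H) is an algebra by Kleisli composition; it inherits a comonoid
   structure from H, which makes it a bialgebroid D, and
   d (x) m |-> Q(h |-> h (x) m)(d) is a morphism of bimonads D [x] M -> U Q F M,
   invertible for Q = B (x)_A -. The left fusion operator of U Q F is that of Q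
   after Q of the operator F(X (x) U N) -> F X (x) N, which is invertible because H
   is Hopf; that of Q is inverted by the antipode,
   (b (x) x) (x) (c (x) y) |-> (b_1 (x) b_2(-1) x) (x) (S(b_2(0)) c (x) y).
   The fusion operators of D [x] - at A^e are the canonical maps of D. *)

Require Import Defs.
From HB Require Import structures.
From mathcomp Require Import all_boot all_order all_algebra.
From mathcomp Require boolp.

Set Implicit Arguments.
Unset Strict Implicit.
Unset Printing Implicit Defensive.

Import GRing.Theory.
Local Open Scope ring_scope.

(** The bialgebroid axioms quantify over all expansions of the tensors involved, so a direct check
    on B ⊗ H would mix well-definedness over A with braiding and coaction. For Q(H) they become
    equations of H-linear maps out of H, tested at 1. K-linearity of Q makes the Kleisli product
    additive in its second factor and lets Q be applied termwise to an expansion of a coproduct.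

    The antipode inverts only the left fusion operator of B ⊗ -. The half-braiding need not be
    invertible, so invertibility of the right fusion operator comes from the assumption that B ⊗ -
    is a Hopf monad, which is made in the last clause of the theorem.

    The formula for the inverse of beta reflects the order in which two inverses compose: the one
    built from the antipode puts x = b_2(-1) h in the H-factor, then the inverse for H splits the
    whole product x into x_(+) and x_(-). The leg x_(-) acts on Q(H), which is left multiplication
    by 1_B ⊗ x_(-), so the second factor is (1_B ⊗ x_(-)) (S(b_2(0)) ⊗ 1). *)

Section Isomorphisms.
Local Open Scope cat_scope.
Variable C : category.

Lemma is_iso_comp (X Y Z : C) (g : mor Y Z) (f : mor X Y) :
  is_iso g -> is_iso f -> is_iso (g ∘ f).
Proof.
move=> [g' [g1 g2]] [f' [f1 f2]]; exists (f' ∘ g'); split.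
  by rewrite compmA -(compmA f') g1 compm1.
by rewrite compmA -(compmA g) f2 compm1.
Qed.

Lemma is_iso_cancell (X Y Z : C) (g : mor Y Z) (f : mor X Y) :
  is_iso g -> is_iso (g ∘ f) -> is_iso f.
Proof.
move=> [g' [g1 g2]] gf; rewrite -[f]comp1m -g1 -compmA.
by apply: is_iso_comp gf; exists g.
Qed.

End Isomorphisms.

Lemma is_iso_tmor (C : monoidal) (X X' Y Y' : C) (f : mor X X') (g : mor Y Y') :
  is_iso f -> is_iso g -> is_iso (f ⊗₁ g)%cat.
Proof.
move=> [f' [f1 f2]] [g' [g1 g2]]; exists (f' ⊗₁ g')%cat.
by rewrite -!tmor_comp f1 f2 g1 g2 !tmor1.
Qed.

(** * Comonoidal functors and cross products *)

Section ComonoidalFunctors.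
Local Open Scope cat_scope.

Definition functorial (C D : category) (F : C -> D)
    (Fm : forall X Y : C, mor X Y -> mor (F X) (F Y)) : Prop :=
  (forall X, Fm X X (idm X) = idm (F X)) /\
  (forall X Y Z (g : mor Y Z) (f : mor X Y), Fm X Z (g ∘ f) = Fm Y Z g ∘ Fm X Y f).

Definition comonoidal_functor (C D : monoidal) (F : C -> D)
    (Fm : forall X Y : C, mor X Y -> mor (F X) (F Y))
    (F2 : forall X Y : C, mor (F (X ⊗ Y)) (F X ⊗ F Y)) (F0 : mor (F 𝟙) 𝟙) : Prop :=
  functorial Fm /\
  (forall X X' Y Y' (f : mor X X') (g : mor Y Y'),
     F2 X' Y' ∘ Fm _ _ (f ⊗₁ g) = (Fm _ _ f ⊗₁ Fm _ _ g) ∘ F2 X Y) /\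
  (forall X Y Z,
     asc (F X) (F Y) (F Z) ∘ (F2 X Y ⊗₁ idm (F Z)) ∘ F2 (X ⊗ Y) Z =
     (idm (F X) ⊗₁ F2 Y Z) ∘ F2 X (Y ⊗ Z) ∘ Fm _ _ (asc X Y Z)) /\
  (forall X, lun (F X) ∘ (F0 ⊗₁ idm (F X)) ∘ F2 𝟙 X = Fm _ _ (lun X)) /\
  (forall X, run (F X) ∘ (idm (F X) ⊗₁ F0) ∘ F2 X 𝟙 = Fm _ _ (run X)).

Lemma tmor_compl (C : monoidal) (X Y Z W : C) (g : mor Y Z) (f : mor X Y) :
  (g ∘ f) ⊗₁ idm W = (g ⊗₁ idm W) ∘ (f ⊗₁ idm W).
Proof. by rewrite -tmor_comp comp1m. Qed.
Lemma tmor_compr (C : monoidal) (X Y Z W : C) (g : mor Y Z) (f : mor X Y) :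
  idm W ⊗₁ (g ∘ f) = (idm W ⊗₁ g) ∘ (idm W ⊗₁ f).
Proof. by rewrite -tmor_comp comp1m. Qed.

(** Composites associate to the left, so two adjacent arrows preceded by [z] do not form a subterm;
    [pre1] and [pre2] rewrite such a pair. *)
Lemma pre1 (C : category) (X Y Z W : C) (g : mor Y Z) (f : mor X Y) h (z : mor Z W) :
  g ∘ f = h -> z ∘ g ∘ f = z ∘ h.
Proof. by move=> e; rewrite -compmA e. Qed.
Lemma pre2 (C : category) (X Y Y' Z W : C) (g : mor Y Z) (f : mor X Y) (g' : mor Y' Z)
  (f' : mor X Y') (z : mor Z W) : g ∘ f = g' ∘ f' -> z ∘ g ∘ f = z ∘ g' ∘ f'.
Proof. by move=> e; rewrite -!compmA e. Qed.

Lemma comonoidal_functor_comp (C D E : monoidal) (F : C -> D) Fm F2 F0 (G : D -> E) Gm G2 G0 :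
  @comonoidal_functor C D F Fm F2 F0 -> @comonoidal_functor D E G Gm G2 G0 ->
  @comonoidal_functor C E (fun X => G (F X)) (fun X Y f => Gm _ _ (Fm _ _ f))
    (fun X Y => G2 (F X) (F Y) ∘ Gm _ _ (F2 X Y)) (G0 ∘ Gm _ _ F0).
Proof.
move=> [[F1 Fc] [Fn [Fa [Fl Fr]]]] [[G1 Gc] [Gn [Ga [Gl Gr]]]].
split; first by split=> *; rewrite ?F1 ?Fc.
split=> [X X' Y Y' f g|].
  by rewrite -compmA -Gc Fn Gc compmA Gn -compmA.
have Gnl (X Y Z : D) (f : mor X Y) :
    (Gm _ _ f ⊗₁ idm (G Z)) ∘ G2 X Z = G2 Y Z ∘ Gm _ _ (f ⊗₁ idm Z).
  by rewrite Gn G1.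
have Gnr (X Y Z : D) (f : mor X Y) :
    (idm (G Z) ⊗₁ Gm _ _ f) ∘ G2 Z X = G2 Z Y ∘ Gm _ _ (idm Z ⊗₁ f).
  by rewrite Gn G1.
split=> [X Y Z|].
  rewrite tmor_compl tmor_compr !compmA (pre2 _ (Gnl _ _ _ _)) (pre2 _ (Gnr _ _ _ _)).
  by rewrite Ga -!compmA -!Gc !compmA Fa.
by split=> X; rewrite (tmor_compl, tmor_compr) !compmA (pre2 _ (Gnl _ _ _ _), pre2 _ (Gnr _ _ _ _));
  rewrite (Gl, Gr) -!Gc (Fl, Fr).
Qed.

(** The source of the comonoid axioms of D: applied to Q and to restriction of scalars, it replaces
    any computation with coproducts of elements. *)
Lemma comonoidal_functor_comonoid (C D : monoidal) (F : C -> D) Fm F2 F0 :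
  @comonoidal_functor C D F Fm F2 F0 -> forall (X : C) (d : mor X (X ⊗ X)) (e : mor X 𝟙),
  is_comonoid d e -> is_comonoid (F2 X X ∘ Fm _ _ d) (F0 ∘ Fm _ _ e).
Proof.
move=> [[F1 Fc] [Fn [Fa [Fl Fr]]]] X d e [ca cl cr].
have Fnl (f : mor X (X ⊗ X)) : (Fm _ _ f ⊗₁ idm (F X)) ∘ F2 X X = F2 _ X ∘ Fm _ _ (f ⊗₁ idm X).
  by rewrite Fn F1.
have Fnr (f : mor X (X ⊗ X)) : (idm (F X) ⊗₁ Fm _ _ f) ∘ F2 X X = F2 X _ ∘ Fm _ _ (idm X ⊗₁ f).
  by rewrite Fn F1.
have Fnl0 (f : mor X 𝟙) : (Fm _ _ f ⊗₁ idm (F X)) ∘ F2 X X = F2 _ X ∘ Fm _ _ (f ⊗₁ idm X).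
  by rewrite Fn F1.
have Fnr0 (f : mor X 𝟙) : (idm (F X) ⊗₁ Fm _ _ f) ∘ F2 X X = F2 X _ ∘ Fm _ _ (idm X ⊗₁ f).
  by rewrite Fn F1.
split; rewrite ?tmor_compl ?tmor_compr !compmA.
- by rewrite (pre2 _ (Fnl _)) (pre2 _ (Fnr _)) Fa -!compmA -!Fc !compmA ca.
- by rewrite (pre2 _ (Fnl0 _)) Fl -!Fc cl F1.
by rewrite (pre2 _ (Fnr0 _)) Fr -!Fc cr F1.
Qed.

(** Needed because D is an A-bimodule both by restricting its H-action and by multiplication through
    its own unit map; the two are isomorphic by an identity map but are different objects. *)
Lemma is_comonoid_transport (C : monoidal) (X Y : C) (i : mor X Y) (j : mor Y X) d e :
  j ∘ i = idm X -> i ∘ j = idm Y -> is_comonoid d e ->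
  is_comonoid ((j ⊗₁ j) ∘ d ∘ i) (e ∘ i).
Proof.
move=> ji ij [ca cl cr].
have jl (Z : C) (f : mor Y Z) : ((f ∘ i) ⊗₁ idm X) ∘ (j ⊗₁ j) = f ⊗₁ j.
  by rewrite -tmor_comp comp1m -compmA ij compm1.
have jr (Z : C) (f : mor Y Z) : (idm X ⊗₁ (f ∘ i)) ∘ (j ⊗₁ j) = j ⊗₁ f.
  by rewrite -tmor_comp comp1m -compmA ij compm1.
split; rewrite !compmA (pre1 _ (jl _ _), pre1 _ (jr _ _)) ?jr.
- have -> : ((j ⊗₁ j) ∘ d) ⊗₁ j = ((j ⊗₁ j) ⊗₁ j) ∘ (d ⊗₁ idm Y).
    by rewrite -tmor_comp compm1.
  have -> : j ⊗₁ ((j ⊗₁ j) ∘ d) = (j ⊗₁ (j ⊗₁ j)) ∘ (idm Y ⊗₁ d).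
    by rewrite -tmor_comp compm1.
  by rewrite !compmA -asc_nat -[in RHS](compmA _ _ d) -ca !compmA.
- have -> : e ⊗₁ j = (idm 𝟙 ⊗₁ j) ∘ (e ⊗₁ idm Y) by rewrite -tmor_comp comp1m compm1.
  by rewrite !compmA -lun_nat -[j ∘ _ ∘ _]compmA -[j ∘ _ ∘ _]compmA cl compm1.
have -> : j ⊗₁ e = (j ⊗₁ idm 𝟙) ∘ (idm Y ⊗₁ e) by rewrite -tmor_comp comp1m compm1.
by rewrite !compmA -run_nat -[j ∘ _ ∘ _]compmA -[j ∘ _ ∘ _]compmA cr compm1.
Qed.

(** The last four fields say that unit and counit are comonoidal transformations. No invertibility
    of [adj_U2] or [adj_U0] is required here. *)
Record comonoidal_adjunction (C D : monoidal) (a : comonoidal_adjunction_data C D) : Prop :=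
  ComonoidalAdjunction {
  ca_F : comonoidal_functor (adj_Fmor a) (adj_F2 a) (adj_F0 a);
  ca_U : comonoidal_functor (adj_Umor a) (adj_U2 a) (adj_U0 a);
  ca_unit_nat : forall (X Y : C) (f : mor X Y),
    adj_Umor a (adj_Fmor a f) ∘ adj_unit a X = adj_unit a Y ∘ f;
  ca_counit_nat : forall (X Y : D) (f : mor X Y),
    f ∘ adj_counit a X = adj_counit a Y ∘ adj_Fmor a (adj_Umor a f);
  ca_zigzagF : forall X, adj_counit a (adj_F a X) ∘ adj_Fmor a (adj_unit a X) = idm _;
  ca_zigzagU : forall Y, adj_Umor a (adj_counit a Y) ∘ adj_unit a (adj_U a Y) = idm _;
  ca_unit2 : forall X Y, adj_U2 a _ _ ∘ adj_Umor a (adj_F2 a X Y) ∘ adj_unit a (X ⊗ Y) =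
    adj_unit a X ⊗₁ adj_unit a Y;
  ca_unit0 : adj_U0 a ∘ adj_Umor a (adj_F0 a) ∘ adj_unit a 𝟙 = idm 𝟙;
  ca_counit2 : forall X Y, (adj_counit a X ⊗₁ adj_counit a Y) ∘ adj_F2 a _ _ ∘
    adj_Fmor a (adj_U2 a X Y) = adj_counit a (X ⊗ Y);
  ca_counit0 : adj_F0 a ∘ adj_Fmor a (adj_U0 a) = adj_counit a 𝟙
}.

(** * The cross product bimonad U Q F and its fusion operators *)

Section CrossProduct.
Variables (C D : monoidal) (a : comonoidal_adjunction_data C D) (Q : bimonad_data D).
Hypotheses (ha : comonoidal_adjunction a) (hQ : is_bimonad Q).
Notation T := (cross_product a Q).
Notation F := (adj_F a).
Notation U := (adj_U a).
Notation Fm := (adj_Fmor a).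
Notation Um := (adj_Umor a).
Notation Qm := (bm_mor Q).
Notation eps := (adj_counit a).

Lemma bimonad_comonoidal_functor (E : monoidal) (R : bimonad_data E) :
  is_bimonad R -> comonoidal_functor (@bm_mor E R) (bm_T2 R) (bm_T0 R).
Proof. by case=> [[R1 [Rc _]] [h _]]. Qed.

Lemma cross_product_comonoidal :
  comonoidal_functor (@bm_mor C T) (bm_T2 T) (bm_T0 T).
Proof.
have hQF := comonoidal_functor_comp (ca_F ha) (bimonad_comonoidal_functor hQ).
exact: comonoidal_functor_comp hQF (ca_U ha).
Qed.

(** Naturality of the counit moves [eps] past morphisms until an axiom of Q applies. The unit laws
    use one triangle identity each; compatibility of T2 and T0 with multiplication and with unit
    uses comonoidality of the counit and of the unit of the adjunction. *)
Lemma cross_product_bimonad : is_bimonad T.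
Proof.
have [TF Tc] := cross_product_comonoidal.
case: hQ => [[Q1 [Qc [Qmu [Qeta [Qass [Qu1 Qu2]]]]]] [Qcom [Qmu2 [Qmu0 [Qeta2 Qeta0]]]]].
case: ha => [[[F1 Fc] _] [[U1 Uc] [U2n _]] un cn zF zU u2 u0 c2 c0].
have Q2n := Qcom.1.
split; [|split; [exact: Tc|]].
  split; first exact: TF.1.
  split; first exact: TF.2.
  split=> [X Y f|] /=.
    by rewrite -!Uc !compmA Qmu -(compmA (bm_mu Q _)) -Qc cn Qc compmA.
  split=> [X Y f|] /=.
    by rewrite compmA -Uc Qeta Uc -compmA un compmA.
  split=> [X|] /=.
    rewrite -!Uc; congr (Um _).
    by rewrite -compmA -Qc -cn !Qc !compmA Qass (pre2 _ (Qmu _ _ _)).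
  split=> X /=.
    rewrite -Uc -compmA -Qc Fc compmA -cn -[_ ∘ eps _ ∘ _]compmA zF compm1 Qu1; exact: U1.
  rewrite compmA -Uc -[_ ∘ Qm _ ∘ _]compmA Qeta compmA Qu2 comp1m; exact: zU.
have U2n' (X X' Y Y' : D) (f : mor X X') (g : mor Y Y') :
   (Um f ⊗₁ Um g) ∘ adj_U2 a X Y = adj_U2 a X' Y' ∘ Um (f ⊗₁ g) by rewrite U2n.
have Q2n' (X X' Y Y' : D) (f : mor X X') (g : mor Y Y') :
   (Qm f ⊗₁ Qm g) ∘ bm_T2 Q X Y = bm_T2 Q X' Y' ∘ Qm (f ⊗₁ g) by rewrite Q2n.
split=> [X Y|] /=.
  rewrite !compmA U2n' -!compmA -!Uc; congr (_ ∘ Um _).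
  rewrite !compmA tmor_comp (pre2 _ (Q2n' _ _ _ _ _ _)) Fc.
  rewrite -!compmA -!Qc. rewrite (compmA _ (adj_F2 _ _ _)) (compmA _ (Fm (adj_U2 _ _ _))) c2 -cn.
  by rewrite !Qc !compmA (pre2 _ (Qmu _ _ _)) Qmu2.
split=> [|] /=.
  rewrite -!compmA -!Uc; congr (_ ∘ Um _).
  rewrite Fc -!compmA -!Qc (compmA _ (Fm (adj_U0 _))) c0 -cn.
  by rewrite !Qc !compmA (pre2 _ (Qmu _ _ _)) Qmu0.
split=> [X Y|] /=.
  rewrite !compmA (pre1 _ (esym (Uc _ _ _ _ _))) -[_ ∘ Qm _ ∘ _]compmA Qeta compmA Qeta2.
  by rewrite Uc compmA -U2n' -!compmA [adj_U2 _ _ _ ∘ _]compmA u2 -tmor_comp.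
rewrite !compmA (pre1 _ (esym (Uc _ _ _ _ _))) -[_ ∘ Qm _ ∘ _]compmA Qeta compmA Qeta0.
by rewrite comp1m u0.
Qed.

(** The Hopf operators of the comonoidal adjunction. *)
Definition hopf_l (X : C) (N : D) : mor (F (X ⊗ U N)) (F X ⊗ N) :=
  (idm (F X) ⊗₁ eps N) ∘ adj_F2 a X (U N).
Definition hopf_r (N : D) (X : C) : mor (F (U N ⊗ X)) (N ⊗ F X) :=
  (eps N ⊗₁ idm (F X)) ∘ adj_F2 a (U N) X.

(** Naturality of [adj_U2] and then of [bm_T2] carries the counit contained in the multiplication of
    T under Q, where it meets [adj_F2] and forms [hopf_l]. *)
Lemma cross_product_left_fusion (X Y : C) :
  left_fusion T X Y =
  adj_U2 a _ _ ∘ Um (left_fusion Q (F X) (F Y) ∘ Qm (hopf_l X (Q (F Y)))).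
Proof.
case: hQ => [[Q1 [Qc _]] [[Q2n _] _]]; case: ha => [_ [[U1 Uc] [U2n _]] _ _ _ _ _ _ _ _].
rewrite /left_fusion /hopf_l /= -[idm (U _)]U1 compmA -U2n -!compmA -!Uc; congr (_ ∘ Um _).
rewrite Qc !compmA -[Qm (idm _ ⊗₁ _)]compm1.
by rewrite compm1 (pre2 _ (Q2n _ _ _ _ _ _)) Q1 -tmor_comp comp1m.
Qed.

Lemma cross_product_right_fusion (X Y : C) :
  right_fusion T X Y =
  adj_U2 a _ _ ∘ Um (right_fusion Q (F X) (F Y) ∘ Qm (hopf_r (Q (F X)) Y)).
Proof.
case: hQ => [[Q1 [Qc _]] [[Q2n _] _]]; case: ha => [_ [[U1 Uc] [U2n _]] _ _ _ _ _ _ _ _].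
rewrite /right_fusion /hopf_r /= -[idm (U _)]U1 compmA -U2n -!compmA -!Uc; congr (_ ∘ Um _).
by rewrite Qc !compmA (pre2 _ (Q2n _ _ _ _ _ _)) Q1 -tmor_comp comp1m.
Qed.
End CrossProduct.

Lemma functorial_is_iso (C D : category) (F : C -> D) Fm :
  @functorial C D F Fm -> forall (X Y : C) (f : mor X Y), is_iso f -> is_iso (Fm _ _ f).
Proof. by move=> [F1 Fc] X Y f [g [gf fg]]; exists (Fm _ _ g); rewrite -!Fc gf fg !F1. Qed.

(** [box_bimonad] is by definition a cross product with this bimonad, so the lemmas on cross
    products also describe D [x] -, whose fusion operators are then bare Hopf operators. *)
Lemma id_bimonadP (C : monoidal) : is_bimonad (id_bimonad C).
Proof.
split; first by do 6! (split; first by move=> *; rewrite /= ?comp1m ?compm1);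
  move=> *; rewrite /= comp1m.
split; first by do 3! (split; first by move=> *; rewrite /= ?tmor1 ?comp1m ?compm1);
  move=> *; rewrite /= tmor1 !compm1.
by do 3! (split; first by move=> *; rewrite /= ?tmor1 ?comp1m ?compm1); rewrite /= comp1m.
Qed.

Lemma left_fusion_id (C : monoidal) (X Y : C) : left_fusion (id_bimonad C) X Y = idm (X ⊗ Y).
Proof. by rewrite /left_fusion /= tmor1 comp1m. Qed.
Lemma right_fusion_id (C : monoidal) (X Y : C) : right_fusion (id_bimonad C) X Y = idm (X ⊗ Y).
Proof. by rewrite /right_fusion /= tmor1 comp1m. Qed.

(** * Invertibility of fusion operators along an isomorphism of bimonads *)

Section BimonadIso.
Variables (C : monoidal) (S T : bimonad_data C) (t : forall X, mor (S X) (T X)).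
Hypotheses (hS : is_bimonad S) (hT : is_bimonad T) (ht : bimonad_iso t).

(** The isomorphism conjugates one fusion operator into the other, by naturality and its
    compatibility with T2 and mu; the invertible [t X ⊗₁ t Y] is then cancelled. *)
Lemma bimonad_iso_left_fusion X Y :
  is_iso (left_fusion T X Y) -> is_iso (left_fusion S X Y).
Proof.
move=> hl; have [[S1 Sc] _] := bimonad_comonoidal_functor hS.
case: hT => [[T1 [Tc _]] [[T2n _] _]]; case: ht => [ti [tn [tmu [_ [t2 _]]]]].
apply: (is_iso_cancell (is_iso_tmor (ti X) (ti Y))).
have <- : left_fusion T X Y ∘ (t (X ⊗ T Y) ∘ bm_mor S (idm X ⊗₁ t Y)) =
    (t X ⊗₁ t Y) ∘ left_fusion S X Y.
  rewrite /left_fusion tn !compmA (pre2 _ (T2n _ _ _ _ _ _)) T1 -tmor_comp comp1m.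
  by rewrite (pre2 _ (t2 _ _)) -!tmor_comp tmu comp1m compm1.
apply: is_iso_comp hl _; apply: is_iso_comp (ti _) _.
by apply: (functorial_is_iso (conj S1 Sc)); apply: is_iso_tmor (ti Y); exists (idm X); rewrite comp1m.
Qed.

Lemma bimonad_iso_right_fusion X Y :
  is_iso (right_fusion T X Y) -> is_iso (right_fusion S X Y).
Proof.
move=> hl; have [[S1 Sc] _] := bimonad_comonoidal_functor hS.
case: hT => [[T1 [Tc _]] [[T2n _] _]]; case: ht => [ti [tn [tmu [_ [t2 _]]]]].
apply: (is_iso_cancell (is_iso_tmor (ti X) (ti Y))).
have <- : right_fusion T X Y ∘ (t (T X ⊗ Y) ∘ bm_mor S (t X ⊗₁ idm Y)) =
    (t X ⊗₁ t Y) ∘ right_fusion S X Y.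
  rewrite /right_fusion tn !compmA (pre2 _ (T2n _ _ _ _ _ _)) T1 -tmor_comp comp1m.
  by rewrite (pre2 _ (t2 _ _)) -!tmor_comp tmu comp1m compm1.
apply: is_iso_comp hl _; apply: is_iso_comp (ti _) _.
by apply: (functorial_is_iso (conj S1 Sc)); apply: is_iso_tmor (ti X) _; exists (idm Y); rewrite comp1m.
Qed.
End BimonadIso.
End ComonoidalFunctors.

Lemma lmod_is_iso (R : pzRingType) (X Y : lmod_cat R) (f : mor X Y) :
  is_iso f <-> bijective (f : {linear (X : lmodType R) -> (Y : lmodType R)}).
Proof.
split=> [[g [gf fg]]|[g gf fg]].
  exists (g : {linear (Y : lmodType R) -> (X : lmodType R)}).
    by move=> x; exact: (congr1 (fun h : {linear (X : lmodType R) -> (X : lmodType R)} => h x) gf).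
  by move=> x; exact: (congr1 (fun h : {linear (Y : lmodType R) -> (Y : lmodType R)} => h x) fg).
exists (mklin (can2_linear gf fg) : {linear (Y : lmodType R) -> (X : lmodType R)}).
by split; apply: linext => x; [exact: gf|exact: fg].
Qed.

Lemma regular_linext (R : nzRingType) (N : lmodType R) (f g : {linear R^o -> N}) :
  f 1 = g 1 -> f = g.
Proof.
move=> fg; apply: linext => x; have -> : x = x *: (1 : R^o) by rewrite [RHS]mulr1.
by rewrite !linearZ fg.
Qed.

(** * The free H-module adjunction *)

Section FreeAdjunction.
Variables (K : fieldType) (A : algType K) (H : bialgebroid A).
Notation "'|' M" := (res (bd_eta H) M) (at level 20, only parsing).

Lemma boxpE (M : lmodType (env A)) d (m : M) : boxp d m = d *: boxp (1 : H) m.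
Proof. by rewrite scale_boxp mulr1. Qed.

(** The elements 1 ⊗ m generate [box H M] over H. On them every structure map of the free functor is
    explicit, so its axioms need no coproduct of H. *)
Lemma box_linext (M : lmodType (env A)) (N : lmodType H) (f g : {linear box H M -> N}) :
  (forall m, f (boxp 1 m) = g (boxp 1 m)) -> f = g.
Proof.
move=> fg; apply: linext; elim/box_ind=> [|x y hx hy|d m]; first by rewrite !raddf0.
  by rewrite !raddfD /= hx hy.
by rewrite boxpE !linearZ fg.
Qed.

Lemma box_linext2 (M N : lmodType (env A)) (P : lmodType H) (f g : {linear box H (btens M N) -> P}) :
  (forall m n, f (boxp 1 (bpure m n)) = g (boxp 1 (bpure m n))) -> f = g.
Proof.
move=> fg; apply: box_linext; elim/btens_ind=> [|x y hx hy|//].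
  by rewrite [boxp _ _]pure0r !raddf0.
by rewrite boxpDr !raddfD /= hx hy.
Qed.

Lemma box_linext3 (M N P : lmodType (env A)) (R : lmodType H)
  (f g : {linear box H (btens (btens M N) P) -> R}) :
  (forall m n p, f (boxp 1 (bpure (bpure m n) p)) = g (boxp 1 (bpure (bpure m n) p))) -> f = g.
Proof.
move=> fg; apply: box_linext2 => t p; elim/btens_ind: t => [|x y hx hy|//].
  by rewrite bpure0l [boxp _ _]pure0r !raddf0.
by rewrite bpureDl boxpDr !raddfD /= hx hy.
Qed.

Lemma box_liftE1 (M : lmodType (env A)) (N : lmodType H) (f : {linear M -> (| N)}) m :
  box_lift f (boxp 1 m) = f m.
Proof. by rewrite box_liftE scale1r. Qed.

Lemma box_morE (M N : lmodType (env A)) (f : {linear M -> N}) m :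
  box_mor H f (boxp 1 m) = boxp 1 (f m).
Proof. by rewrite box_liftE1. Qed.

Lemma box_F2E (M N : lmodType (env A)) m n :
  box_F2 H M N (boxp 1 (bpure m n)) = hpure (boxp 1 m) (boxp 1 n).
Proof. by rewrite box_liftE1 lincompE [btmor _ _ _]btmorE. Qed.

Lemma box_counitE (N : lmodType H) (n : (| N)) : box_counit N (boxp 1 n) = n.
Proof. by rewrite box_liftE1. Qed.

(** [res_tens] and [res_triv] are identities of the underlying groups, so each axiom only says that
    a constraint of H-modules and the one of bimodules agree on pure tensors. *)
Lemma res_comonoidal_functor :
  @comonoidal_functor (HMod H) (Bimod A) (fun N => (| (N : lmodType H)) : lmodType (env A))
    (fun M N f => res_mor f) (fun M N => res_tens M N) (res_triv H).
Proof.
split; first by split=> *; apply: linext.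
split=> [M M' N N' f g|]; first exact: linext.
split=> [M N P|].
  apply: linext; elim/btens_ind=> [|x y hx hy|t p]; first by rewrite !raddf0.
    by rewrite [LHS]raddfD [RHS]raddfD; congr (_ + _).
  elim/btens_ind: t => [|x y hx hy|m n]; first by rewrite bpure0l !raddf0.
    by rewrite bpureDl [LHS]raddfD [RHS]raddfD; congr (_ + _).
  transitivity (basc _ _ _ (bpure (bpure (m : (| M)) (n : (| N))) (p : (| P)))).
    by congr (basc _ _ _ _); exact: (btmorE (res_tens M N) (linid (| P))).
  rewrite bascE; symmetry.
  transitivity (btmor (linid (| M)) (res_tens N P) (hpure m (hpure n p))); last exact: btmorE.
  by congr (btmor _ _ _); exact: hascE.
split=> [M|].
  apply: linext; elim/btens_ind=> [|x y hx hy|c m]; first by rewrite !raddf0.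
    by rewrite [LHS]raddfD [RHS]raddfD; congr (_ + _).
  transitivity (blun (| M) (bpure (c : regb A) m)).
    by congr (blun _ _); exact: (btmorE (res_triv H) (linid (| M))).
  by rewrite blunE; symmetry; exact: hlunE.
move=> M; apply: linext; elim/btens_ind=> [|x y hx hy|m c]; first by rewrite !raddf0.
  by rewrite [LHS]raddfD [RHS]raddfD; congr (_ + _).
transitivity (brun (| M) (bpure m (c : regb A))).
  by congr (brun _ _); exact: (btmorE (linid (| M)) (res_triv H)).
by rewrite brunE; symmetry; exact: hrunE.
Qed.

Lemma box_comonoidal_functor :
  @comonoidal_functor (Bimod A) (HMod H) (fun M => box H M : lmodType H) (@box_mor K A H)
    (@box_F2 K A H) (@box_F0 K A H).
Proof.
split; first split.
- by move=> M; apply: box_linext => m; rewrite [LHS]box_morE.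
- by move=> M N P g f; apply: box_linext => m; rewrite [LHS]box_morE [RHS]lincompE !box_morE.
split=> [M M' N N' f g|].
  apply: box_linext2 => m n.
  by rewrite [LHS]lincompE [RHS]lincompE box_morE box_F2E btmorE box_F2E hmorE !box_morE.
split=> [M N P|].
  apply: box_linext3 => m n p.
  rewrite [LHS]lincompE [RHS]lincompE box_morE box_F2E [asc M N P _]bascE.
  by rewrite [LHS]lincompE [RHS]lincompE box_F2E !hmorE !box_F2E [LHS]hascE.
split=> M; apply: box_linext2.
  move=> c m; rewrite box_morE [LHS]lincompE box_F2E [LHS]lincompE hmorE box_liftE1.
  by rewrite [LHS]hlunE [lun M _]blunE scale_boxp mulr1 -boxp_bal mul1r.
move=> m c; rewrite box_morE [LHS]lincompE box_F2E [LHS]lincompE hmorE box_liftE1.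
by rewrite [LHS]hrunE [run M _]brunE scale_boxp mulr1 -boxp_bal mul1r.
Qed.

Lemma free_adjunctionP : comonoidal_adjunction (free_adjunction H).
Proof.
split; [exact: box_comonoidal_functor|exact: res_comonoidal_functor|..].
- by move=> M N f; apply: linext => m; exact: box_morE.
- by move=> M N f; apply: box_linext => m; rewrite [LHS]lincompE [RHS]lincompE box_morE !box_counitE.
- by move=> M; apply: box_linext => m; rewrite [LHS]lincompE box_morE box_counitE.
- by move=> N; apply: linext => n; exact: box_counitE.
- by move=> M N; apply: btens_linext => m n; rewrite [RHS]btmorE; exact: box_F2E.
- by apply: linext => a; exact: (box_liftE1 (res_trivi H)).
- move=> M N; apply: box_linext => t; rewrite [LHS]lincompE box_morE [RHS]box_counitE.
  elim/btens_ind: t => [|x y hx hy|m n].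
  + by rewrite !raddf0 [boxp _ _]pure0r raddf0.
  + by rewrite [boxp _ _]pureDr [LHS]raddfD; congr (_ + _).
  by rewrite [LHS]lincompE box_F2E hmorE !box_counitE.
by apply: box_linext => a; rewrite [LHS]lincompE box_morE [RHS]box_counitE; exact: (box_liftE1 (res_trivi H)).
Qed.
End FreeAdjunction.

(** * Hopf operators and canonical maps *)

Lemma env1 (K : fieldType) (A : algType K) : envp 1 1 = 1 :> env A.
Proof. by []. Qed.

Section HopfOperators.
Variables (K : fieldType) (A : algType K) (H : bialgebroid A).
Notation "'|' M" := (res (bd_eta H) M) (at level 20, only parsing).
Notation src := (bd_src H).
Notation tgt := (bd_tgt H).

Definition hopf_lin_l (X : lmodType (env A)) (N : lmodType H) :
  {linear box H (btens X (| N)) -> htens (box H X) N} := hopf_l (free_adjunction H) X N.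
Definition hopf_lin_r (X : lmodType (env A)) (N : lmodType H) :
  {linear box H (btens (| N) X) -> htens N (box H X)} := hopf_r (free_adjunction H) N X.

Lemma hopf_lE (X : lmodType (env A)) (N : lmodType H) x n :
  hopf_lin_l X N
    (boxp 1 (bpure x n)) = hpure (boxp 1 x) n.
Proof.
by rewrite [LHS]lincompE (box_F2E _ x) [LHS]hmorE; congr hpure; exact: box_counitE.
Qed.

Lemma hopf_rE (X : lmodType (env A)) (N : lmodType H) n x :
  hopf_lin_r X N
    (boxp 1 (bpure n x)) = hpure n (boxp 1 x).
Proof.
by rewrite [LHS]lincompE (box_F2E _ _ x) [LHS]hmorE; congr hpure; exact: box_counitE.
Qed.

Lemma tens_op_ind (P : tens_op H -> Prop) :
  P 0 -> (forall x y, P x -> P y -> P (x + y)) -> (forall d e, P (pure_op d e)) ->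
  forall t, P t.
Proof. exact: tens_ind. Qed.

Lemma left_canonical_pure d e : left_canonical (pure_op d e) = bd_rmul 1 e (bd_Delta d) :> tens_dia H.
Proof. exact: tlift_pure. Qed.

Section OpAction.
Variables (a b : A) (c : H).
Let f (k l : H) : tens_op H := pure_op (k * src a) (src b * l * c).
Let f_bal : balanced (fun (s : A) (d : H) => d * tgt s) (fun (s : A) (d : H) => tgt s * d) f.
Proof.
split=> [k k' l|k l l'|s k l]; rewrite /f.
- by rewrite mulrDl [LHS]pureDl.
- by rewrite mulrDr mulrDl [LHS]pureDr.
rewrite -mulrA -bd_src_tgt mulrA [LHS]pure_bal; congr pure_op.
by rewrite !mulrA bd_src_tgt.
Qed.
(** The actions that survive the relations over A^op. Through [left_canonical] they become right
    multiplications on D <> D, and so the value of the inverse of beta at h eta(x) <> c is found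
    from its value at h <> 1. *)
Definition op_act : tens_op H -> tens_op H := tlift f_bal.
HB.instance Definition _ := GRing.Additive.copy op_act (tlift f_bal).
Lemma op_actE k l : op_act (pure_op k l) = pure_op (k * src a) (src b * l * c).
Proof. exact: tlift_pure. Qed.
Lemma left_canonical_op_act z :
  left_canonical (op_act z) = bd_rmul (tgt b * src a) c (left_canonical z).
Proof.
elim/tens_op_ind: z => [|x y hx hy|k l]; first by rewrite !raddf0.
  by rewrite !raddfD /= hx hy.
rewrite op_actE !left_canonical_pure bd_rmulM mul1r.
rewrite -[src a]mulr1 -(bd_tgt1 H) bd_Delta_act !bd_rmulM bd_tgt1 !mulr1 mul1r.
(* The Takeuchi condition trades [src b] to the right of k_2 for [tgt b] to the right of k_1. *)
have := congr1 (bd_rmul (src a) (l * c)) (takeuchi b k).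
by rewrite !bd_rmulM !mul1r !mulrA => ->.
Qed.
End OpAction.

(** * From an inverse of beta to an inverse of the left Hopf operator *)

Section LeftInsertion.
Variables (X : lmodType (env A)) (N : lmodType H).

Section Def.
Variables (x : X) (n : N).
Let f (k l : H) : box H (btens X (| N)) := boxp k (bpure x (l *: n : (| N))).
Let f_bal : balanced (fun (s : A) (d : H) => d * tgt s) (fun (s : A) (d : H) => tgt s * d) f.
Proof.
split=> [k k' l|k l l'|s k l]; rewrite /f ?boxpDl //.
- by rewrite scalerDl bpureDr boxpDr.
rewrite boxp_bal -scalerA; congr boxp; exact: ract_pure.
Qed.
(** Inserting x and n maps the source of beta to the source of the Hopf operator; [hopf_l_ins] shows
    that the Hopf operator is then beta followed by insertion in the target. *)
Definition ins_l : tens_op H -> box H (btens X (| N)) := tlift f_bal.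
HB.instance Definition _ := GRing.Additive.copy ins_l (tlift f_bal).
Lemma ins_lE k l : ins_l (pure_op k l) = boxp k (bpure x (l *: n : (| N))).
Proof. exact: tlift_pure. Qed.
End Def.

Lemma ins_lDl x x' n z : ins_l (x + x') n z = ins_l x n z + ins_l x' n z.
Proof.
elim/tens_op_ind: z => [|z z' hz hz'|k l]; first by rewrite !raddf0 addr0.
  by rewrite !raddfD /= hz hz' addrACA.
by rewrite !ins_lE bpureDl boxpDr.
Qed.
Lemma ins_lDr x n n' z : ins_l x (n + n') z = ins_l x n z + ins_l x n' z.
Proof.
elim/tens_op_ind: z => [|z z' hz hz'|k l]; first by rewrite !raddf0 addr0.
  by rewrite !raddfD /= hz hz' addrACA.
by rewrite !ins_lE scalerDr bpureDr boxpDr.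
Qed.
(** Actions on the tensor become actions on the inserted elements. The parameters a, b serve the
    relations over A^e between h and x, and c the relation over A between [box H X] and N. *)
Lemma ins_l_act a b c x n z :
  ins_l x n (op_act a b c z) = ins_l (envp a b *: x) (c *: n) z.
Proof.
elim/tens_op_ind: z => [|z z' hz hz'|k l]; first by rewrite !raddf0.
  by rewrite !raddfD /= hz hz'.
rewrite op_actE !ins_lE boxp_bal; congr boxp.
rewrite [LHS]lact_pure env_act; have -> : (src b * l * c) *: n = lact b (l *: (c *: n) : (| N)).
  by rewrite [RHS]scalerA scalerA.
by rewrite -bpure_bal lact_ract.
Qed.

Lemma hopf_l_ins x n z :
  hopf_lin_l X N (ins_l x n z) =
  hact2 (boxp 1 x : box H X) n (left_canonical z).
Proof.
elim/tens_op_ind: z => [|z z' hz hz'|k l]; first by rewrite !raddf0.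
  by rewrite [ins_l _ _ _]raddfD [LHS]raddfD [left_canonical _]raddfD [RHS]raddfD; congr (_ + _).
rewrite ins_lE boxpE [LHS]linearZZ hopf_lE hscale_pure left_canonical_pure.
by rewrite hact2_rmul scale1r.
Qed.

Variable LCi : tens_dia H -> tens_op H.
Hypotheses (LCK : cancel (@left_canonical K A H) LCi) (LCiK : cancel LCi (@left_canonical K A H)).

Let LCiD : {morph LCi : z z' / z + z'}.
Proof. by move=> z z'; rewrite -{1}(LCiK z) -{1}(LCiK z') -raddfD LCK. Qed.
Let LCi0 : LCi 0 = 0.
Proof. by rewrite -[in LHS](raddf0 (@left_canonical K A H)) LCK. Qed.

(** Start of the inverse (h ⊗ x) ⊗ n |-> h_(+) ⊗ (x ⊗ h_(-) n), which is lifted over A^e in (h, x)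
    and then over A. *)
Let g1 (n : N) (h : H) (x : X) : box H (btens X (| N)) := ins_l x n (LCi (bd_pure h 1)).
Let LCi_act a b c h : LCi (bd_pure (h * bd_eta H (envp a b)) c) = op_act a b c (LCi (bd_pure h 1)).
Proof.
apply: (can_inj LCK); rewrite LCiK left_canonical_op_act LCiK bd_rmulE mul1r bd_etaE.
by rewrite bd_src_tgt.
Qed.
Let g1_bal n : balanced (fun (x : env A) (d : H) => d * bd_eta H x) (fun (x : env A) (m : X) => x *: m) (g1 n).
Proof.
split=> [h h' x|h x x'|e h x]; rewrite /g1.
- by rewrite bd_pureDl LCiD raddfD.
- exact: ins_lDl.
elim/env_ind: e => [|e e' he he'|a b].
- rewrite raddf0 mulr0 scale0r [bd_pure _ _]pure0l LCi0 raddf0.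
  by apply: (@addrI _ (ins_l 0 n (LCi (bd_pure h 1)))); rewrite -ins_lDl !addr0.
- by rewrite raddfD mulrDr bd_pureDl LCiD raddfD /= he he' scalerDl ins_lDl.
by rewrite LCi_act ins_l_act scale1r.
Qed.
Let g2 (t : box H X) (n : N) : box H (btens X (| N)) := tlift (g1_bal n) t.
Let g2E h x n : g2 (boxp h x) n = ins_l x n (LCi (bd_pure h 1)).
Proof. exact: tlift_pure. Qed.
Let g2_bal : bbalanced (fun (t : (| (box H X))) (n : (| N)) => g2 t n).
Proof.
split=> [t t' n|t n n'|a t n]; first exact: (raddfD (tlift (g1_bal n))).
  elim/box_ind: t => [|t t' ht ht'|h x]; rewrite /g2; first by rewrite !raddf0 addr0.
    by rewrite !raddfD /= -!/(g2 _ _) ht ht' addrACA.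
  by rewrite -!/(g2 _ _) !g2E ins_lDr.
elim/box_ind: t => [|t t' ht ht'|h x]; rewrite /g2.
- by rewrite ract0 !raddf0.
- by rewrite ractD !raddfD /=; congr (_ + _).
rewrite -!/(g2 _ _) -[ract a _]/(tgt a *: boxp h x) scale_boxp !g2E.
(* In D <> D the factor \bar a moves from the left of h to the 1 in the second place, and so ends up
   to the right of h_(-), where it acts on n. *)
have -> : LCi (bd_pure (tgt a * h) 1) = op_act 1 1 (src a) (LCi (bd_pure h 1)).
  by rewrite -LCi_act [bd_pure (tgt a * h) _]bd_pure_bal env1 rmorph1 !mulr1.
by rewrite ins_l_act env1 scale1r.
Qed.
Let g (t : htens (box H X) N) : box H (btens X (| N)) := blift g2_bal t.
Let gD : {morph g : t t' / t + t'}. Proof. exact: (raddfD (blift g2_bal)). Qed.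
Let g0 : g 0 = 0. Proof. exact: (raddf0 (blift g2_bal)). Qed.
Let gE h x n : g (hpure (boxp h x) n) = ins_l x n (LCi (bd_pure h 1)).
Proof. by rewrite [LHS]blift_pure g2E. Qed.
Let g_hact2 x n z : g (hact2 (boxp 1 x : box H X) n z) = ins_l x n (LCi z).
Proof.
elim/bd_ind: z => [|z z' hz hz'|k l].
- by rewrite [hact2 _ _ _]raddf0 LCi0 [RHS]raddf0 g0.
- by rewrite [hact2 _ _ _]raddfD LCiD [RHS]raddfD gD; congr (_ + _).
rewrite [hact2 _ _ _]hact2E scale_boxp mulr1 gE -[l in RHS]mul1r -[k in RHS]mulr1.
by rewrite -[X in LCi (bd_pure (_ * X) _)](rmorph1 (bd_eta H)) mul1r LCi_act ins_l_act env1 scale1r.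
Qed.

Lemma hopf_l_is_iso : is_iso (hopf_l (free_adjunction H) X N).
Proof.
suff: bijective (hopf_lin_l X N) by move/lmod_is_iso.
exists g.
  elim/box_ind=> [|t t' ht ht'|h t].
  - by rewrite raddf0 g0.
  - by rewrite raddfD gD; congr (_ + _).
  elim/btens_ind: t => [|t t' ht ht'|x n].
  - by rewrite [boxp _ _]pure0r raddf0 g0.
  - by rewrite [boxp _ _]pureDr raddfD gD; congr (_ + _).
  (* Every generator is the insertion of h ⊗ 1, so [hopf_l_ins] reduces the claim to [LCK]. *)
  have -> : boxp h (bpure x n) = ins_l x n (pure_op h 1) by rewrite ins_lE scale1r.
  by rewrite [X in g X]hopf_l_ins g_hact2 LCK.
elim/htens_ind=> [|t t' ht ht'|t n]; first by rewrite g0 raddf0.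
  by rewrite gD raddfD; congr (_ + _).
elim/box_ind: t => [|t t' ht ht'|h x]; first by rewrite hpure0l g0 raddf0.
  by rewrite hpureDl gD raddfD; congr (_ + _).
by rewrite gE [LHS]hopf_l_ins LCiK hact2E scale_boxp mulr1 scale1r.
Qed.
End LeftInsertion.

(** * The left canonical map recovered from the Hopf operator at A^e *)

Section Regular.
Let E : lmodType (env A) := (env A)^o.
Let lone : E := (1 : env A).

Let u0 (x : E) : (| (H^o : lmodType H)) := bd_eta H x.
Let u0_lin : linear u0.
Proof. by move=> x y z; rewrite /u0 raddfD /= rmorphM. Qed.
Definition box_env : {linear box H E -> H^o} := box_lift (mklin u0_lin).
Lemma box_envE d x : box_env (boxp d x) = d * bd_eta H x.
Proof. exact: box_liftE. Qed.
Lemma box_envK t : boxp (box_env t) lone = t.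
Proof.
elim/box_ind: t => [|t t' ht ht'|d x]; first by rewrite raddf0 [LHS]pure0l.
  by rewrite raddfD boxpDl ht ht'.
by rewrite box_envE boxp_bal [_ *: _]mulr1.
Qed.

Lemma hact2_box_env_bij :
  bijective (hact2 (boxp 1 lone : box H E) (boxp 1 lone : box H E)).
Proof.
have uE d : box_env (boxp d lone) = d by rewrite box_envE rmorph1 mulr1.
exists (fun t => hmor box_env box_env t : tens_dia H) => t.
  elim/bd_ind: t => [|t t' ht ht'|d e]; first by rewrite !raddf0.
    by rewrite !raddfD; congr (_ + _).
  by rewrite [hact2 _ _ _]hact2E hmorE !scale_boxp !mulr1 !uE.
elim/htens_ind: t => [|t t' ht ht'|s t]; first by rewrite !raddf0.
  by rewrite !raddfD; congr (_ + _).
by rewrite hmorE [LHS]hact2E !scale_boxp !mulr1 !box_envK.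
Qed.

Section InsInverse.
(** The inverse of insertion at A^e. Since a\bar b ⊗ t = a (1 ⊗ b t), the element d ⊗ (a\bar b ⊗ t)
    comes from d a ⊗ b t. Three quotients are crossed: [f3] is lifted over K, [f2] over A and [f1]
    over A^e. *)
Let f3 (d : H) (t : box H E) (a b : A) : tens_op H := pure_op (d * src a) (src b * box_env t).
(** D ⊗ D is balanced over \bar A here, so a scalar can cross the tensor sign only when written as a
    target element. *)
Let srcZ (k : K) a : src (k *: a) = src a * tgt (k *: 1).
Proof. by rewrite /bd_src /bd_tgt -rmorphM envpM !mulr1 envpZ. Qed.
Let f3_bal d t : balanced (fun (k : K) (a : A) => k *: a) (fun (k : K) (a : A) => k *: a) (f3 d t).
Proof.
split=> [a a' b|a b b'|k a b]; rewrite /f3.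
- by rewrite /bd_src envpDl raddfD mulrDr [LHS]pureDl.
- by rewrite /bd_src envpDl raddfD mulrDl [LHS]pureDr.
by rewrite !srcZ mulrA [LHS]pure_bal mulrA bd_src_tgt.
Qed.
Let f2 d (e : E) (t : (| (box H E))) : tens_op H := tlift (f3_bal d t) (e : env A).
Let f2E d a b t : f2 d (envp a b) t = pure_op (d * src a) (src b * box_env t).
Proof. exact: tlift_pure. Qed.
Let f2Dl d t : {morph (fun e : env A => f2 d e t) : e e' / e + e'}.
Proof. exact: (raddfD (tlift (f3_bal d t))). Qed.
Let f20l d t : f2 d (0 : env A) t = 0.
Proof. exact: (raddf0 (tlift (f3_bal d t))). Qed.
Let f2Dr d e : {morph f2 d e : t t' / t + t'}.
Proof.
move=> t t'; elim/env_ind: e => [|e e' he he'|a b]; first by rewrite !f20l addr0.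
  by rewrite !f2Dl he he' addrACA.
by rewrite !f2E raddfD mulrDr [LHS]pureDr.
Qed.
Let f2_bal d : bbalanced (f2 d).
Proof.
split=> [e e' t|e t t'|c e t]; [exact: f2Dl|exact: f2Dr|].
elim/env_ind: e => [|e e' he he'|a b]; first by rewrite ract0 !f20l.
  by rewrite ractD !f2Dl he he'.
rewrite [ract _ _]envpM mul1r !f2E; congr pure_op.
by rewrite [lact _ _]resE linearZ mulrA -rmorphM envpM mulr1.
Qed.
Let f1 (d : H) (t : btens E (| (box H E))) : tens_op H := blift (f2_bal d) t.
Let f1E d e t : f1 d (bpure e t) = f2 d e t. Proof. exact: blift_pure. Qed.
Let f1Dr d : {morph f1 d : t t' / t + t'}. Proof. exact: (raddfD (blift (f2_bal d))). Qed.
Let f10r d : f1 d 0 = 0. Proof. exact: (raddf0 (blift (f2_bal d))). Qed.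
Let f1Dl t : {morph f1^~ t : d d' / d + d'}.
Proof.
move=> d d'; elim/btens_ind: t => [|t t' ht ht'|e t]; first by rewrite !f10r addr0.
  by rewrite !f1Dr ht ht' addrACA.
rewrite !f1E; elim/env_ind: e => [|e e' he he'|a b]; first by rewrite !f20l addr0.
  by rewrite !f2Dl he he' addrACA.
by rewrite !f2E mulrDl [LHS]pureDl.
Qed.
Let f10l t : f1 0 t = 0.
Proof. by apply: (@addrI _ (f1 0 t)); rewrite -f1Dl !addr0. Qed.
Let f1_bal : balanced (fun (x : env A) (d : H) => d * bd_eta H x) (fun (x : env A) (t : btens E (| (box H E))) => x *: t) f1.
Proof.
split=> [d d' t|d t t'|x d t]; [exact: f1Dl|exact: f1Dr|].
elim/env_ind: x => [|x x' hx hx'|p q]; first by rewrite raddf0 mulr0 scale0r f10r f10l.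
  by rewrite raddfD mulrDr f1Dl hx hx' scalerDl f1Dr.
elim/btens_ind: t => [|t t' ht ht'|e t]; first by rewrite scaler0 !f10r.
  by rewrite scalerDr !f1Dr ht ht'.
rewrite env_act ract_pure lact_pure !f1E.
elim/env_ind: e => [|e e' he he'|a b]; first by rewrite lact0 !f20l.
  by rewrite lactD !f2Dl he he'.
rewrite [lact _ _]envpM mulr1 !f2E bd_etaE.
have -> : src (p * a) = src p * src a by rewrite -rmorphM envpM mulr1.
rewrite -!mulrA -[tgt q * src a]bd_src_tgt !mulrA [LHS]pure_bal; congr pure_op.
by rewrite [ract _ _]resE linearZ mulrA -bd_src_tgt mulrA.
Qed.
Let f (t : box H (btens E (| (box H E)))) : tens_op H := tlift f1_bal t.
Let fE d e t : f (boxp d (bpure e t)) = f2 d e t.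
Proof. by rewrite [LHS]tlift_pure f1E. Qed.

Lemma ins_l_env_bij : bijective (@ins_l E (box H E) lone (boxp 1 lone)).
Proof.
have fD : {morph f : t t' / t + t'} by exact: (raddfD (tlift f1_bal)).
have f0 : f 0 = 0 by exact: (raddf0 (tlift f1_bal)).
exists f => t.
  elim/tens_op_ind: t => [|t t' ht ht'|d e]; first by rewrite raddf0 f0.
    by rewrite raddfD fD; congr (_ + _).
  rewrite ins_lE fE [lone](env1 A) f2E !(bd_src1, mulr1, mul1r); congr pure_op.
  by rewrite scale_boxp mulr1 box_envE rmorph1 mulr1.
elim/box_ind: t => [|t t' ht ht'|d t]; first by rewrite f0 raddf0.
  by rewrite fD raddfD; congr (_ + _).
elim/btens_ind: t => [|t t' ht ht'|e t]; first by rewrite [boxp d _]pure0r f0 raddf0.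
  by rewrite [boxp d _]pureDr fD raddfD; congr (_ + _).
rewrite fE; elim/env_ind: e => [|e e' he he'|a b].
- by rewrite f20l [LHS]raddf0 bpure0l [RHS]pure0r.
- by rewrite f2Dl [LHS]raddfD bpureDl boxpDr; congr (_ + _).
rewrite f2E ins_lE boxp_bal; congr boxp.
have -> : (src b * box_env t) *: boxp 1 lone = lact b (t : (| (box H E))).
  by rewrite -scalerA scale_boxp mulr1 box_envK.
rewrite [LHS]lact_pure -bpure_bal; congr bpure.
by rewrite [LHS]scalerA [LHS]mulr1 envpM !mul1r.
Qed.
End InsInverse.

(** For X = A^e and N = H ⊗ A^e over A^e, insertion at 1 is bijective both in the source and in the
    target of the Hopf operator, so [hopf_l_ins] identifies beta with that operator. *)
Lemma left_canonical_bij :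
  is_iso (left_fusion (box_bimonad H) E E) -> bijective (@left_canonical K A H).
Proof.
rewrite (cross_product_left_fusion (free_adjunctionP H) (id_bimonadP _)) left_fusion_id comp1m.
move=> /lmod_is_iso hl; have {}hl : bijective (hopf_lin_l E (box H E)) by exact: hl.
have e t : hact2 (boxp 1 lone : box H E) (boxp 1 lone : box H E) (left_canonical t) =
  hopf_lin_l E (box H E) (ins_l lone (boxp 1 lone) t) by rewrite hopf_l_ins.
have [g gK Kg] := hact2_box_env_bij.
apply: (@eq_bij _ _ (g \o (hopf_lin_l E (box H E) \o ins_l lone (boxp 1 lone)))).
  apply: bij_comp; first by exists (hact2 (boxp 1 lone : box H E) (boxp 1 lone : box H E)).
  exact: bij_comp hl ins_l_env_bij.
move=> t; rewrite -[LHS]/(g (hopf_lin_l E (box H E) (ins_l lone (boxp 1 lone) t))).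
by rewrite -e gK.
Qed.
End Regular.
End HopfOperators.
Arguments box_env {K A H}.

(** * The right Hopf operator and the right canonical map, by the mirrored argument *)

Section RightHopfOperators.
Variables (K : fieldType) (A : algType K) (H : bialgebroid A).
Notation "'|' M" := (res (bd_eta H) M) (at level 20, only parsing).
Notation src := (bd_src H).
Notation tgt := (bd_tgt H).

Definition pure_dot (d e : H) : tens_dot H := pure _ _ d e.

Lemma tens_dot_ind (P : tens_dot H -> Prop) :
  P 0 -> (forall x y, P x -> P y -> P (x + y)) -> (forall d e, P (pure_dot d e)) ->
  forall t, P t.
Proof. exact: tens_ind. Qed.

Lemma right_canonical_pure d e :
  right_canonical (pure_dot d e) = bd_rmul e 1 (bd_Delta d) :> tens_dia H.
Proof. exact: tlift_pure. Qed.

Section DotAction.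
Variables (a b : A) (c : H).
Let f (k l : H) : tens_dot H := pure_dot (k * tgt b) (tgt a * l * c).
Let f_bal : balanced (fun (s : A) (d : H) => d * src s) (fun (s : A) (d : H) => src s * d) f.
Proof.
split=> [k k' l|k l l'|s k l]; rewrite /f.
- by rewrite mulrDl [LHS]pureDl.
- by rewrite mulrDr mulrDl [LHS]pureDr.
rewrite -mulrA bd_src_tgt mulrA [LHS]pure_bal; congr pure_dot.
by rewrite !mulrA bd_src_tgt.
Qed.
(** The relations are now over A, so the surviving actions of a and b are by target elements. *)
Definition dot_act : tens_dot H -> tens_dot H := tlift f_bal.
HB.instance Definition _ := GRing.Additive.copy dot_act (tlift f_bal).
Lemma dot_actE k l : dot_act (pure_dot k l) = pure_dot (k * tgt b) (tgt a * l * c).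
Proof. exact: tlift_pure. Qed.
Lemma right_canonical_dot_act z :
  right_canonical (dot_act z) = bd_rmul c (src a * tgt b) (right_canonical z).
Proof.
elim/tens_dot_ind: z => [|x y hx hy|k l]; first by rewrite !raddf0.
  by rewrite !raddfD /= hx hy.
rewrite dot_actE !right_canonical_pure bd_rmulM mul1r.
rewrite -[tgt b in LHS]mul1r -(bd_src1 H) bd_Delta_act !bd_rmulM bd_src1 !mulr1 mul1r.
have := congr1 (bd_rmul (l * c) (tgt b)) (takeuchi a k).
by rewrite !bd_rmulM !mul1r !mulrA => ->.
Qed.
End DotAction.

Section RightInsertion.
Variables (X : lmodType (env A)) (N : lmodType H).

Section Def.
Variables (n : N) (x : X).
Let f (k l : H) : box H (btens (| N) X) := boxp k (bpure (l *: n : (| N)) x).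
Let f_bal : balanced (fun (s : A) (d : H) => d * src s) (fun (s : A) (d : H) => src s * d) f.
Proof.
split=> [k k' l|k l l'|s k l]; rewrite /f ?boxpDl //.
- by rewrite scalerDl bpureDl boxpDr.
rewrite boxp_bal -scalerA; congr boxp; exact: lact_pure.
Qed.
Definition ins_r : tens_dot H -> box H (btens (| N) X) := tlift f_bal.
HB.instance Definition _ := GRing.Additive.copy ins_r (tlift f_bal).
Lemma ins_rE k l : ins_r (pure_dot k l) = boxp k (bpure (l *: n : (| N)) x).
Proof. exact: tlift_pure. Qed.
End Def.

Lemma ins_rDr n x x' z : ins_r n (x + x') z = ins_r n x z + ins_r n x' z.
Proof.
elim/tens_dot_ind: z => [|z z' hz hz'|k l]; first by rewrite !raddf0 addr0.
  by rewrite !raddfD /= hz hz' addrACA.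
by rewrite !ins_rE bpureDr boxpDr.
Qed.
Lemma ins_rDl n n' x z : ins_r (n + n') x z = ins_r n x z + ins_r n' x z.
Proof.
elim/tens_dot_ind: z => [|z z' hz hz'|k l]; first by rewrite !raddf0 addr0.
  by rewrite !raddfD /= hz hz' addrACA.
by rewrite !ins_rE scalerDr bpureDl boxpDr.
Qed.
Lemma ins_r_act a b c n x z :
  ins_r n x (dot_act a b c z) = ins_r (c *: n) (envp a b *: x) z.
Proof.
elim/tens_dot_ind: z => [|z z' hz hz'|k l]; first by rewrite !raddf0.
  by rewrite !raddfD /= hz hz'.
rewrite dot_actE !ins_rE boxp_bal; congr boxp.
rewrite [LHS]ract_pure env_act; have -> : (tgt a * l * c) *: n = ract a (l *: (c *: n) : (| N)).
  by rewrite [RHS]scalerA scalerA.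
by rewrite bpure_bal.
Qed.

Lemma hopf_r_ins n x z :
  hopf_lin_r X N (ins_r n x z) = hact2 n (boxp 1 x : box H X) (right_canonical z).
Proof.
elim/tens_dot_ind: z => [|z z' hz hz'|k l]; first by rewrite !raddf0.
  by rewrite [ins_r _ _ _]raddfD [LHS]raddfD [right_canonical _]raddfD [RHS]raddfD; congr (_ + _).
rewrite ins_rE boxpE [LHS]linearZZ hopf_rE hscale_pure right_canonical_pure.
by rewrite hact2_rmul scale1r.
Qed.

Variable RCi : tens_dia H -> tens_dot H.
Hypotheses (RCK : cancel (@right_canonical K A H) RCi) (RCiK : cancel RCi (@right_canonical K A H)).

Let RCiD : {morph RCi : z z' / z + z'}.
Proof. by move=> z z'; rewrite -{1}(RCiK z) -{1}(RCiK z') -raddfD RCK. Qed.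
Let RCi0 : RCi 0 = 0.
Proof. by rewrite -[in LHS](raddf0 (@right_canonical K A H)) RCK. Qed.

(** Here h stands in the second tensor factor of the target, so the inverse is governed by the
    preimage of 1 <> h rather than h <> 1. *)
Let g1 (n : N) (h : H) (x : X) : box H (btens (| N) X) := ins_r n x (RCi (bd_pure 1 h)).
Let RCi_act a b c h : RCi (bd_pure c (h * bd_eta H (envp a b))) = dot_act a b c (RCi (bd_pure 1 h)).
Proof.
by apply: (can_inj RCK); rewrite RCiK right_canonical_dot_act RCiK bd_rmulE mul1r bd_etaE.
Qed.
Let g1_bal n : balanced (fun (x : env A) (d : H) => d * bd_eta H x) (fun (x : env A) (m : X) => x *: m) (g1 n).
Proof.
split=> [h h' x|h x x'|e h x]; rewrite /g1.
- by rewrite bd_pureDr RCiD raddfD.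
- exact: ins_rDr.
elim/env_ind: e => [|e e' he he'|a b].
- rewrite raddf0 mulr0 scale0r [bd_pure _ _]pure0r RCi0 raddf0.
  by apply: (@addrI _ (ins_r n 0 (RCi (bd_pure 1 h)))); rewrite -ins_rDr !addr0.
- by rewrite raddfD mulrDr bd_pureDr RCiD raddfD /= he he' scalerDl ins_rDr.
by rewrite RCi_act ins_r_act scale1r.
Qed.
Let g2 (n : N) (t : box H X) : box H (btens (| N) X) := tlift (g1_bal n) t.
Let g2E n h x : g2 n (boxp h x) = ins_r n x (RCi (bd_pure 1 h)).
Proof. exact: tlift_pure. Qed.
Let g2_bal : bbalanced (fun (n : (| N)) (t : (| (box H X))) => g2 n t).
Proof.
split=> [n n' t|n t t'|a n t]; last 1 first.
- elim/box_ind: t => [|t t' ht ht'|h x]; rewrite /g2.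
  + by rewrite lact0 !raddf0.
  + by rewrite lactD !raddfD /=; congr (_ + _).
  rewrite -!/(g2 _ _) -[lact a _]/(src a *: boxp h x) scale_boxp !g2E.
  have -> : RCi (bd_pure 1 (src a * h)) = dot_act 1 1 (tgt a) (RCi (bd_pure 1 h)).
    by rewrite -RCi_act -bd_pure_bal env1 rmorph1 !mulr1.
  by rewrite ins_r_act env1 scale1r.
- elim/box_ind: t => [|t t' ht ht'|h x]; rewrite /g2; first by rewrite !raddf0 addr0.
    by rewrite !raddfD /= -!/(g2 _ _) ht ht' addrACA.
  by rewrite -!/(g2 _ _) !g2E ins_rDl.
exact: (raddfD (tlift (g1_bal n))).
Qed.
Let g (t : htens N (box H X)) : box H (btens (| N) X) := blift g2_bal t.
Let gD : {morph g : t t' / t + t'}. Proof. exact: (raddfD (blift g2_bal)). Qed.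
Let g0 : g 0 = 0. Proof. exact: (raddf0 (blift g2_bal)). Qed.
Let gE n h x : g (hpure n (boxp h x)) = ins_r n x (RCi (bd_pure 1 h)).
Proof. by rewrite [LHS]blift_pure g2E. Qed.
Let g_hact2 n x z : g (hact2 n (boxp 1 x : box H X) z) = ins_r n x (RCi z).
Proof.
elim/bd_ind: z => [|z z' hz hz'|k l].
- by rewrite [hact2 _ _ _]raddf0 RCi0 [RHS]raddf0 g0.
- by rewrite [hact2 _ _ _]raddfD RCiD [RHS]raddfD gD; congr (_ + _).
rewrite [hact2 _ _ _]hact2E scale_boxp mulr1 gE -[l in RHS]mulr1.
by rewrite -[X in RCi (bd_pure _ (_ * X))](rmorph1 (bd_eta H)) RCi_act ins_r_act env1 scale1r.
Qed.

Lemma hopf_r_is_iso : is_iso (hopf_r (free_adjunction H) N X).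
Proof.
suff: bijective (hopf_lin_r X N) by move/lmod_is_iso.
exists g.
  elim/box_ind=> [|t t' ht ht'|h t]; first by rewrite raddf0 g0.
    by rewrite raddfD gD; congr (_ + _).
  elim/btens_ind: t => [|t t' ht ht'|n x]; first by rewrite [boxp _ _]pure0r raddf0 g0.
    by rewrite [boxp _ _]pureDr raddfD gD; congr (_ + _).
  have -> : boxp h (bpure n x) = ins_r n x (pure_dot h 1) by rewrite ins_rE scale1r.
  by rewrite [X in g X]hopf_r_ins g_hact2 RCK.
elim/htens_ind=> [|t t' ht ht'|n t]; first by rewrite g0 raddf0.
  by rewrite gD raddfD; congr (_ + _).
elim/box_ind: t => [|t t' ht ht'|h x]; first by rewrite hpure0r g0 raddf0.
  by rewrite hpureDr gD raddfD; congr (_ + _).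
by rewrite gE [LHS]hopf_r_ins RCiK hact2E scale_boxp mulr1 scale1r.
Qed.
End RightInsertion.

Section RightRegular.
Let E : lmodType (env A) := (env A)^o.
Let lone : E := (1 : env A).

Section InsInverse.
(** The inverse of insertion at A^e: d ⊗ (t ⊗ a\bar b) comes from d\bar b ⊗ \bar a t, because a
    crosses to t as a right action and \bar b leaves through A^e. *)
Let f3 (d : H) (t : box H E) (a b : A) : tens_dot H := pure_dot (d * tgt b) (tgt a * box_env t).
Let tgtZ (k : K) a : tgt (k *: a) = src (k *: 1) * tgt a.
Proof. by rewrite /bd_src /bd_tgt -rmorphM envpM !mulr1 envpZ. Qed.
Let f3_bal d t : balanced (fun (k : K) (a : A) => k *: a) (fun (k : K) (a : A) => k *: a) (f3 d t).
Proof.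
split=> [a a' b|a b b'|k a b]; rewrite /f3.
- by rewrite /bd_tgt envpDr raddfD mulrDl [LHS]pureDr.
- by rewrite /bd_tgt envpDr raddfD mulrDr [LHS]pureDl.
by rewrite !tgtZ -mulrA -[LHS]pure_bal -mulrA bd_src_tgt.
Qed.
Let f2 d (t : (| (box H E))) (e : E) : tens_dot H := tlift (f3_bal d t) (e : env A).
Let f2E d a b t : f2 d t (envp a b) = pure_dot (d * tgt b) (tgt a * box_env t).
Proof. exact: tlift_pure. Qed.
Let f2Dr d t : {morph (fun e : env A => f2 d t e) : e e' / e + e'}.
Proof. exact: (raddfD (tlift (f3_bal d t))). Qed.
Let f20r d t : f2 d t (0 : env A) = 0.
Proof. exact: (raddf0 (tlift (f3_bal d t))). Qed.
Let f2Dl d e : {morph f2 d ^~ e : t t' / t + t'}.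
Proof.
move=> t t'; elim/env_ind: e => [|e e' he he'|a b]; first by rewrite !f20r addr0.
  by rewrite !f2Dr he he' addrACA.
by rewrite !f2E raddfD mulrDr [LHS]pureDr.
Qed.
Let f2_bal d : bbalanced (f2 d).
Proof.
split=> [t t' e|t e e'|c t e]; [exact: f2Dl|exact: f2Dr|].
elim/env_ind: e => [|e e' he he'|a b]; first by rewrite lact0 !f20r.
  by rewrite lactD !f2Dr he he'.
rewrite [lact _ _]envpM mulr1 !f2E; congr pure_dot.
by rewrite [ract _ _]resE linearZ mulrA -rmorphM envpM mul1r.
Qed.
Let f1 (d : H) (t : btens (| (box H E)) E) : tens_dot H := blift (f2_bal d) t.
Let f1E d t e : f1 d (bpure t e) = f2 d t e. Proof. exact: blift_pure. Qed.
Let f1Dr d : {morph f1 d : t t' / t + t'}. Proof. exact: (raddfD (blift (f2_bal d))). Qed.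
Let f10r d : f1 d 0 = 0. Proof. exact: (raddf0 (blift (f2_bal d))). Qed.
Let f1Dl t : {morph f1^~ t : d d' / d + d'}.
Proof.
move=> d d'; elim/btens_ind: t => [|t t' ht ht'|t e]; first by rewrite !f10r addr0.
  by rewrite !f1Dr ht ht' addrACA.
rewrite !f1E; elim/env_ind: e => [|e e' he he'|a b]; first by rewrite !f20r addr0.
  by rewrite !f2Dr he he' addrACA.
by rewrite !f2E mulrDl [LHS]pureDl.
Qed.
Let f10l t : f1 0 t = 0.
Proof. by apply: (@addrI _ (f1 0 t)); rewrite -f1Dl !addr0. Qed.
Let f1_bal : balanced (fun (x : env A) (d : H) => d * bd_eta H x) (fun (x : env A) (t : btens (| (box H E)) E) => x *: t) f1.
Proof.
split=> [d d' t|d t t'|x d t]; [exact: f1Dl|exact: f1Dr|].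
elim/env_ind: x => [|x x' hx hx'|p q]; first by rewrite raddf0 mulr0 scale0r f10r f10l.
  by rewrite raddfD mulrDr f1Dl hx hx' scalerDl f1Dr.
elim/btens_ind: t => [|t t' ht ht'|t e]; first by rewrite scaler0 !f10r.
  by rewrite scalerDr !f1Dr ht ht'.
rewrite env_act ract_pure lact_pure !f1E.
elim/env_ind: e => [|e e' he he'|a b]; first by rewrite ract0 !f20r.
  by rewrite ractD !f2Dr he he'.
rewrite [ract _ _]envpM mul1r !f2E bd_etaE.
have -> : tgt (b * q) = tgt q * tgt b by rewrite -rmorphM envpM mulr1.
rewrite bd_src_tgt mulrA -(mulrA _ (src p)) bd_src_tgt mulrA [LHS]pure_bal.
have -> : box_env (lact p t) = src p * box_env t by rewrite [lact _ _]resE linearZ.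
by rewrite !mulrA bd_src_tgt.
Qed.
Let f (t : box H (btens (| (box H E)) E)) : tens_dot H := tlift f1_bal t.
Let fE d t e : f (boxp d (bpure t e)) = f2 d t e.
Proof. by rewrite [LHS]tlift_pure f1E. Qed.

Lemma ins_r_env_bij : bijective (@ins_r E (box H E) (boxp 1 lone) lone).
Proof.
have fD : {morph f : t t' / t + t'} by exact: (raddfD (tlift f1_bal)).
have f0 : f 0 = 0 by exact: (raddf0 (tlift f1_bal)).
exists f => t.
  elim/tens_dot_ind: t => [|t t' ht ht'|d e]; first by rewrite raddf0 f0.
    by rewrite raddfD fD; congr (_ + _).
  rewrite ins_rE fE [lone](env1 A) f2E !(bd_tgt1, mulr1, mul1r); congr pure_dot.
  by rewrite scale_boxp mulr1 box_envE rmorph1 mulr1.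
elim/box_ind: t => [|t t' ht ht'|d t]; first by rewrite f0 raddf0.
  by rewrite fD raddfD; congr (_ + _).
elim/btens_ind: t => [|t t' ht ht'|t e]; first by rewrite [boxp d _]pure0r f0 raddf0.
  by rewrite [boxp d _]pureDr fD raddfD; congr (_ + _).
rewrite fE; elim/env_ind: e => [|e e' he he'|a b].
- by rewrite f20r [LHS]raddf0 bpure0r [RHS]pure0r.
- by rewrite f2Dr [LHS]raddfD bpureDr boxpDr; congr (_ + _).
rewrite f2E ins_rE boxp_bal; congr boxp.
have -> : (tgt a * box_env t) *: boxp 1 lone = ract a (t : (| (box H E))).
  by rewrite -scalerA scale_boxp mulr1 box_envK.
rewrite [LHS]ract_pure bpure_bal; congr bpure.
by rewrite [LHS]scalerA [LHS]mulr1 envpM !mulr1.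
Qed.
End InsInverse.

Lemma right_canonical_bij :
  is_iso (right_fusion (box_bimonad H) E E) -> bijective (@right_canonical K A H).
Proof.
rewrite (cross_product_right_fusion (free_adjunctionP H) (id_bimonadP _)) right_fusion_id comp1m.
move=> /lmod_is_iso hr; have {}hr : bijective (hopf_lin_r E (box H E)) by exact: hr.
have e t : hact2 (boxp 1 lone : box H E) (boxp 1 lone : box H E) (right_canonical t) =
  hopf_lin_r E (box H E) (ins_r (boxp 1 lone) lone t) by rewrite hopf_r_ins.
have [g gK Kg] := hact2_box_env_bij H.
apply: (@eq_bij _ _ (g \o (hopf_lin_r E (box H E) \o ins_r (boxp 1 lone) lone))).
  apply: bij_comp; first by exists (hact2 (boxp 1 lone : box H E) (boxp 1 lone : box H E)).
  exact: bij_comp hr ins_r_env_bij.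
move=> t; rewrite -[LHS]/(g (hopf_lin_r E (box H E) (ins_r (boxp 1 lone) lone t))).
by rewrite -e gK.
Qed.
End RightRegular.
End RightHopfOperators.

(** * The bimonad B (x)_A - *)

(** Stated for plain functions: once an inner tensor has been generalized, both sides of a goal are
    additive in it without being given as linear maps. *)
Lemma htens_morph_ext (K : fieldType) (A : algType K) (H : bialgebroid A) (M N : lmodType H)
  (Z : zmodType) (f g : htens M N -> Z) :
  {morph f : s t / s + t} -> {morph g : s t / s + t} ->
  (forall m n, f (hpure m n) = g (hpure m n)) -> forall t, f t = g t.
Proof.
move=> fD gD fg.
have z (h : htens M N -> Z) : {morph h : s t / s + t} -> h 0 = 0.
  by move=> hD; apply: (@addrI _ (h 0)); rewrite -hD !addr0.
elim/htens_ind=> [|s t hs ht|//]; first by rewrite !z.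
by rewrite fD gD hs ht.
Qed.

Section Extensionality.
Variables (K : fieldType) (A : algType K) (H : bialgebroid A) (Z : zmodType).
Implicit Types L M N P Q R : lmodType H.

Lemma htens_ext3 L M N (f g : htens L (htens M N) -> Z) :
  {morph f : s t / s + t} -> {morph g : s t / s + t} ->
  (forall l m n, f (hpure l (hpure m n)) = g (hpure l (hpure m n))) -> forall t, f t = g t.
Proof.
move=> fD gD fg; apply: htens_morph_ext => // l t; move: t.
by apply: htens_morph_ext => // s t; rewrite !hpureDr (fD, gD).
Qed.

Lemma htens_ext31 L M N P (f g : htens L (htens (htens M N) P) -> Z) :
  {morph f : s t / s + t} -> {morph g : s t / s + t} ->
  (forall l m n p, f (hpure l (hpure (hpure m n) p)) = g (hpure l (hpure (hpure m n) p))) ->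
  forall t, f t = g t.
Proof.
move=> fD gD fg; apply: htens_ext3 => // l t p; move: t.
by apply: htens_morph_ext => // s t; rewrite hpureDl !hpureDr (fD, gD).
Qed.

Lemma htens_ext4 L M N P (f g : htens L (htens M (htens N P)) -> Z) :
  {morph f : s t / s + t} -> {morph g : s t / s + t} ->
  (forall l m n p, f (hpure l (hpure m (hpure n p))) = g (hpure l (hpure m (hpure n p)))) ->
  forall t, f t = g t.
Proof.
move=> fD gD fg; apply: htens_ext3 => // l m t; move: t.
by apply: htens_morph_ext => // s t; rewrite !hpureDr (fD, gD).
Qed.

End Extensionality.

Section SealedMorphisms.
Variables (K : fieldType) (A : algType K) (H : bialgebroid A).
Implicit Types M N P : lmodType H.

(* The structure maps of [HMod H] are sealed so that rewriting does not unfold them. *)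
Definition hm M M' N N' (f : {linear M -> M'}) (g : {linear N -> N'}) :
  {linear htens M N -> htens M' N'} := locked (hmor f g).
Definition asl M N P : {linear htens (htens M N) P -> htens M (htens N P)} :=
  locked (hasc M N P).
Definition asr M N P : {linear htens M (htens N P) -> htens (htens M N) P} :=
  locked (hasci M N P).
Lemma hmU M M' N N' (f : {linear M -> M'}) (g : {linear N -> N'}) : hm f g = hmor f g.
Proof. by rewrite /hm -lock. Qed.
Lemma aslU M N P : asl M N P = hasc M N P. Proof. by rewrite /asl -lock. Qed.
Lemma asrU M N P : asr M N P = hasci M N P. Proof. by rewrite /asr -lock. Qed.
Lemma hmE M M' N N' (f : {linear M -> M'}) (g : {linear N -> N'}) m n :
  hm f g (hpure m n) = hpure (f m) (g n).
Proof. by rewrite hmU hmorE. Qed.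
Lemma aslE M N P m n p : asl M N P (hpure (hpure m n) p) = hpure m (hpure n p).
Proof. by rewrite aslU hascE. Qed.
Lemma asrE M N P m n p : asr M N P (hpure m (hpure n p)) = hpure (hpure m n) p.
Proof. by rewrite asrU hasciE. Qed.
End SealedMorphisms.

Section MorphAdd.
Variables (T : zmodType).
Lemma morph_id : {morph (fun t : T => t) : s t / s + t}. Proof. by []. Qed.
Lemma morph_lin (R : pzRingType) (U V : lmodType R) (f : {linear U -> V}) (g : T -> U) :
  {morph g : s t / s + t} -> {morph (fun t => f (g t)) : s t / s + t}.
Proof. by move=> gD s t; rewrite gD raddfD. Qed.
Variables (K : fieldType) (A : algType K) (H : bialgebroid A) (M N : lmodType H).
Lemma morph_purel (g : T -> M) (n : N) :
  {morph g : s t / s + t} -> {morph (fun t => hpure (g t) n) : s t / s + t}.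
Proof. by move=> gD s t; rewrite gD hpureDl. Qed.
Lemma morph_purer (g : T -> N) (m : M) :
  {morph g : s t / s + t} -> {morph (fun t => hpure m (g t)) : s t / s + t}.
Proof. by move=> gD s t; rewrite gD hpureDr. Qed.
End MorphAdd.

(** The formal counterpart of Sweedler notation. After a coproduct or a value of the braiding has
    been generalized, [hind] replaces it by a pure tensor; [morph_add] proves additivity by
    descending through linear maps and [hpure]. *)
Ltac morph_add := first [exact: morph_id | apply: morph_lin; morph_add
  | apply: morph_purel; morph_add | apply: morph_purer; morph_add].
Ltac hind := apply: htens_morph_ext; [morph_add|morph_add|].

(** * The axioms of B with a spectator factor *)

Section BraidedCalculus.
Variables (K : fieldType) (A : algType K) (H : bialgebroid A).
Variable B : lax_central_hopf (HMod H).
Notation b := (bh_mod B).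
Implicit Types M N X Y Z W : lmodType H.

Definition br_tau M : {linear htens b M -> htens M b} := lh_tau B M.
Definition br_mul : {linear htens b b -> b} := lh_mul B.
Definition br_one : {linear htriv H -> b} := lh_one B.
Definition br_cop : {linear b -> htens b b} := lh_comul B.
Definition br_cou : {linear b -> htriv H} := lh_counit B.
Definition br_ant : {linear b -> b} := lh_antipode B.

(* The structure maps of B tensored with a spectator X on the right: with every
   tensor product bracketed to the right, the bimonad identities for B (x)_A -
   become equations between these maps without associativity constraints. *)
Definition pass M X : {linear htens b (htens M X) -> htens M (htens b X)} :=
  locked (lincomp (lincomp (asl M b X) (hm (br_tau M) (linid X))) (asr b M X)).
Definition wcop X : {linear htens b X -> htens b (htens b X)} :=
  locked (lincomp (asl b b X) (hm br_cop (linid X))).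
Definition wmul X : {linear htens b (htens b X) -> htens b X} :=
  locked (lincomp (hm br_mul (linid X)) (asr b b X)).
Definition wcou X : {linear htens b X -> X} :=
  locked (lincomp (hlun X) (hm br_cou (linid X))).
Definition wone X : {linear X -> htens b X} :=
  locked (lincomp (hm br_one (linid X)) (hluni X)).
Definition want X : {linear htens b X -> htens b X} :=
  locked (hm br_ant (linid X)).

Lemma passU M X : pass M X = lincomp (lincomp (asl M b X) (hm (br_tau M) (linid X))) (asr b M X).
Proof. by rewrite /pass -lock. Qed.
Lemma passE M X c m x : pass M X (hpure c (hpure m x)) = asl M b X (hpure (br_tau M (hpure c m)) x).
Proof. by rewrite /pass -lock !lincompE asrE hmE. Qed.
Lemma wcopE X c x : wcop X (hpure c x) = asl b b X (hpure (br_cop c) x).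
Proof. by rewrite /wcop -lock lincompE hmE. Qed.
Lemma wmulE X c d x : wmul X (hpure c (hpure d x)) = hpure (br_mul (hpure c d)) x.
Proof. by rewrite /wmul -lock lincompE asrE hmE. Qed.
Lemma wcouE X c x : wcou X (hpure c x) = bd_src H (br_cou c) *: x.
Proof. by rewrite /wcou -lock lincompE hmE hlunE. Qed.
Lemma woneE X x : wone X x = hpure (br_one (1 : A)) x.
Proof. by rewrite /wone -lock lincompE hluniE hmE. Qed.
Lemma wantE X c x : want X (hpure c x) = hpure (br_ant c) x.
Proof. by rewrite /want -lock hmE. Qed.

Lemma htriv_src a (x : htriv H) : bd_src H a *: x = (a * x : A).
Proof.
by rewrite htrivE bd_eps_src -[bd_src H x]mulr1 bd_eps_src [bd_eps _]bd_counit1 mulr1.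
Qed.
Lemma htriv_tgt a (x : htriv H) : bd_tgt H a *: x = (x * a : A).
Proof.
by rewrite htrivE bd_eps_tgt -[bd_src H x]mulr1 bd_eps_src [bd_eps _]bd_counit1 mulr1.
Qed.
Lemma linidE (M : lmodType H) (m : M) : linid M m = m. Proof. by []. Qed.
Lemma linE (M N : lmodType H) (f g : {linear M -> N}) : f = g -> forall x, f x = g x.
Proof. by move=> ->. Qed.

Lemma tau_nat_lin M N (f : {linear M -> N}) :
  lincomp (br_tau N) (hm (linid b) f) = lincomp (hm f (linid b)) (br_tau M).
Proof. by have [tn _ _] := lh_tauP B; rewrite !(hmU, aslU, asrU); exact: tn. Qed.
Lemma tau_nat M N (f : {linear M -> N}) c m :
  br_tau N (hpure c (f m)) = hm f (linid b) (br_tau M (hpure c m)).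
Proof. by rewrite -[RHS](linE (tau_nat_lin f)) lincompE hmE. Qed.

Lemma tau_tens_lin M N : br_tau (htens M N) =
  lincomp (lincomp (lincomp (lincomp (asr M N b) (hm (linid M) (br_tau N))) (asl M b N))
    (hm (br_tau M) (linid N))) (asr b M N).
Proof.
have [_ tt _] := lh_tauP B.
by rewrite (hmU (linid M)) (hmU (br_tau M)) aslU !asrU; exact: (tt M N).
Qed.
Lemma tau_tens M N c m n :
  br_tau (htens M N) (hpure c (hpure m n)) =
  asr M N b (hm (linid M) (br_tau N) (pass M N (hpure c (hpure m n)))).
Proof. by rewrite tau_tens_lin passU !lincompE. Qed.

Lemma tau_unit_lin : br_tau (htriv H) = lincomp (hluni b) (hrun b).
Proof. by have [_ _ t1] := lh_tauP B; exact: t1. Qed.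
Lemma tau_unit c (a : htriv H) :
  br_tau (htriv H) (hpure c a) = hpure ((1 : A) : htriv H) (bd_tgt H a *: c).
Proof. by rewrite tau_unit_lin lincompE hrunE hluniE. Qed.

Definition tau2 M : {linear htens (htens b b) M -> htens M (htens b b)} :=
  lincomp (lincomp (pass M b) (hm (linid b) (br_tau M))) (asl b b M).
Lemma tau2E M c d m : tau2 M (hpure (hpure c d) m) = pass M b (hpure c (br_tau M (hpure d m))).
Proof. by rewrite /tau2 !lincompE aslE hmE. Qed.
Lemma tensor_braidingE M : tensor_braiding (lh_tau B) (lh_tau B) M = tau2 M.
Proof. by rewrite /tau2 passU !(hmU, aslU, asrU); exact: linext. Qed.

Lemma tau_mul_lin M : lincomp (hm (linid M) br_mul) (tau2 M) = lincomp (br_tau M) (hm br_mul (linid M)).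
Proof. by rewrite -tensor_braidingE !hmU; exact: (lh_mul_central B M). Qed.
Lemma tau_mul M c d m :
  br_tau M (hpure (br_mul (hpure c d)) m) =
  hm (linid M) br_mul (pass M b (hpure c (br_tau M (hpure d m)))).
Proof. by rewrite -tau2E -[RHS]lincompE tau_mul_lin lincompE hmE. Qed.
Lemma tau_one_lin M : lincomp (hm (linid M) br_one) (lincomp (hruni M) (hlun M)) =
  lincomp (br_tau M) (hm br_one (linid M)).
Proof. by rewrite !hmU; exact: (lh_one_central B M). Qed.
Lemma tau_one M (a : htriv H) m :
  br_tau M (hpure (br_one a) m) = hpure (bd_src H a *: m) (br_one (1 : A)).
Proof.
have := linE (tau_one_lin M) (hpure a m).
by rewrite !lincompE hlunE hruniE !hmE => <-.
Qed.
Lemma tau_cop_lin M : lincomp (hm (linid M) br_cop) (br_tau M) =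
  lincomp (tau2 M) (hm br_cop (linid M)).
Proof. by rewrite -tensor_braidingE !hmU; exact: (lh_comul_central B M). Qed.
Lemma tau_cop M c m : hm (linid M) br_cop (br_tau M (hpure c m)) = tau2 M (hpure (br_cop c) m).
Proof. by rewrite -[LHS]lincompE tau_cop_lin lincompE hmE. Qed.
Lemma tau_cou_lin M : lincomp (hm (linid M) br_cou) (br_tau M) =
  lincomp (lincomp (hruni M) (hlun M)) (hm br_cou (linid M)).
Proof. by rewrite !hmU; exact: (lh_counit_central B M). Qed.
Lemma tau_cou M c m : hm (linid M) br_cou (br_tau M (hpure c m)) =
  hpure (bd_src H (br_cou c) *: m) ((1 : A) : htriv H).
Proof. by rewrite -[LHS]lincompE tau_cou_lin !lincompE hmE hlunE hruniE. Qed.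

(** The hexagon: a strand B crossing M ⊗ N crosses M and then N. The [pass_] lemmas that follow are
    naturality of the half-braiding, centrality of the structure maps of B, and crossing of the
    unit. *)
Lemma pass_tens M N X t :
  asl M N (htens b X) (pass (htens M N) X t) =
  hm (linid M) (pass N X) (pass M (htens N X) (hm (linid b) (asl M N X) t)).
Proof.
move: t; apply: htens_ext31 => [||c m n x]; [morph_add|morph_add|].
rewrite hmE aslE !passE tau_tens passE.
move: (br_tau M (hpure c m)); hind => m' c'.
rewrite !aslE !hmE passE.
move: (br_tau N (hpure c' n)); hind => n' d.
by rewrite asrE !aslE.
Qed.

Lemma pass_nat M M' X X' (f : {linear M -> M'}) (g : {linear X -> X'}) t :
  pass M' X' (hm (linid b) (hm f g) t) = hm f (hm (linid b) g) (pass M X t).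
Proof.
move: t; apply: htens_ext3 => [||c m x]; [morph_add|morph_add|].
rewrite !hmE !passE linidE tau_nat.
move: (br_tau M (hpure c m)); hind => m' d.
by rewrite hmE !aslE !hmE.
Qed.

Lemma pass_cop M X t :
  hm (linid M) (wcop X) (pass M X t) =
  pass M (htens b X) (hm (linid b) (pass M X) (wcop (htens M X) t)).
Proof.
move: t; apply: htens_ext3 => [||c m x]; [morph_add|morph_add|].
rewrite passE wcopE.
(* Rebracketing brings [br_cop] directly onto the value of [br_tau], where [tau_cop] applies. *)
transitivity (hm (linid M) (asl b b X)
   (asl M (htens b b) X (hpure (hm (linid M) br_cop (br_tau M (hpure c m))) x))).
  move: (br_tau M (hpure c m)); hind => m' d.
  by rewrite hmE !aslE !hmE wcopE.
rewrite tau_cop; move: (br_cop c); hind => d e.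
rewrite tau2E aslE hmE passE linidE.
move: (br_tau M (hpure e m)); hind => m' e'.
rewrite aslE !passE; move: (br_tau M (hpure d m')); hind => m'' d'.
by rewrite !aslE !hmE aslE.
Qed.

Lemma pass_mul M X t :
  pass M X (wmul (htens M X) t) =
  hm (linid M) (wmul X) (pass M (htens b X) (hm (linid b) (pass M X) t)).
Proof.
move: t; apply: htens_ext4 => [||c d m x]; [morph_add|morph_add|].
rewrite wmulE passE hmE linidE passE tau_mul.
move: (br_tau M (hpure d m)); hind => m' d'.
rewrite aslE !passE; move: (br_tau M (hpure c m')); hind => m'' c'.
by rewrite !aslE !hmE !aslE wmulE.
Qed.

Lemma pass_one M X t : pass M X (wone (htens M X) t) = hm (linid M) (wone X) t.
Proof.
move: t; hind => m x.
by rewrite woneE passE tau_one bd_src1 scale1r aslE hmE woneE.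
Qed.

Lemma pass_cou M X t : hm (linid M) (wcou X) (pass M X t) = wcou (htens M X) t.
Proof.
move: t; apply: htens_ext3 => [||c m x]; [morph_add|morph_add|].
rewrite passE wcouE.
transitivity (hm (linid M) (hlun X)
   (asl M (htriv H) X (hpure (hm (linid M) br_cou (br_tau M (hpure c m))) x))).
  move: (br_tau M (hpure c m)); hind => m' d.
  by rewrite hmE !aslE !hmE wcouE hlunE.
rewrite tau_cou aslE hmE hlunE bd_src1 scale1r linidE.
have := @hscale_eta _ _ _ _ _ (br_cou c) 1 m x.
by rewrite bd_etaE bd_tgt1 mulr1 scale1r => <-.
Qed.

Lemma pass_unit X c (a : htriv H) x :
  pass (htriv H) X (hpure c (hpure a x)) = hpure ((1 : A) : htriv H) (hpure c (bd_src H a *: x)).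
Proof. by rewrite passE tau_unit aslE hpure_bal. Qed.

Section Naturality.
Variables (X Y : lmodType H) (f : {linear X -> Y}).
Lemma wcop_nat t : wcop Y (hm (linid b) f t) = hm (linid b) (hm (linid b) f) (wcop X t).
Proof.
move: t; hind => c x; rewrite hmE !wcopE linidE; move: (br_cop c); hind => d e.
by rewrite !aslE !hmE.
Qed.
Lemma wmul_nat t : wmul Y (hm (linid b) (hm (linid b) f) t) = hm (linid b) f (wmul X t).
Proof.
move: t; apply: htens_ext3 => [||c d x]; [morph_add|morph_add|].
by rewrite !hmE !wmulE !hmE.
Qed.
Lemma wcou_nat t : wcou Y (hm (linid b) f t) = f (wcou X t).
Proof. by move: t; hind => c x; rewrite hmE !wcouE linearZ. Qed.
Lemma wone_nat x : wone Y (f x) = hm (linid b) f (wone X x).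
Proof. by rewrite !woneE hmE. Qed.
Lemma want_nat t : want Y (hm (linid b) f t) = hm (linid b) f (want X t).
Proof. by move: t; hind => c x; rewrite hmE !wantE hmE. Qed.
End Naturality.

Lemma br_comonoid : is_comonoid (C := HMod H) br_cop br_cou. Proof. exact: lh_comonoid. Qed.
Lemma br_copA c : asl b b b (hm br_cop (linid b) (br_cop c)) = hm (linid b) br_cop (br_cop c).
Proof. by have [ca _ _] := br_comonoid; rewrite !hmU aslU; exact: (linE ca c). Qed.
Lemma br_copl c : hlun b (hm br_cou (linid b) (br_cop c)) = c.
Proof. by have [_ cl _] := br_comonoid; rewrite !hmU; exact: (linE cl c). Qed.
Lemma br_copr c : hrun b (hm (linid b) br_cou (br_cop c)) = c.
Proof. by have [_ _ cr] := br_comonoid; rewrite !hmU; exact: (linE cr c). Qed.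

Lemma wcop_coassoc X t : hm (linid b) (wcop X) (wcop X t) = wcop (htens b X) (wcop X t).
Proof.
move: t; hind => c x; rewrite !wcopE.
transitivity (hm (linid b) (asl b b X)
  (asl b (htens b b) X (hpure (hm (linid b) br_cop (br_cop c)) x))).
  by move: (br_cop c); hind => d e; rewrite hmE !aslE !hmE wcopE.
rewrite -br_copA; move: (br_cop c); hind => d e.
rewrite hmE aslE wcopE; move: (br_cop d); hind => d1 d2.
by rewrite !aslE !hmE aslE.
Qed.
Lemma wcop_counitl X t : wcou (htens b X) (wcop X t) = t.
Proof.
move: t; hind => c x; rewrite wcopE -[c in RHS]br_copl; move: (br_cop c); hind => d e.
rewrite hmE aslE wcouE hlunE.
have := @hscale_eta _ _ _ _ _ (br_cou d) 1 e x.
by rewrite bd_etaE bd_tgt1 mulr1 scale1r => <-.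
Qed.
Lemma wcop_counitr X t : hm (linid b) (wcou X) (wcop X t) = t.
Proof.
move: t; hind => c x; rewrite wcopE -[c in RHS]br_copr; move: (br_cop c); hind => d e.
by rewrite hmE aslE hmE wcouE hrunE hpure_bal.
Qed.

Lemma br_monoid : is_monoid (C := HMod H) br_mul br_one. Proof. exact: lh_monoid. Qed.
Lemma br_mulA c d e : br_mul (hpure (br_mul (hpure c d)) e) = br_mul (hpure c (br_mul (hpure d e))).
Proof.
have [ma _ _] := br_monoid.
have ma' : lincomp br_mul (hm br_mul (linid b)) =
  lincomp (lincomp br_mul (hm (linid b) br_mul)) (asl b b b) by rewrite !hmU aslU; exact: ma.
by have := linE ma' (hpure (hpure c d) e); rewrite !lincompE aslE !hmE.
Qed.
Lemma br_mul1 c : br_mul (hpure (br_one (1 : A)) c) = c.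
Proof.
have [_ ml _] := br_monoid.
have ml' : lincomp br_mul (hm br_one (linid b)) = hlun b by rewrite !hmU; exact: ml.
by have := linE ml' (hpure ((1 : A) : htriv H) c); rewrite lincompE hmE hlunE bd_src1 scale1r.
Qed.
Lemma br_mulr1 c : br_mul (hpure c (br_one (1 : A))) = c.
Proof.
have [_ _ mr] := br_monoid.
have mr' : lincomp br_mul (hm (linid b) br_one) = hrun b by rewrite !hmU; exact: mr.
by have := linE mr' (hpure c ((1 : A) : htriv H)); rewrite lincompE hmE hrunE bd_tgt1 scale1r.
Qed.
Lemma wmul_assoc X t : wmul X (hm (linid b) (wmul X) t) = wmul X (wmul (htens b X) t).
Proof.
move: t; apply: htens_ext4 => [||c d e x]; [morph_add|morph_add|].
by rewrite hmE !wmulE br_mulA.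
Qed.
Lemma wmul_unitl X t : wmul X (wone (htens b X) t) = t.
Proof. by move: t; hind => c x; rewrite woneE wmulE br_mul1. Qed.
Lemma wmul_unitr X t : wmul X (hm (linid b) (wone X) t) = t.
Proof. by move: t; hind => c x; rewrite hmE woneE wmulE br_mulr1. Qed.

Lemma wcou_mul X t : wcou X (wmul X t) = wcou X (hm (linid b) (wcou X) t).
Proof.
move: t; apply: htens_ext3 => [||c d x]; [morph_add|morph_add|].
rewrite wmulE hmE !wcouE scalerA.
have e : lincomp br_cou br_mul = lincomp (hlun (htriv H)) (hm br_cou br_cou) by rewrite !hmU; exact: (lh_counit_mul B).
have := linE e (hpure c d); rewrite !lincompE hmE hlunE => ->.
by rewrite htriv_src /bd_src -rmorphM envpM mulr1.
Qed.
Lemma wcou_one X x : wcou X (wone X x) = x.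
Proof.
rewrite woneE wcouE; have e : lincomp br_cou br_one = linid _ by exact: (lh_counit_one B).
by have := linE e (1 : A); rewrite !lincompE => ->; rewrite bd_src1 scale1r.
Qed.
Lemma wcop_one X x : wcop X (wone X x) = wone (htens b X) (wone X x).
Proof.
rewrite !woneE wcopE; have e : lincomp br_cop br_one = lincomp (hm br_one br_one) (hluni (htriv H)) by rewrite !hmU; exact: (lh_comul_one B).
by have := linE e (1 : A); rewrite !lincompE hluniE hmE => ->; rewrite aslE.
Qed.

Lemma exchange_lin M N X : exchange (lh_tau B) M N X = lincomp (lincomp (asr M N (htens b X)) (hm (linid M) (pass N X))) (asl M b (htens N X)) :> {linear htens (htens M b) (htens N X) -> htens (htens M N) (htens b X)}.
Proof. by rewrite passU !(hmU, aslU, asrU). Qed.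
Lemma br_cop_mul : lincomp br_cop br_mul = lincomp (lincomp (hm br_mul br_mul)
  (lincomp (lincomp (asr b b (htens b b)) (hm (linid b) (pass b b))) (asl b b (htens b b)))) (hm br_cop br_cop).
Proof. by rewrite -exchange_lin !hmU; exact: (lh_comul_mul B). Qed.

(** The braided bialgebra axiom: with right brackets, the middle exchange is the single crossing
    [pass b]. *)
Lemma wcop_mul X t :
  wcop X (wmul X t) = wmul (htens b X) (hm (linid b) (hm (linid b) (wmul X))
    (hm (linid b) (pass b (htens b X)) (wcop (htens b (htens b X)) (hm (linid b) (wcop X) t)))).
Proof.
move: t; apply: htens_ext3 => [||c d x]; [morph_add|morph_add|].
rewrite wmulE hmE !wcopE linidE.
have := linE br_cop_mul (hpure c d); rewrite !lincompE hmE => ->.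
move: (br_cop c); hind => c1 c2; move: (br_cop d); hind => d1 d2.
rewrite !aslE !hmE !passE linidE; move: (br_tau b (hpure c2 d1)); hind => d1' c2'.
by rewrite !aslE asrE !hmE !aslE !wmulE.
Qed.

Lemma antipode_r X t : wmul X (hm (linid b) (want X) (wcop X t)) = wone X (wcou X t).
Proof.
move: t; hind => c x; rewrite wcopE wcouE woneE.
have e : lincomp (lincomp br_mul (hm (linid b) br_ant)) br_cop = lincomp br_one br_cou by rewrite !hmU; exact: (lh_antipode_l B).
(* The scalar epsilon(c) crosses the tensor sign from x to 1_B, where by H-linearity of the unit it
   acts on 1 in A from the right. *)
have -> : hpure (br_one (1 : A)) (bd_src H (br_cou c) *: x) = hpure (br_one (br_cou c)) x.
  rewrite -hpure_bal -linearZ; congr (hpure (br_one _) x).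
  by rewrite htriv_tgt mul1r.
have := linE e c; rewrite !lincompE => <-; move: (br_cop c); hind => d d'.
by rewrite aslE !hmE wantE wmulE.
Qed.
Lemma antipode_l X t : wmul X (want (htens b X) (wcop X t)) = wone X (wcou X t).
Proof.
move: t; hind => c x; rewrite wcopE wcouE woneE.
have e : lincomp (lincomp br_mul (hm br_ant (linid b))) br_cop = lincomp br_one br_cou by rewrite !hmU; exact: (lh_antipode_r B).
have -> : hpure (br_one (1 : A)) (bd_src H (br_cou c) *: x) = hpure (br_one (br_cou c)) x.
  rewrite -hpure_bal -linearZ; congr (hpure (br_one _) x).
  by rewrite htriv_tgt mul1r.
have := linE e c; rewrite !lincompE => <-; move: (br_cop c); hind => d d'.
by rewrite aslE !hmE wantE wmulE.
Qed.

Local Notation "M '◁' f" := (hm (linid M) f) (at level 30, right associativity).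

(** * Whiskering and the bimonad axioms for B ⊗ - *)

Section Whiskering.
Variables (L M M' N P : lmodType H) (Q : lmodType H).
Lemma whisker_comp (g : {linear M -> N}) (f : {linear L -> M}) (t : htens Q L) :
  (Q ◁ g) ((Q ◁ f) t) = (Q ◁ (lincomp g f)) t.
Proof. by move: t; hind => q l; rewrite !hmE. Qed.
Lemma whisker_ext (f g : {linear L -> M}) (t : htens Q L) : f =1 g -> (Q ◁ f) t = (Q ◁ g) t.
Proof. by move=> /linext ->. Qed.
Lemma whisker_id (f : {linear L -> L}) (t : htens Q L) : f =1 id -> (Q ◁ f) t = t.
Proof. by move=> fid; move: t; hind => q l; rewrite hmE fid. Qed.
End Whiskering.

Section WhiskeredIdentities.
Variables (L M M' N P : lmodType H) (Q : lmodType H).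
(** These rewrite under Q ⊗ - by a pointwise identity; the digits count the maps composed on its two
    sides. *)
Lemma whisker22 (f : {linear M -> N}) (g : {linear L -> M}) (f' : {linear M' -> N})
    (g' : {linear L -> M'}) : (forall x, f (g x) = f' (g' x)) ->
  forall t : htens Q L, (Q ◁ f) ((Q ◁ g) t) = (Q ◁ f') ((Q ◁ g') t).
Proof. by move=> e t; rewrite !whisker_comp; apply: whisker_ext. Qed.
Lemma whisker23 (f : {linear M -> N}) (g : {linear L -> M}) (f1 : {linear M' -> N})
    (f2 : {linear P -> M'}) (f3 : {linear L -> P}) : (forall x, f (g x) = f1 (f2 (f3 x))) ->
  forall t : htens Q L, (Q ◁ f) ((Q ◁ g) t) = (Q ◁ f1) ((Q ◁ f2) ((Q ◁ f3) t)).
Proof.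
move=> e t; rewrite whisker_comp; move: t; hind => q l.
by rewrite !hmE -e.
Qed.
End WhiskeredIdentities.

(** Equations between elements of a left-bracketed tensor are proved after applying [asl], which
    brings them into the right-bracketed form of the calculus. *)
Lemma hasc_inj (M N P : lmodType H) : injective (asl M N P).
Proof. by apply: (can_inj (g := asr M N P)) => t; by rewrite aslU asrU; exact: (linE (hascK M N P) t). Qed.
Lemma hasciKE (M N P : lmodType H) t : asl M N P (asr M N P t) = t.
Proof. by rewrite aslU asrU; exact: (linE (hasciK M N P) t). Qed.
Lemma hascKE (M N P : lmodType H) t : asr M N P (asl M N P t) = t.
Proof. by rewrite aslU asrU; exact: (linE (hascK M N P) t). Qed.
Lemma whisker_inj (Q L M : lmodType H) (f : {linear L -> M}) (g : {linear M -> L}) :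
  cancel f g -> injective (Q ◁ f).
Proof.
move=> fK; apply: (can_inj (g := Q ◁ g)) => t; rewrite whisker_comp.
by apply: whisker_id => x; exact: fK.
Qed.

Definition wT2 X Y : {linear htens b (htens X Y) -> htens (htens b X) (htens b Y)} :=
  locked (lincomp (asr b X (htens b Y)) (lincomp (b ◁ pass X Y) (wcop (htens X Y)))).
Lemma wT2E X Y t : wT2 X Y t = asr b X (htens b Y) ((b ◁ pass X Y) (wcop (htens X Y) t)).
Proof. by rewrite /wT2 -lock. Qed.
Definition wT0 : {linear htens b (htriv H) -> htriv H} := wcou (htriv H).

Lemma wT2_nat X X' Y Y' (f : {linear X -> X'}) (g : {linear Y -> Y'}) t :
  wT2 X' Y' ((b ◁ (hm f g)) t) = hm (b ◁ f) (b ◁ g) (wT2 X Y t).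
Proof.
rewrite !wT2E wcop_nat (whisker22 (pass_nat f g)).
move: ((b ◁ pass X Y) _); apply: htens_ext3 => [||c x w]; [morph_add|morph_add|].
by rewrite !hmE !asrE !hmE.
Qed.

(** Tensoring T2 with W is again comultiplying and crossing X, with Y ⊗ W as the spectator. *)
Lemma wT2_whisker X Y W t :
  (b ◁ (X ◁ asl b Y W)) (asl b X (htens (htens b Y) W)
     (asl (htens b X) (htens b Y) W (hm (wT2 X Y) (linid W) (asr b (htens X Y) W t)))) =
  (b ◁ pass X (htens Y W)) (wcop (htens X (htens Y W)) ((b ◁ asl X Y W) t)).
Proof.
move: t; apply: htens_ext31 => [||c x y w]; [morph_add|morph_add|].
rewrite asrE !hmE aslE wT2E !wcopE; move: (br_cop c); hind => d e.
rewrite !aslE !hmE !passE; move: (br_tau X (hpure e x)); hind => x' e'.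
by rewrite !aslE asrE !aslE !hmE !aslE.
Qed.

Lemma hasc_whisker X Y Z (g : {linear Y -> Z}) t :
  asl b X Z (hm (linid (htens b X)) g (asr b X Y t)) = (b ◁ (X ◁ g)) t.
Proof.
move: t; apply: htens_ext3 => [||c x y]; [morph_add|morph_add|].
by rewrite asrE !hmE aslE.
Qed.

(** The hexagon splits the crossing of X ⊗ Y, and centrality of the coproduct moves the second
    comultiplication before the crossing of X. What remains is coassociativity of B. *)
Lemma wT2_coassoc X Y Z t :
  asl (htens b X) (htens b Y) (htens b Z) (hm (wT2 X Y) (linid (htens b Z)) (wT2 (htens X Y) Z t)) =
  hm (linid (htens b X)) (wT2 Y Z) (wT2 X (htens Y Z) ((b ◁ asl X Y Z) t)).
Proof.
apply: hasc_inj; apply: (@whisker_inj b _ _ (X ◁ asl b Y (htens b Z)) (X ◁ asr b Y (htens b Z))).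
  by move=> u; rewrite whisker_comp; apply: whisker_id => v; exact: hascKE.
rewrite (@wT2E (htens X Y) Z) wT2_whisker (@wT2E X (htens Y Z)) hasc_whisker.
rewrite (whisker23 (@pass_tens X Y Z)) -wcop_nat.
move: ((b ◁ asl X Y Z) t) => {}t.
rewrite !wcop_nat (whisker22 (pass_nat (linid X) (pass Y Z))).
have e u : (X ◁ asl b Y (htens b Z)) ((X ◁ wT2 Y Z) u) = (X ◁ (b ◁ pass Y Z)) ((X ◁ wcop (htens Y Z)) u).
  by apply: whisker22 => v; rewrite wT2E hasciKE.
rewrite (whisker22 e) (whisker23 (@pass_cop X (htens Y Z))).
by rewrite wcop_coassoc.
Qed.

Lemma wT2_counitl X t :
  hlun (htens b X) (hm wT0 (linid (htens b X)) (wT2 (htriv H) X t)) = (b ◁ hlun X) t.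
Proof.
rewrite wT2E -[RHS]wcop_counitl wcop_nat.
move: (wcop _ t); apply: htens_ext4 => [||c d a x]; [morph_add|morph_add|].
rewrite !hmE pass_unit asrE hmE hlunE hlunE /wT0 !wcouE htriv_src mulr1.
by [].
Qed.

(** The counit meets the strand that has already crossed X, so centrality of the counit enters,
    whereas the left law only crosses the unit object. *)
Lemma wT2_counitr X t :
  hrun (htens b X) (hm (linid (htens b X)) wT0 (wT2 X (htriv H) t)) = (b ◁ hrun X) t.
Proof.
rewrite wT2E -[RHS]wcop_counitr wcop_nat whisker_comp.
transitivity ((b ◁ lincomp (hrun X) (lincomp (X ◁ wT0) (pass X (htriv H)))) (wcop (htens X (htriv H)) t)).
  rewrite -!whisker_comp; move: ((b ◁ pass X _) _).
  apply: htens_ext3 => [||c x w]; [morph_add|morph_add|].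
  rewrite asrE !hmE !hrunE; have := @hscale_eta _ _ _ _ _ 1 (wT0 w) c x.
  by rewrite bd_etaE bd_src1 mul1r scale1r.
apply: whisker_ext => u; rewrite !lincompE pass_cou.
by rewrite wcou_nat.
Qed.

Lemma asl_wmul X Y t :
  asl b X (htens b Y) (hm (wmul X) (wmul Y) (asr b (htens b X) (htens b (htens b Y))
    ((b ◁ asr b X (htens b (htens b Y))) t))) =
  wmul (htens X (htens b Y)) ((b ◁ (b ◁ (X ◁ wmul Y))) t).
Proof.
move: t; apply: htens_ext4 => [||c d x w]; [morph_add|morph_add|].
by rewrite !hmE !asrE !hmE !wmulE aslE.
Qed.

Lemma pass_wT2 X Y t :
  pass (htens b X) (htens b Y) ((b ◁ wT2 X Y) t) =
  asr b X (htens b (htens b Y)) ((b ◁ pass X (htens b Y))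
   ((b ◁ (b ◁ pass X Y)) (pass b (htens b (htens X Y)) ((b ◁ wcop (htens X Y)) t)))).
Proof.
apply: hasc_inj; rewrite pass_tens hasciKE -pass_nat; congr ((b ◁ pass X (htens b Y)) (pass b _ _)).
by apply: whisker22 => u; rewrite wT2E hasciKE.
Qed.

(** The bialgebra axiom expands the coproduct of a product, and centrality of multiplication lets
    both factors cross X separately. On the other side the crossing of B ⊗ X is split by the
    hexagon, in [pass_wT2]. *)
Lemma wT2_mul X Y t :
  wT2 X Y (wmul (htens X Y) t) =
  hm (wmul X) (wmul Y) (wT2 (htens b X) (htens b Y) ((b ◁ wT2 X Y) t)).
Proof.
apply: hasc_inj; rewrite wT2E hasciKE wcop_mul -wmul_nat.
rewrite (whisker23 (whisker23 (@pass_mul X Y))) [in RHS]wT2E !wcop_nat.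
pose G := lincomp (asr b X (htens b (htens b Y))) (lincomp (b ◁ pass X (htens b Y))
   (lincomp (b ◁ (b ◁ pass X Y)) (lincomp (pass b (htens b (htens X Y))) (b ◁ wcop (htens X Y))))).
rewrite (whisker_comp (pass (htens b X) (htens b Y))) (whisker_ext (g := G)); last by move=> u; exact: pass_wT2.
rewrite /G -!whisker_comp asl_wmul.
by [].
Qed.

Lemma wT2_one X Y t : wT2 X Y (wone (htens X Y) t) = hm (wone X) (wone Y) t.
Proof.
apply: hasc_inj; rewrite wT2E hasciKE wcop_one -wone_nat pass_one woneE.
by move: t; hind => x y; rewrite !hmE !woneE aslE.
Qed.

(** * The left fusion operator of B ⊗ - and its inverse *)

Definition wfusion X Y : {linear htens b (htens X (htens b Y)) -> htens (htens b X) (htens b Y)} :=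
  locked (lincomp (htens b X ◁ wmul Y) (wT2 X (htens b Y))).
Definition wfusion_inv X Y : {linear htens (htens b X) (htens b Y) -> htens b (htens X (htens b Y))} :=
  locked (lincomp (lincomp (b ◁ (X ◁ (lincomp (wmul Y) (want (htens b Y))))) (b ◁ pass X (htens b Y)))
    (lincomp (wcop (htens X (htens b Y))) (asl b X (htens b Y)))).
Lemma wfusionE X Y t : wfusion X Y t = (htens b X ◁ wmul Y) (wT2 X (htens b Y) t).
Proof. by rewrite /wfusion -lock. Qed.
Lemma wfusion_invE X Y t : wfusion_inv X Y t = (b ◁ (X ◁ (lincomp (wmul Y) (want (htens b Y)))))
  ((b ◁ pass X (htens b Y)) (wcop (htens X (htens b Y)) (asl b X (htens b Y) t))).
Proof. by rewrite /wfusion_inv -lock. Qed.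
Lemma asl_wfusion X Y t : asl b X (htens b Y) (wfusion X Y t) =
  (b ◁ (X ◁ wmul Y)) ((b ◁ pass X (htens b Y)) (wcop (htens X (htens b Y)) t)).
Proof. by rewrite wfusionE wT2E hasc_whisker. Qed.

(** One argument for both composites. Each operator comultiplies, crosses X and applies some g to
    the crossed strand together with B ⊗ Y; g is multiplication, preceded by the antipode in the
    inverse. Coassociativity and centrality of the coproduct bring both g's behind a single
    crossing, where the hypothesis, a convolution identity, leaves the counit. *)
Lemma fusion_comp X Y (g1 g2 : {linear htens b (htens b Y) -> htens b Y}) t :
  (forall z, g1 ((b ◁ g2) (wcop (htens b Y) z)) = wcou (htens b Y) z) ->
  (b ◁ (X ◁ g1)) ((b ◁ pass X (htens b Y)) (wcop (htens X (htens b Y))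
    ((b ◁ (X ◁ g2)) ((b ◁ pass X (htens b Y)) (wcop (htens X (htens b Y)) t))))) = t.
Proof.
move=> g12; rewrite !wcop_nat (whisker22 (pass_nat (linid X) g2)) -wcop_coassoc.
rewrite -(whisker23 (@pass_cop X (htens b Y))).
have e z : (X ◁ g1) ((X ◁ (b ◁ g2)) ((X ◁ wcop (htens b Y)) z)) = (X ◁ wcou (htens b Y)) z.
  by rewrite !whisker_comp; apply: whisker_ext => u; rewrite -g12.
have e' z : (X ◁ g1) ((X ◁ (b ◁ g2)) ((X ◁ wcop (htens b Y)) (pass X (htens b Y) z))) = wcou _ z.
  by rewrite e pass_cou.
rewrite !whisker_comp -[RHS]wcop_counitr; apply: whisker_ext => z; exact: e'.
Qed.

Lemma wfusion_invK X Y : cancel (wfusion_inv X Y) (wfusion X Y).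
Proof.
move=> t; apply: hasc_inj; rewrite asl_wfusion wfusion_invE; apply: fusion_comp => z.
rewrite -whisker_comp wmul_assoc antipode_r.
by rewrite wmul_unitl.
Qed.
Lemma wfusionK X Y : cancel (wfusion X Y) (wfusion_inv X Y).
Proof.
move=> t; rewrite wfusion_invE asl_wfusion; apply: fusion_comp => z.
by rewrite lincompE want_nat wmul_assoc antipode_l wmul_unitl.
Qed.

(** [tensor_bimonad B] rewritten with the spectator maps; once [tensor_bimonadE] identifies the two,
    the identities above are its axioms. *)
Definition tensor_bimonad_lin : bimonad_data (HMod H) :=
  @BimonadData (HMod H) (fun X => htens b X : lmodType H) (fun X Y f => b ◁ f) wmul wone wT2 wT0.

Lemma wmulU X : wmul X = lincomp (hmor br_mul (linid X)) (hasci b b X).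
Proof. by rewrite /wmul -lock hmU asrU. Qed.
Lemma woneU X : wone X = lincomp (hmor br_one (linid X)) (hluni X).
Proof. by rewrite /wone -lock hmU. Qed.
Lemma wT2U X Y : wT2 X Y =
  lincomp (exchange (lh_tau B) b X Y) (hmor br_cop (linid (htens X Y))).
Proof.
apply: linext => t; rewrite wT2E [RHS]lincompE exchange_lin !lincompE.
by rewrite /wcop -lock lincompE asrU !hmU aslU.
Qed.
(** One side multiplies by a after the counit, the other lets a act on c before it; both send c ⊗ a
    to epsilon(c) a. *)
Lemma wT0U : wT0 = lincomp br_cou (hrun b).
Proof.
apply: linext; hind => c a; rewrite /wT0 wcouE lincompE hrunE.
by rewrite [RHS](linearZZ br_cou) htriv_src [RHS]htriv_tgt.
Qed.

Lemma tensor_bimonadE : tensor_bimonad B = tensor_bimonad_lin.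
Proof.
rewrite /tensor_bimonad_lin wT0U (boolp.functional_extensionality_dep wmulU).
rewrite (boolp.functional_extensionality_dep woneU).
rewrite (boolp.functional_extensionality_dep (fun X => boolp.functional_extensionality_dep (wT2U X))).
have -> : (fun X Y f => b ◁ f) = (fun (X Y : lmodType H) (f : {linear X -> Y}) => hmor (linid b) f).
  do 3 (apply: boolp.functional_extensionality_dep => ?); exact: hmU.
by [].
Qed.

Lemma tensor_bimonadP : is_bimonad (tensor_bimonad B).
Proof.
have hm1 (M N : lmodType H) : hm (linid M) (linid N) = linid (htens M N).
  by rewrite hmU hmor1.
have whC (M N P Q : lmodType H) (g : {linear N -> P}) (f : {linear M -> N}) :
  (Q ◁ lincomp g f) = lincomp (Q ◁ g) (Q ◁ f).
  by apply: linext => t; rewrite lincompE whisker_comp.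
rewrite tensor_bimonadE; split.
  split=> [X|]; first exact: hm1.
  split=> [X Y Z g f|]; first exact: whC.
  split=> [X Y f|]; first by apply: linext => t; rewrite [RHS]wmul_nat.
  split=> [X Y f|]; first by apply: linext => t; rewrite [RHS]wone_nat.
  split=> [X|]; first by apply: linext => t; exact: wmul_assoc.
  by split=> X; apply: linext => t; [exact: wmul_unitr|exact: wmul_unitl].
split.
  split=> [X X' Y Y' f g|].
    apply: linext => t; rewrite -[LHS]/(wT2 X' Y' ((b ◁ (hmor f g)) t)) -hmU.
    by rewrite wT2_nat hmU.
  split=> [X Y Z|].
    apply: linext => t; have := wT2_coassoc t.
    by rewrite (hmU (wT2 X Y)) (hmU (linid _) (wT2 Y Z)) !aslU.
  split=> X; apply: linext => t.
    by have := wT2_counitl t; rewrite (hmU wT0).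
  by have := wT2_counitr t; rewrite (hmU (linid _) wT0).
split=> [X Y|]; first by apply: linext => t; have := wT2_mul t; rewrite (hmU (wmul X)).
split; first by apply: linext => t; exact: wcou_mul.
split=> [X Y|]; first by apply: linext => t; have := wT2_one t; rewrite (hmU (wone X)).
by apply: linext => t; exact: wcou_one.
Qed.

Lemma tensor_bimonad_left_fusion X Y : is_iso (left_fusion (tensor_bimonad B) X Y).
Proof.
rewrite tensor_bimonadE; exists (wfusion_inv X Y).
have -> : left_fusion tensor_bimonad_lin X Y = wfusion X Y.
  by apply: linext => t; rewrite wfusionE (hmU _ (wmul Y)).
by split; apply: linext => t; [exact: wfusionK|exact: wfusion_invK].
Qed.
End BraidedCalculus.

(** * The bialgebroid of a linear bimonad on H-modules *)

Section RegularModule.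
Variables (R : nzRingType) (N : lmodType R).
Let orb (n : N) (h : R^o) : N := (h : R) *: n.
Let orb_lin n : linear (orb n).
Proof. by move=> a x y; rewrite /orb scalerDl scalerA. Qed.
Definition orbit_map (n : N) : {linear R^o -> N} := mklin (orb_lin n).
Lemma orbit_mapE n h : orbit_map n h = h *: n. Proof. by []. Qed.
Lemma orbit_map1 n : orbit_map n 1 = n. Proof. by rewrite orbit_mapE scale1r. Qed.
End RegularModule.

Lemma orbit_map_comp (R : nzRingType) (N P : lmodType R) (f : {linear N -> P}) n h :
  f (orbit_map n h) = orbit_map (f n) h.
Proof. by rewrite !orbit_mapE linearZ. Qed.

(** K acts on morphisms through the central elements [k%:A] of H. The combination k f + g is
    represented by any H-linear [h] with these values. *)
Record linear_bimonad (K : fieldType) (A : algType K) (H : bialgebroid A) := LinearBimonad {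
  lb_bimonad :> bimonad_data (HMod H);
  lb_bimonadP : is_bimonad lb_bimonad;
  lb_linear : forall (X Y : lmodType H) (k : K) (f g h : {linear X -> Y}),
    (forall x, h x = (k%:A : H) *: f x + g x) ->
    forall q, (bm_mor lb_bimonad h :
        {linear (lb_bimonad X : lmodType H) -> (lb_bimonad Y : lmodType H)}) q =
      (k%:A : H) *: (bm_mor lb_bimonad f :
        {linear (lb_bimonad X : lmodType H) -> (lb_bimonad Y : lmodType H)}) q +
      (bm_mor lb_bimonad g :
        {linear (lb_bimonad X : lmodType H) -> (lb_bimonad Y : lmodType H)}) q
}.

(** * The axioms of a linear bimonad on elements *)

Section Elements.
Variables (K : fieldType) (A : algType K) (H : bialgebroid A) (Q : linear_bimonad H).
Implicit Types X Y Z : lmodType H.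

Definition qo X : lmodType H := lb_bimonad Q X.
Definition qm X Y (f : {linear X -> Y}) : {linear qo X -> qo Y} := bm_mor Q f.
Definition qmu X : {linear qo (qo X) -> qo X} := bm_mu Q X.
Definition qeta X : {linear X -> qo X} := bm_eta Q X.
Definition qT2 X Y : {linear qo (htens X Y) -> htens (qo X) (qo Y)} := bm_T2 Q X Y.
Definition qT0 : {linear qo (htriv H) -> htriv H} := bm_T0 Q.

Lemma qm_id X q : qm (linid X) q = q.
Proof. by case: (lb_bimonadP Q) => [[e _] _]; exact: (linE (e X) q). Qed.
Lemma qm_comp X Y Z (g : {linear Y -> Z}) (f : {linear X -> Y}) q :
  qm (lincomp g f) q = qm g (qm f q).
Proof. by case: (lb_bimonadP Q) => [[_ [e _]] _]; exact: (linE (e _ _ _ g f) q). Qed.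
Lemma qmu_nat X Y (f : {linear X -> Y}) q : qm f (qmu X q) = qmu Y (qm (qm f) q).
Proof. by case: (lb_bimonadP Q) => [[_ [_ [e _]]] _]; exact: (linE (e _ _ f) q). Qed.
Lemma qeta_nat X Y (f : {linear X -> Y}) x : qm f (qeta X x) = qeta Y (f x).
Proof. by case: (lb_bimonadP Q) => [[_ [_ [_ [e _]]]] _]; exact: (linE (e _ _ f) x). Qed.
Lemma qmuA X q : qmu X (qm (qmu X) q) = qmu X (qmu (qo X) q).
Proof. by case: (lb_bimonadP Q) => [[_ [_ [_ [_ [e _]]]]] _]; exact: (linE (e X) q). Qed.
Lemma qmu_etar X q : qmu X (qm (qeta X) q) = q.
Proof. by case: (lb_bimonadP Q) => [[_ [_ [_ [_ [_ [e _]]]]]] _]; exact: (linE (e X) q). Qed.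
Lemma qmu_eta X q : qmu X (qeta (qo X) q) = q.
Proof. by case: (lb_bimonadP Q) => [[_ [_ [_ [_ [_ [_ e]]]]]] _]; exact: (linE (e X) q). Qed.
Lemma qT2_nat X X' Y Y' (f : {linear X -> X'}) (g : {linear Y -> Y'}) q :
  qT2 X' Y' (qm (hmor f g) q) = hmor (qm f) (qm g) (qT2 X Y q).
Proof. by case: (lb_bimonadP Q) => [_ [[e _] _]]; exact: (linE (e _ _ _ _ f g) q). Qed.
Lemma qT2_mu X Y q :
  qT2 X Y (qmu (htens X Y) q) = hmor (qmu X) (qmu Y) (qT2 (qo X) (qo Y) (qm (qT2 X Y) q)).
Proof. by case: (lb_bimonadP Q) => [_ [_ [e _]]]; exact: (linE (e X Y) q). Qed.
Lemma qT0_mu q : qT0 (qmu (htriv H) q) = qT0 (qm qT0 q).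
Proof. by case: (lb_bimonadP Q) => [_ [_ [_ [e _]]]]; exact: (linE e q). Qed.
Lemma qT2_eta X Y t : qT2 X Y (qeta (htens X Y) t) = hmor (qeta X) (qeta Y) t.
Proof. by case: (lb_bimonadP Q) => [_ [_ [_ [_ [e _]]]]]; exact: (linE (e X Y) t). Qed.
Lemma qT0_eta a : qT0 (qeta (htriv H) a) = a.
Proof. by case: (lb_bimonadP Q) => [_ [_ [_ [_ [_ e]]]]]; exact: (linE e a). Qed.

Lemma qm_ext X Y (f g : {linear X -> Y}) q : f =1 g -> qm f q = qm g q.
Proof. by move=> /linext ->. Qed.
Lemma qm_lin X Y (k : K) (f g h : {linear X -> Y}) :
  (forall x, h x = (k%:A : H) *: f x + g x) ->
  forall q, qm h q = (k%:A : H) *: qm f q + qm g q.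
Proof. exact: lb_linear. Qed.
Lemma qm_add X Y (f g h : {linear X -> Y}) :
  (forall x, h x = f x + g x) -> forall q, qm h q = qm f q + qm g q.
Proof.
move=> e q; rewrite (@qm_lin _ _ 1 f g) ?scale1r ?scale1r //.
by move=> x; rewrite e !scale1r.
Qed.
Lemma qm_zero X Y (f : {linear X -> Y}) : (forall x, f x = 0) -> forall q, qm f q = 0.
Proof.
move=> f0 q; apply: (@addrI _ (qm f q)); rewrite addr0 -(qm_add (h := f)) // => x.
by rewrite f0 addr0.
Qed.
Lemma qm_scale X Y (k : K) (f h : {linear X -> Y}) :
  (forall x, h x = (k%:A : H) *: f x) -> forall q, qm h q = (k%:A : H) *: qm f q.
Proof.
move=> e q; pose z : {linear X -> Y} := \0.
by rewrite (@qm_lin _ _ k f z) ?(qm_zero (f := z)) ?addr0 // => x; rewrite e addr0.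
Qed.
End Elements.

(** * The algebra Q(H) *)

Section CrossAlgebra.
Variables (K : fieldType) (A : algType K) (H : bialgebroid A) (Q : linear_bimonad H).
Notation Hr := (H^o : lmodType H).
Notation D := (qo Q Hr).
Notation act := orbit_map.

(* Multiplication by [y] is the Kleisli extension of the H-linear map h |-> h y. *)
Definition cross_mul (x y : D) : D := qmu Q Hr (qm Q (act y) x).
Definition cross_unit (h : H) : D := qeta Q Hr h.

Lemma cross_mulE x y : cross_mul x y = qmu Q Hr (qm Q (act y) x). Proof. by []. Qed.

Lemma cross_mul_scale (h : H) x y : cross_mul (h *: x) y = h *: cross_mul x y.
Proof. by rewrite !cross_mulE !linearZ. Qed.
(** The two sides of multiplication by the image of H: from the left it is the H-action on Q(H),
    from the right it is Q of right multiplication in H. *)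
Lemma cross_unit_mul h d : cross_mul (cross_unit h) d = h *: d.
Proof. by rewrite cross_mulE qeta_nat qmu_eta. Qed.
Lemma cross_mul_unit d h : cross_mul d (cross_unit h) = qm Q (act (h : Hr)) d.
Proof.
rewrite cross_mulE -[RHS]qmu_etar -qm_comp; congr (qmu Q Hr _).
by apply: qm_ext => x; rewrite lincompE -orbit_map_comp.
Qed.
Lemma cross_unit_scale h k : h *: cross_unit k = cross_unit (h * k).
Proof. by rewrite /cross_unit -linearZ. Qed.

Let mulA : associative cross_mul.
Proof.
move=> x y z; rewrite !cross_mulE qmu_nat -qmuA; congr (qmu Q Hr _).
rewrite -!qm_comp; apply: qm_ext => h.
by rewrite !lincompE !orbit_mapE !linearZ.
Qed.
Let mul1 : left_id (cross_unit 1) cross_mul.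
Proof. by move=> x; rewrite cross_unit_mul scale1r. Qed.
Let mulr1 : right_id (cross_unit 1) cross_mul.
Proof.
move=> x; rewrite cross_mul_unit -[RHS]qm_id; apply: qm_ext => h.
by rewrite orbit_mapE [LHS]mulr1.
Qed.
Let mulDl : left_distributive cross_mul +%R.
Proof. by move=> x y z; rewrite !cross_mulE !raddfD. Qed.
Let mulDr : right_distributive cross_mul +%R.
Proof.
move=> x y z; rewrite !cross_mulE -raddfD; congr (qmu Q Hr _).
by apply: qm_add => h; rewrite !orbit_mapE scalerDr.
Qed.

(** T0 after Q of the counit of H. It precedes the ring structure because 1 != 0 in D is read off
    from epsilon(1) = 1. *)
Definition cross_eps (d : D) : A := qT0 Q (qm Q (act ((1 : A) : htriv H)) d).
Lemma cross_eps_unit h : cross_eps (cross_unit h) = bd_eps h.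
Proof. by rewrite /cross_eps qeta_nat qT0_eta [LHS]htrivE bd_src1 GRing.mulr1. Qed.
Let one_neq0 : cross_unit 1 != 0 :> D.
Proof.
apply/eqP => /(congr1 cross_eps); rewrite cross_eps_unit [bd_eps _]bd_counit1.
by rewrite /cross_eps !raddf0 => /eqP; rewrite oner_eq0.
Qed.

Definition cross_alg : Type := D.
HB.instance Definition _ := GRing.Zmodule.on cross_alg.
HB.instance Definition _ := GRing.Zmodule_isNzRing.Build cross_alg
  mulA mul1 mulr1 mulDl mulDr one_neq0.

Let kscale (k : K) (x : cross_alg) : cross_alg := (k%:A : H) *: (x : D).
Let kscaleA a c v : kscale a (kscale c v) = kscale (a * c) v.
Proof. by rewrite /kscale scalerA -scalerAl mul1r scalerA. Qed.
Let kscale1 : left_id 1 kscale.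
Proof. by move=> x; rewrite /kscale !scale1r. Qed.
Let kscaleDr : right_distributive kscale +%R.
Proof. by move=> k x y; exact: scalerDr. Qed.
Let kscaleDl v : {morph kscale^~ v : a c / a + c}.
Proof. by move=> a c; rewrite /kscale !scalerDl. Qed.
HB.instance Definition _ := GRing.Zmodule_isLmodule.Build K cross_alg
  kscaleA kscale1 kscaleDr kscaleDl.
Let kscaleAl (k : K) (x y : cross_alg) : k *: (x * y) = (k *: x) * y.
Proof. by symmetry; exact: cross_mul_scale. Qed.
HB.instance Definition _ := GRing.Lmodule_isLalgebra.Build K cross_alg kscaleAl.
Let kscaleAr (k : K) (x y : cross_alg) : k *: (x * y) = x * (k *: y).
Proof.
rewrite -[LHS]/((k%:A : H) *: cross_mul x y) -[RHS]/(cross_mul x ((k%:A : H) *: (y : D))).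
rewrite !cross_mulE -linearZ; congr (qmu Q Hr _); symmetry.
apply: qm_scale => h; rewrite !orbit_mapE !scalerA; congr (_ *: _).
by rewrite -scalerAr -scalerAl GRing.mulr1 mul1r.
Qed.
HB.instance Definition _ := GRing.Lalgebra_isAlgebra.Build K cross_alg kscaleAr.

Definition cross_eta (x : env A) : cross_alg := cross_unit (bd_eta H x).
Let eta_zmod : zmod_morphism cross_eta.
Proof. by move=> x y; rewrite /cross_eta /cross_unit !raddfB. Qed.
Let eta_monoid : monoid_morphism cross_eta.
Proof.
split; first by rewrite /cross_eta rmorph1.
by move=> x y; rewrite [RHS]cross_unit_mul cross_unit_scale /cross_eta rmorphM.
Qed.
Let eta_scalable : scalable cross_eta.
Proof.
move=> k x; rewrite /cross_eta linearZ /= -mulr_algl.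
by symmetry; exact: cross_unit_scale.
Qed.
HB.instance Definition _ := GRing.isZmodMorphism.Build (env A) cross_alg cross_eta eta_zmod.
HB.instance Definition _ := GRing.isMonoidMorphism.Build (env A) cross_alg cross_eta eta_monoid.
HB.instance Definition _ := GRing.isScalable.Build K (env A) cross_alg *:%R cross_eta eta_scalable.
End CrossAlgebra.

(** * The bialgebroid axioms for Q(H) *)

Section CrossBialgebroid.
Variables (K : fieldType) (A : algType K) (H : bialgebroid A) (Q : linear_bimonad H).
Notation Hr := (H^o : lmodType H).
Notation D := (qo Q Hr).
Notation act := orbit_map.
Notation "'|' M" := (res (bd_eta H) M) (at level 20, only parsing).
Notation eta := (cross_eta Q : {lrmorphism env A -> cross_alg Q}).
Notation Db := (lbimod eta).

(** The comultiplication of H as an H-linear map out of the regular module: h (1 ⊗ 1) = h_1 ⊗ h_2.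
    Likewise [reg_eps] is the counit of H. *)
Definition reg_Delta : {linear Hr -> htens Hr Hr} := act (hpure (1 : Hr) (1 : Hr)).
Definition reg_eps : {linear Hr -> htriv H} := act ((1 : A) : htriv H).

Lemma reg_comonoid : @is_comonoid (HMod H) Hr reg_Delta reg_eps.
Proof.
by split; apply: regular_linext; rewrite !lincompE /reg_Delta /reg_eps orbit_map1 !hmorE !orbit_map1
  ?[RHS]hmorE ?[LHS]hascE ?[LHS]hlunE ?[LHS]hrunE ?bd_src1 ?bd_tgt1 ?scale1r.
Qed.

(** The action of A^e through the unit map of D and the one restricted from H agree by
    [cross_unit_mul]; [cross_res] and [cross_resi] are the identity between them. *)
Let to_res (x : Db) : (| D) := x.
Let to_res_lin : linear to_res.
Proof.
move=> a x y; rewrite /to_res; congr (_ + _).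
exact: (cross_unit_mul (Q := Q) (bd_eta H a) (x : D)).
Qed.
Definition cross_res : {linear Db -> (| D)} := mklin to_res_lin.
Let of_res (x : (| D)) : Db := x.
Let of_res_lin : linear of_res.
Proof.
move=> a x y; rewrite /of_res; congr (_ + _); symmetry.
exact: (cross_unit_mul (Q := Q) (bd_eta H a) (x : D)).
Qed.
Definition cross_resi : {linear (| D) -> Db} := mklin of_res_lin.

Definition cross_Delta (d : D) : htens D D := qT2 Q Hr Hr (qm Q reg_Delta d).

(* The identity of D (x)_A D, between its two presentations through eta_H and eta_D. *)
Definition cross_dia (t : htens D D) : btens Db Db := btmor cross_resi cross_resi t.
Lemma cross_diaD : {morph cross_dia : s t / s + t}.
Proof. exact: (raddfD (btmor _ _)). Qed.
Lemma cross_dia0 : cross_dia 0 = 0. Proof. exact: (raddf0 (btmor _ _)). Qed.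
Lemma cross_diaE d e : cross_dia (hpure d e) = dpure eta d e.
Proof. exact: btmorE. Qed.
Lemma cross_dia_sum (I : Type) (s : seq I) (f : I -> htens D D) :
  cross_dia (\sum_(i <- s) f i) = \sum_(i <- s) cross_dia (f i).
Proof. exact: (big_morph _ cross_diaD cross_dia0). Qed.
Lemma cross_dia_inj : injective cross_dia.
Proof.
apply: (can_inj (g := fun t => btmor cross_res cross_res t : htens D D)).
elim/htens_ind=> [|s t hs ht|d e]; first by rewrite cross_dia0; exact: (raddf0 (btmor _ _)).
  by rewrite cross_diaD -[in RHS]hs -[in RHS]ht; exact: (raddfD (btmor _ _)).
by rewrite cross_diaE; exact: btmorE.
Qed.

Definition cross_comul : {linear Db -> btens Db Db} :=
  lincomp (lincomp (btmor cross_resi cross_resi)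
    (lincomp (res_tens D D) (res_mor (lincomp (qT2 Q Hr Hr) (qm Q reg_Delta))))) cross_res.
Definition cross_counit : {linear Db -> regb A} :=
  lincomp (lincomp (res_triv H) (res_mor (lincomp (qT0 Q) (qm Q reg_eps)))) cross_res.
Lemma cross_comulE (d : D) : cross_comul d = cross_dia (cross_Delta d). Proof. by []. Qed.
Lemma cross_counitE (d : D) : cross_counit d = cross_eps d. Proof. by []. Qed.

Lemma cross_comonoid : @is_comonoid (Bimod A) Db cross_comul cross_counit.
Proof.
apply: (@is_comonoid_transport (Bimod A) Db (| D) cross_res cross_resi); [exact: linext|exact: linext|].
apply: (comonoidal_functor_comonoid (res_comonoidal_functor H)).
exact: (comonoidal_functor_comonoid (bimonad_comonoidal_functor (lb_bimonadP Q)) reg_comonoid).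
Qed.

Definition rmul (d : D) : {linear D -> D} := lincomp (qmu Q Hr) (qm Q (act d)).
Lemma rmulE (d e : D) : rmul d e = cross_mul e d. Proof. by []. Qed.

(** Compatibility of T2 with mu makes the coproduct of d e come from Q of h |-> h e_1 ⊗ h e_2, taken
    over the whole coproduct of e. Additivity of Q splits this along any expansion [w], and
    naturality of T2 turns each term into right multiplication of the coproduct of d. *)
Lemma cross_Delta_mulr (d e : D) (w : seq (D * D)) :
  cross_Delta e = \sum_(q <- w) hpure q.1 q.2 ->
  cross_Delta (cross_mul d e) = \sum_(q <- w) hmor (rmul q.1) (rmul q.2) (cross_Delta d).
Proof.
move=> hw; rewrite /cross_Delta cross_mulE qmu_nat qT2_mu -!qm_comp.
have -> : qm Q (lincomp (lincomp (qT2 Q Hr Hr) (qm Q reg_Delta)) (act e)) d =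
   \sum_(q <- w) qm Q (lincomp (hmor (act q.1) (act q.2)) reg_Delta) d.
  have : act (\sum_(q <- w) hpure q.1 q.2) =1
      lincomp (lincomp (qT2 Q Hr Hr) (qm Q reg_Delta)) (act e).
    by move=> h; rewrite -hw !lincompE !orbit_map_comp.
  move=> /linext <-; elim: w {hw} => [|q w IH].
    by rewrite !big_nil; apply: qm_zero => h; rewrite orbit_mapE scaler0.
  rewrite !big_cons -IH; apply: qm_add => h.
  by rewrite lincompE !orbit_mapE scalerDr /reg_Delta orbit_map_comp hmorE !orbit_map1.
rewrite !raddf_sum; apply: eq_bigr => q _; rewrite qm_comp.
transitivity (hmor (qmu Q Hr) (qmu Q Hr) (hmor (qm Q (act q.1)) (qm Q (act q.2)) (cross_Delta d))).
  by congr (hmor _ _ _); exact: qT2_nat.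
by rewrite -[LHS]lincompE -hmor_comp.
Qed.

Lemma cross_Delta_unit (d : D) h h1 h2 :
  h *: hpure (1 : Hr) (1 : Hr) = hpure (h1 : Hr) (h2 : Hr) ->
  cross_Delta (cross_mul d (cross_unit Q h)) =
  hmor (rmul (cross_unit Q h1)) (rmul (cross_unit Q h2)) (cross_Delta d).
Proof.
move=> e; have -> : cross_Delta (cross_mul d (cross_unit Q h)) =
   \sum_(q <- [:: (cross_unit Q h1, cross_unit Q h2)]) hmor (rmul q.1) (rmul q.2) (cross_Delta d).
  apply: cross_Delta_mulr => //.
  by rewrite big_seq1 /cross_Delta qeta_nat qT2_eta /reg_Delta orbit_mapE e hmorE.
by rewrite big_seq1.
Qed.

(** Compatibility of T0 with mu shows that epsilon(d e) depends on e only through epsilon(e). The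
    counit axioms then reduce to computing epsilon on source and target elements. *)
Lemma cross_eps_mulr (d e e' : D) : cross_eps e = cross_eps e' ->
  cross_eps (cross_mul d e) = cross_eps (cross_mul d e').
Proof.
have E x : cross_eps (cross_mul d x) = qT0 Q (qm Q (act (cross_eps x : htriv H)) d).
  rewrite /cross_eps cross_mulE qmu_nat qT0_mu -!qm_comp; congr (qT0 Q _).
  by apply: qm_ext => h; rewrite !lincompE !orbit_map_comp.
by move=> e12; rewrite !E e12.
Qed.

Lemma cross_dia_Delta (d : D) (w : seq (cross_alg Q * cross_alg Q)) :
  cross_comul d = \sum_(p <- w) dpure eta p.1 p.2 ->
  cross_Delta d = \sum_(p <- w) hpure (p.1 : D) (p.2 : D).
Proof.
move=> hw; apply: cross_dia_inj; rewrite -cross_comulE hw cross_dia_sum.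
by apply: eq_bigr => p _; rewrite cross_diaE.
Qed.

Lemma cross_dia_rmul (d x y : D) (w : seq (cross_alg Q * cross_alg Q)) :
  cross_Delta d = \sum_(p <- w) hpure (p.1 : D) (p.2 : D) ->
  cross_dia (hmor (rmul x) (rmul y) (cross_Delta d)) =
  \sum_(p <- w) dpure eta (p.1 * (x : cross_alg Q)) (p.2 * (y : cross_alg Q)).
Proof.
move=> ->; rewrite (raddf_sum (hmor _ _)) cross_dia_sum; apply: eq_bigr => p _.
by rewrite -cross_diaE; congr cross_dia; exact: hmorE.
Qed.

Lemma cross_comul_act (d : cross_alg Q) (r s : A) (w : seq (cross_alg Q * cross_alg Q)) :
  cross_comul d = \sum_(p <- w) dpure eta p.1 p.2 ->
  cross_comul (d * eta (envp r s)) =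
    \sum_(p <- w) dpure eta (p.1 * eta (envp r 1)) (p.2 * eta (envp 1 s)).
Proof.
move=> /cross_dia_Delta hw; rewrite cross_comulE -(cross_dia_rmul _ _ hw); congr cross_dia.
by apply: cross_Delta_unit; rewrite hscale_eta; congr hpure; exact: mulr1.
Qed.

Lemma cross_counit_act (d : cross_alg Q) (r : A) :
  cross_counit (d * eta (envp r 1)) = cross_counit (d * eta (envp 1 r)).
Proof.
rewrite !cross_counitE; apply: cross_eps_mulr; rewrite /= !cross_eps_unit.
by rewrite -[bd_eta H (envp r 1)]mulr1 -[bd_eta H (envp 1 r)]mulr1 [LHS]bd_eps_src
  [RHS]bd_eps_tgt [bd_eps _]bd_counit1 mulr1 mul1r.
Qed.

Lemma cross_comulM (d e : cross_alg Q) (w w' : seq (cross_alg Q * cross_alg Q)) :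
  cross_comul d = \sum_(p <- w) dpure eta p.1 p.2 ->
  cross_comul e = \sum_(q <- w') dpure eta q.1 q.2 ->
  cross_comul (d * e) = \sum_(p <- w) \sum_(q <- w') dpure eta (p.1 * q.1) (p.2 * q.2).
Proof.
move=> /cross_dia_Delta hw /cross_dia_Delta hw'.
rewrite cross_comulE (cross_Delta_mulr _ hw') cross_dia_sum exchange_big.
by apply: eq_bigr => q _; exact: cross_dia_rmul.
Qed.

Lemma cross_comul1 : cross_comul (1 : cross_alg Q) = dpure eta 1 1.
Proof.
rewrite cross_comulE -cross_diaE; congr cross_dia.
by rewrite /cross_Delta qeta_nat qT2_eta /reg_Delta orbit_map1 hmorE.
Qed.

Lemma cross_counit1 : cross_counit (1 : cross_alg Q) = (1 : A).
Proof. by rewrite cross_counitE cross_eps_unit; exact: bd_counit1. Qed.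

Lemma cross_counitM (d e : cross_alg Q) :
  cross_counit (d * e) = cross_counit (d * eta (envp (cross_counit e : A) 1)).
Proof.
rewrite !cross_counitE; apply: cross_eps_mulr; rewrite /= cross_eps_unit.
by rewrite -[bd_eta H _]mulr1 [RHS]bd_eps_src [bd_eps _]bd_counit1 mulr1.
Qed.

Lemma cross_counitMop (d e : cross_alg Q) :
  cross_counit (d * e) = cross_counit (d * eta (envp 1 (cross_counit e : A))).
Proof. by rewrite cross_counitM cross_counit_act. Qed.

Definition cross_bialgebroid : bialgebroid A :=
  @Bialgebroid K A (cross_alg Q) (cross_eta Q) cross_comul cross_counit cross_comonoid
    cross_comul_act cross_counit_act cross_comulM cross_comul1 cross_counit1 cross_counitM
    cross_counitMop.
End CrossBialgebroid.

Lemma box_resext (K : fieldType) (A : algType K) (D : bialgebroid A) (M N : lmodType (env A))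
  (f g : {linear res (bd_eta D) (box D M) -> N}) :
  (forall d m, f (boxp d m) = g (boxp d m)) -> f = g.
Proof.
move=> fg; apply: linext; elim/box_ind=> [|s t hs ht|//]; first by rewrite !raddf0.
by rewrite !raddfD /= hs ht.
Qed.

Lemma box_resext2 (K : fieldType) (A : algType K) (D : bialgebroid A) (M M' N : lmodType (env A))
  (f g : {linear res (bd_eta D) (box D (btens M M')) -> N}) :
  (forall d m m', f (boxp d (bpure m m')) = g (boxp d (bpure m m'))) -> f = g.
Proof.
move=> fg; apply: box_resext => d; elim/btens_ind=> [|s t hs ht|//].
  by rewrite [boxp d _]pure0r !raddf0.
by rewrite boxpDr !raddfD /= hs ht.
Qed.

(** * The comparison of D [x] - with the composed monad *)

Section Comparison.
Variables (K : fieldType) (A : algType K) (H : bialgebroid A) (Q : linear_bimonad H).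
Notation Hr := (H^o : lmodType H).
Notation C := (cross_bialgebroid Q).
Notation D := (qo Q Hr).
Notation act := orbit_map.
Notation T := (cross_product (free_adjunction H) (lb_bimonad Q)).
Notation bh1 m := (boxp (1 : H) m).

Section Def.
Variable M : lmodType (env A).
Notation V := (qo Q (box H M)).
Let th (d : D) (m : M) : V := qm Q (act (bh1 m : box H M)) d.
Let th_bal : balanced (fun (x : env A) (d : C) => d * bd_eta C x) (fun (x : env A) (m : M) => x *: m)
  (fun (d : C) (m : M) => th d m).
Proof.
split=> [d d' m|d m m'|x d m]; rewrite /th.
- exact: raddfD.
- by apply: qm_add => h; rewrite !orbit_mapE boxpDr scalerDr.
have -> : d * bd_eta C x = qm Q (act (bd_eta H x : Hr)) d by exact: cross_mul_unit.
rewrite -qm_comp; apply: qm_ext => h.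
by rewrite lincompE !orbit_mapE !scale_boxp !mulr1 -boxp_bal.
Qed.
Let theta0 (t : box C M) : V := tlift th_bal t.
Let theta0E d m : theta0 (boxp d m) = qm Q (act (bh1 m : box H M)) d.
Proof. exact: tlift_pure. Qed.
Let theta0D : {morph theta0 : s t / s + t}. Proof. exact: (raddfD (tlift th_bal)). Qed.
Let theta00 : theta0 0 = 0. Proof. exact: (raddf0 (tlift th_bal)). Qed.
Let theta1 (t : res (bd_eta C) (box C M)) : res (bd_eta H) V := theta0 t.
Let theta_lin : linear theta1.
Proof.
move=> x s t; rewrite /theta1 theta0D; congr (_ + _); rewrite !resE.
elim/box_ind: s => [|u v hu hv|d m]; first by rewrite scaler0 theta00 scaler0.
  by rewrite scalerDr !theta0D hu hv scalerDr.
rewrite scale_boxp !theta0E -linearZ; congr (qm Q _ _).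
exact: (cross_unit_mul (Q := Q) (bd_eta H x) (d : D)).
Qed.
Definition theta : {linear res (bd_eta C) (box C M) -> res (bd_eta H) V} := mklin theta_lin.
Lemma thetaE d m : theta (boxp d m) = qm Q (act (bh1 m : box H M)) d.
Proof. exact: theta0E. Qed.
End Def.

Lemma box_morEd (B : bialgebroid A) (M N : lmodType (env A)) (f : {linear M -> N}) d m :
  box_mor B f (boxp d m) = boxp d (f m).
Proof. by rewrite box_liftE [LHS]scale_boxp mulr1. Qed.

Lemma box_counitEd (B : bialgebroid A) (N : lmodType B) d (n : res (bd_eta B) N) :
  box_counit N (boxp d n) = d *: (n : N).
Proof. exact: box_liftE. Qed.

Lemma theta_nat (M N : lmodType (env A)) (f : {linear M -> N}) :
  lincomp (theta N) (res_mor (box_mor C f)) = lincomp (res_mor (qm Q (box_mor H f))) (theta M).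
Proof.
apply: box_resext => d m.
rewrite -[LHS]/(theta N (box_mor C f (boxp d m))) box_morEd thetaE.
rewrite -[RHS]/(qm Q (box_mor H f) (theta M (boxp d m))) thetaE -qm_comp.
by apply: qm_ext => h; rewrite lincompE orbit_map_comp box_morE.
Qed.

(** At d ⊗ (d' ⊗ m) both sides become mu of Q applied to the map h |-> h theta(d' ⊗ m), evaluated at
    d. *)
Lemma theta_mu (M : lmodType (env A)) :
  lincomp (theta M) (bm_mu (box_bimonad C) M) =
  lincomp (lincomp (bm_mu T M) (bm_mor T (theta M : mor (box_bimonad C M) (T M)))) (theta _).
Proof.
apply: box_resext => d; elim/box_ind=> [|s t hs ht|d' m].
- by rewrite [boxp d _]pure0r !raddf0.
- by rewrite [boxp d _]pureDr [LHS]raddfD [RHS]raddfD; congr (_ + _).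
pose R : lmodType (env A) := res (bd_eta C) (box C M); pose t : R := boxp d' m.
transitivity (theta M (d *: (boxp d' m : box C M))).
  by congr (theta M _); exact: (box_counitEd (N := box C M) d t).
rewrite scale_boxp thetaE.
have mor_mu (u : res (bd_eta H) (qo Q (box H R))) :
    lincomp (bm_mu T M) (bm_mor T (theta M : mor (box_bimonad C M) (T M))) u =
    qmu Q (box H M) (qm Q (box_counit (qo Q (box H M))) (qm Q (box_mor H (theta M)) u)) by [].
apply: esym; apply: (etrans (mor_mu _)).
rewrite thetaE -!qm_comp; apply: esym.
transitivity (qm Q (act (bh1 m : box H M)) (cross_mul (d : D) (d' : D))); first by [].
rewrite cross_mulE qmu_nat -!qm_comp; congr (qmu Q _ _); apply: qm_ext => h.
by rewrite !lincompE !orbit_map_comp box_morE box_counitE thetaE.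
Qed.

Lemma theta_eta (M : lmodType (env A)) :
  lincomp (theta M) (bm_eta (box_bimonad C) M) = bm_eta T M.
Proof.
apply: linext => m; rewrite -[LHS]/(theta M (boxp (1 : C) m)) thetaE.
transitivity (qm Q (act (bh1 m : box H M)) (qeta Q Hr (1 : H))); first by [].
by rewrite qeta_nat orbit_map1.
Qed.

Lemma theta_T2 (M N : lmodType (env A)) :
  lincomp (bm_T2 T M N) (theta (btens M N)) =
  lincomp (btmor (theta M) (theta N)) (bm_T2 (box_bimonad C) M N).
Proof.
apply: box_resext2 => d m n.
have [w hw] := bd_sum (bd_Delta (D := C) d).
have hw' := cross_dia_Delta hw.
transitivity (hmor (qm Q (act (bh1 m : box H M))) (qm Q (act (bh1 n : box H N))) (cross_Delta d)).
  transitivity (qT2 Q _ _ (qm Q (box_F2 H M N) (theta _ (boxp d (bpure m n))))); first by [].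
  rewrite thetaE -qm_comp /cross_Delta -qT2_nat -qm_comp; congr (qT2 Q _ _ _).
  apply: qm_ext => h; rewrite !lincompE !orbit_map_comp box_F2E hmorE.
  by rewrite !orbit_map1.
rewrite hw'; transitivity (btmor (theta M) (theta N) (d *: hpure (boxp (1 : C) m) (boxp (1 : C) n))).
  rewrite (hscale_sum _ _ hw) (raddf_sum (hmor _ _)) (raddf_sum (btmor _ _)).
  apply: eq_bigr => p _; rewrite !scale_boxp !mulr1.
  transitivity (hpure (qm Q (act (bh1 m : box H M)) p.1) (qm Q (act (bh1 n : box H N)) p.2)); first exact: hmorE.
  rewrite -!thetaE; symmetry; exact: btmorE.
congr (btmor _ _ _); rewrite -box_F2E -linearZ.
by rewrite scale_boxp mulr1.
Qed.

Lemma theta_T0 : lincomp (bm_T0 T) (theta (regb A)) = bm_T0 (box_bimonad C).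
Proof.
apply: box_resext => d a.
transitivity (qT0 Q (qm Q (box_F0 H) (theta _ (boxp d a)))); first by [].
transitivity (box_F0 C (boxp d a)); last by [].
rewrite box_liftE thetaE -qm_comp.
transitivity (cross_eps (cross_mul (d : D) (cross_unit Q (bd_src H a)))); last by [].
rewrite /cross_eps cross_mul_unit -qm_comp; congr (qT0 Q _); apply: qm_ext => h.
rewrite !lincompE !orbit_map_comp; congr (act _ h).
by rewrite box_liftE1 /reg_eps orbit_mapE htriv_src mulr1.
Qed.

Definition theta_family (M : Bimod A) : mor (box_bimonad C M) (T M) := theta M.
Lemma theta_bimonad_iso : (forall M, bijective (theta M)) -> bimonad_iso theta_family.
Proof.
move=> thb; split; first by move=> M; apply/lmod_is_iso; exact: thb.
split; first exact: theta_nat.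
split; first exact: theta_mu.
split; first exact: theta_eta.
by split; [exact: theta_T2|exact: theta_T0].
Qed.

Lemma cross_bd_Delta (d : D) : bd_Delta (d : C) = cross_dia (cross_Delta d).
Proof. by []. Qed.

Lemma left_canonical_cross (d f : D) :
  left_canonical (pure_op (d : C) (f : C)) = cross_dia (hmor (linid D) (rmul f) (cross_Delta d)).
Proof.
rewrite left_canonical_pure; have [w hw] := bd_sum (bd_Delta (D := C) d).
have -> : linid D = rmul (cross_unit Q 1).
  by apply: linext => x; symmetry; exact: (mulr1 (x : cross_alg Q)).
by rewrite (cross_dia_rmul _ _ (cross_dia_Delta hw)) hw bd_rmul_sum.
Qed.

Lemma qT2_natr (X Y Z : lmodType H) (g : {linear Y -> Z}) q :
  hmor (linid (qo Q X)) (qm Q g) (qT2 Q X Y q) = qT2 Q X Z (qm Q (hmor (linid X) g) q).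
Proof.
rewrite qT2_nat; congr (hmor _ _ _).
by apply: linext => x; rewrite qm_id.
Qed.

(** The factor l is absorbed under Q, where it gives h |-> h_1 ⊗ h_2 l, an instance of the left
    canonical map of H. *)
Lemma left_canonical_cross_unit (d e : D) (l : H) :
  left_canonical (pure_op (d : C) (cross_mul (cross_unit Q l) e : C)) =
  cross_dia (hmor (linid D) (rmul e)
    (qT2 Q Hr Hr (qm Q (lincomp (hmor (linid Hr) (act (l : Hr))) (reg_Delta H)) d))).
Proof.
rewrite left_canonical_cross qm_comp -qT2_natr -[in RHS]lincompE -hmor_comp.
congr (cross_dia (hmor _ _ _)).
apply: linext => x; rewrite [RHS]lincompE -cross_mul_unit !rmulE.
exact: (mulrA (x : cross_alg Q) (cross_unit Q l : cross_alg Q) (e : cross_alg Q)).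
Qed.
End Comparison.

(** * The smash product *)

Section SmashProduct.
Variables (K : fieldType) (A : algType K) (H : bialgebroid A).
Variable B : lax_central_hopf (HMod H).
Notation b := (bh_mod B).
Notation Hr := (H^o : lmodType H).
Notation act := orbit_map.

Lemma bd_tgt_scalar (k : K) : bd_tgt H k%:A = k%:A.
Proof.
rewrite /bd_tgt; have -> : envp 1 (k%:A : A) = k *: (1 : env A).
  by rewrite -envpZ -[RHS]/(envp (k *: 1) 1 * envp 1 1) envpM !mulr1.
by rewrite linearZ rmorph1.
Qed.

Lemma tensor_bimonad_linear (X Y : lmodType H) (k : K) (f g h : {linear X -> Y}) :
  (forall x, h x = (k%:A : H) *: f x + g x) ->
  forall q : htens b X, hmor (linid b) h q =
    (k%:A : H) *: hmor (linid b) f q + hmor (linid b) g q.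
Proof.
move=> e; apply: htens_morph_ext => [s t|s t|c x]; first by rewrite raddfD.
  by rewrite !raddfD ?scalerDr addrACA.
rewrite !hmorE e hpureDr; congr (_ + _).
have := @hscale_eta _ _ _ _ _ 1 (k%:A : A) c (f x).
rewrite bd_src1 scale1r -[X in hpure c (X *: _)]/(bd_tgt H _) bd_tgt_scalar => <-; congr (_ *: _).
by rewrite -bd_tgt_scalar.
Qed.

Definition smash_bimonad : linear_bimonad H :=
  @LinearBimonad K A H (tensor_bimonad B) (tensor_bimonadP B) tensor_bimonad_linear.
Notation Q := smash_bimonad.
Notation D := (cross_bialgebroid Q).

Lemma smash_qm (X Y : lmodType H) (f : {linear X -> Y}) c x :
  qm Q f (hpure c x) = hpure c (f x).
Proof. exact: hmorE. Qed.
Lemma smash_qmu (X : lmodType H) c d x :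
  qmu Q X (hpure c (hpure d x)) = hpure (br_mul B (hpure c d)) x.
Proof. by rewrite -wmulE wmulU. Qed.
Lemma smash_qeta (X : lmodType H) x : qeta Q X x = hpure (br_one B (1 : A)) x.
Proof. by rewrite -woneE woneU. Qed.
Lemma smash_qT2 (X Y : lmodType H) t : qT2 Q X Y t = wT2 B X Y t.
Proof. by rewrite wT2U. Qed.
Lemma smash_qT0 t : qT0 Q t = wT0 B t.
Proof. by rewrite wT0U. Qed.

Section ThetaInverse.
Variable M : lmodType (env A).
(** The inverse of theta is the rebracketing c ⊗ (h ⊗ m) |-> (c ⊗ h) ⊗ m. It respects A^e because
    right multiplication by the unit map of D affects only the H-factor. *)
Let g1 (c : b) (h : H) (m : M) : box D M := boxp (hpure c (h : Hr) : D) m.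
Let g1_bal c : balanced (fun (x : env A) (d : H) => d * bd_eta H x) (fun (x : env A) (m : M) => x *: m) (g1 c).
Proof.
split=> [h h' m|h m m'|x h m]; rewrite /g1.
- by rewrite hpureDr [LHS]boxpDl.
- exact: boxpDr.
rewrite -boxp_bal; congr boxp; symmetry.
rewrite -[LHS]/(cross_mul (hpure c (h : Hr) : qo Q Hr) (cross_unit Q (bd_eta H x))).
by rewrite cross_mul_unit smash_qm.
Qed.
Let g2 (c : b) (t : box H M) : box D M := tlift (g1_bal c) t.
Let g2E c h m : g2 c (boxp h m) = boxp (hpure c (h : Hr) : D) m. Proof. exact: tlift_pure. Qed.
Let g2_bal : bbalanced (fun (c : res (bd_eta H) b) (t : res (bd_eta H) (box H M)) => g2 c t).
Proof.
split=> [c c' t|c t t'|a c t]; last 1 first.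
- elim/box_ind: t => [|t t' ht ht'|h m]; rewrite /g2.
  + by rewrite lact0 !raddf0.
  + by rewrite lactD !raddfD /=; congr (_ + _).
  rewrite -!/(g2 _ _) -[lact a _]/(bd_src H a *: boxp h m) scale_boxp !g2E; congr boxp.
  exact: hpure_bal.
- elim/box_ind: t => [|t t' ht ht'|h m]; rewrite /g2; first by rewrite !raddf0 addr0.
    by rewrite !raddfD /= -!/(g2 _ _) ht ht' addrACA.
  by rewrite -!/(g2 _ _) !g2E hpureDl [LHS]boxpDl.
exact: (raddfD (tlift (g1_bal c))).
Qed.
Let g (t : htens b (box H M)) : box D M := blift g2_bal t.
Let gD : {morph g : t t' / t + t'}. Proof. exact: (raddfD (blift g2_bal)). Qed.
Let gE c h m : g (hpure c (boxp h m)) = boxp (hpure c (h : Hr) : D) m.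
Proof. by rewrite [LHS]blift_pure g2E. Qed.

Lemma smash_thetaE c h m : theta Q M (boxp (hpure c (h : Hr) : D) m) = hpure c (boxp h m).
Proof. by rewrite thetaE smash_qm orbit_mapE scale_boxp mulr1. Qed.

Lemma smash_theta_bij : bijective (theta Q M).
Proof.
exists g.
  elim/box_ind=> [|t t' ht ht'|d m]; first by rewrite raddf0; exact: (raddf0 (blift g2_bal)).
    by rewrite raddfD gD; congr (_ + _).
  move: d; apply: htens_morph_ext => [d d'|d d'|c h].
  - by rewrite [boxp _ m](boxpDl (H := D) d d') raddfD gD.
  - exact: boxpDl.
  by rewrite [X in g X]smash_thetaE gE.
apply: htens_morph_ext => [t t'|t t'|c t]; [by rewrite gD raddfD|by []|].
elim/box_ind: t => [|t t' ht ht'|h m].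
- by rewrite hpure0r -[RHS](raddf0 (theta Q M)); congr (theta Q M _); exact: (raddf0 (blift g2_bal)).
- by rewrite hpureDr gD raddfD; congr (_ + _).
by rewrite gE smash_thetaE.
Qed.
End ThetaInverse.
End SmashProduct.

Lemma morph_sum (U V : zmodType) (F : U -> V) (I : Type) (s : seq I) (f : I -> U) :
  {morph F : x y / x + y} -> F (\sum_(i <- s) f i) = \sum_(i <- s) F (f i).
Proof.
move=> FD; have F0 : F 0 = 0 by apply: (@addrI _ (F 0)); rewrite -FD !addr0.
exact: (big_morph F FD F0).
Qed.

(** * The smash product formulas and the inverse of beta *)

Section SmashProduct.
Variables (K : fieldType) (A : algType K) (H : bialgebroid A).
Variable B : lax_central_hopf (HMod H).
Notation b := (bh_mod B).
Notation Hr := (H^o : lmodType H).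
Notation act := orbit_map.

Notation Q := (smash_bimonad B).
Notation D := (cross_bialgebroid Q).

(** Naturality of the half-braiding along the H-linear map H -> M with 1 |-> m: the coaction
    determines all of tau. *)
Lemma tau_act (M : lmodType H) c (m : M) (w : seq (H * b)) :
  bh_coact c = \sum_(q <- w) hpure (q.1 : Hr) q.2 ->
  br_tau B M (hpure c m) = \sum_(q <- w) hpure (q.1 *: m) q.2.
Proof.
move=> hw; rewrite -[in LHS](orbit_map1 m) tau_nat -[br_tau B Hr _]/(bh_coact c) hw.
rewrite morph_sum; last by morph_add.
by apply: eq_bigr => q _; rewrite hmE orbit_mapE.
Qed.

Section Sums.
Variables (X Y : lmodType H) (c : b) (s : seq (b * b)) (t : b -> seq (H * b)).
Hypotheses (hs : bh_Delta c = \sum_(p <- s) hpure p.1 p.2)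
  (ht : forall d, bh_coact d = \sum_(q <- t d) hpure (q.1 : Hr) q.2).

Lemma wT2_sum x y : wT2 B X Y (hpure c (hpure x y)) =
  \sum_(p <- s) \sum_(q <- t p.2) hpure (hpure p.1 (q.1 *: x)) (hpure q.2 y).
Proof.
rewrite wT2E wcopE -[br_cop B c]/(bh_Delta c) hs.
rewrite (morph_sum (F := fun u => asr b X _ (hm _ _ (asl b b _ (hpure u _))))); last by morph_add.
apply: eq_bigr => p _; rewrite aslE hmE passE (tau_act _ (ht p.2)).
rewrite (morph_sum (F := fun u => asr b X _ (hpure _ (asl X b _ (hpure u _))))); last by morph_add.
by apply: eq_bigr => q _; rewrite aslE asrE.
Qed.

Lemma wfusion_inv_sum x d y : wfusion_inv B X Y (hpure (hpure c x) (hpure d y)) =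
  \sum_(p <- s) \sum_(q <- t p.2)
    hpure p.1 (hpure (q.1 *: x) (hpure (br_mul B (hpure (bh_S q.2) d)) y)).
Proof.
rewrite wfusion_invE aslE wcopE -[br_cop B c]/(bh_Delta c) hs.
rewrite (morph_sum (F := fun u => hm _ _ (hm _ _ (asl b b _ (hpure u _))))); last by morph_add.
apply: eq_bigr => p _; rewrite aslE !hmE passE (tau_act _ (ht p.2)).
rewrite (morph_sum (F := fun u => hpure _ (hm _ _ (asl X b _ (hpure u _))))); last by morph_add.
by apply: eq_bigr => q _; rewrite aslE hmE lincompE wantE wmulE.
Qed.
End Sums.

Lemma smash_mul c d h k (w : seq (H * H)) : bd_Delta h = \sum_(r <- w) bd_pure r.1 r.2 ->
  cross_mul (Q := Q) (hpure c (h : Hr)) (hpure d (k : Hr)) =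
  \sum_(r <- w) hpure (bh_mul c (r.1 *: d)) (r.2 * k : Hr).
Proof.
move=> hw; rewrite cross_mulE smash_qm orbit_mapE (hscale_sum _ _ hw).
rewrite (morph_sum (F := fun u => qmu Q Hr (hpure c u))); last by move=> u v; rewrite hpureDr raddfD.
by apply: eq_bigr => r _; rewrite smash_qmu.
Qed.

Lemma smash_Delta c h (w : seq (H * H)) s t :
  bh_Delta c = \sum_(p <- s) hpure p.1 p.2 ->
  (forall d, bh_coact d = \sum_(q <- t d) hpure (q.1 : Hr) q.2) ->
  bd_Delta h = \sum_(r <- w) bd_pure r.1 r.2 ->
  cross_Delta (Q := Q) (hpure c (h : Hr)) =
  \sum_(p <- s) \sum_(q <- t p.2) \sum_(r <- w)
    hpure (hpure p.1 (q.1 * r.1 : Hr)) (hpure q.2 (r.2 : Hr)).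
Proof.
move=> hs ht hw; rewrite /cross_Delta smash_qm smash_qT2 orbit_mapE (hscale_sum _ _ hw).
rewrite (morph_sum (F := fun u => wT2 B Hr Hr (hpure c u))); last by morph_add.
under eq_bigr do rewrite (wT2_sum hs ht).
rewrite exchange_big; apply: eq_bigr => p _; rewrite exchange_big; apply: eq_bigr => q _.
apply: eq_bigr => r _; congr (hpure (hpure _ _) (hpure _ _)); last exact: mulr1.
by rewrite scalerA; exact: mulr1.
Qed.

Lemma smash_eps c h : cross_eps (Q := Q) (hpure c (h : Hr)) = bh_eps c * bd_eps h.
Proof.
rewrite /cross_eps smash_qm smash_qT0 /wT0 wcouE orbit_mapE htriv_src; congr (_ * _).
by rewrite htrivE bd_src1 mulr1.
Qed.

Lemma smash_eta a1 a2 a3 a4 c h :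
  cross_eta Q (envp a1 a2) * (hpure c (h : Hr) : cross_alg Q) * cross_eta Q (envp a3 a4) =
  hpure (bd_src H a1 *: c) (bd_tgt H a2 * h * bd_src H a3 * bd_tgt H a4 : Hr).
Proof.
have -> : cross_eta Q (envp a1 a2) * (hpure c (h : Hr) : cross_alg Q) =
    (bd_eta H (envp a1 a2) *: hpure c (h : Hr) : cross_alg Q) by exact: cross_unit_mul.
rewrite hscale_eta -[LHS]/(cross_mul (Q := Q) _ (cross_unit Q _)) cross_mul_unit smash_qm.
congr hpure; rewrite orbit_mapE -[LHS]/(bd_tgt H a2 * h * bd_eta H (envp a3 a4)).
by rewrite bd_etaE mulrA.
Qed.

Lemma hact2_regular (l : H) z : hact2 (1 : Hr) (l : Hr) z = bd_rmul 1 l z.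
Proof. by have [w ->] := bd_sum z; rewrite hact2_sum bd_rmul_sum. Qed.

(** The pair (k, l) enters only through its image under the left canonical map of H, so summing over
    a preimage of x <> 1 leaves x ⊗ 1. *)
Lemma smash_left_canonical c k l e :
  left_canonical (pure_op (hpure c (k : Hr) : D) (cross_mul (cross_unit Q l) e : D)) =
  cross_dia (hmor (linid _) (rmul e) (qT2 Q Hr Hr (hpure c (left_canonical (pure_op k l) : htens Hr Hr)))).
Proof.
apply: (etrans (left_canonical_cross_unit (Q := Q) (hpure c (k : Hr)) e l)).
have E : lincomp (hmor (linid Hr) (act (l : Hr))) (reg_Delta H) k =
    (left_canonical (pure_op k l) : htens Hr Hr).
  rewrite lincompE orbit_map_comp hmorE orbit_map1 orbit_mapE hscale_pure.
  by rewrite hact2_regular -left_canonical_pure.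
congr (cross_dia (hmor _ _ (qT2 _ _ _ _))).
by rewrite smash_qm E.
Qed.

Lemma smash_fusion d (k : H) e :
  hmor (linid _) (rmul e) (qT2 Q Hr Hr (hpure d (hpure (k : Hr) (1 : Hr)))) =
  wfusion B Hr Hr (hpure d (hpure (k : Hr) e)).
Proof.
rewrite wfusionE -smash_qT2 hmU.
have -> : hpure d (hpure (k : Hr) e) = qm Q (hmor (linid Hr) (act e)) (hpure d (hpure (k : Hr) (1 : Hr))).
  by rewrite smash_qm hmorE orbit_map1.
rewrite qT2_nat -[RHS]lincompE -hmor_comp; congr (hmor _ _ _).
  by apply: linext => x; rewrite lincompE qm_id.
by apply: linext => x; rewrite lincompE /rmul lincompE wmulU.
Qed.

Lemma smash_one : hpure (bh_one B) (1 : Hr) = 1 :> cross_alg Q.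
Proof. by symmetry; exact: smash_qeta. Qed.

(** The formula is tested by applying beta. For A = K, h = 1 and b primitive with coaction g ⊗ b, g
    grouplike, the inverse evaluates to b ⊗ 1 - g ⊗ g^{-1} b, where g^{-1} b is a product in D. *)
Lemma smash_left_canonical_inverse c h s t (u : H -> seq (H * H)) :
  bh_Delta c = \sum_(p <- s) hpure p.1 p.2 ->
  (forall d, bh_coact d = \sum_(q <- t d) hpure (q.1 : Hr) q.2) ->
  (forall x, left_canonical (\sum_(r <- u x) pure_op r.1 r.2) = bd_pure x 1) ->
  \sum_(p <- s) \sum_(q <- t p.2) \sum_(r <- u (q.1 * h))
    left_canonical (pure_op (hpure p.1 (r.1 : Hr) : D)
      (cross_mul (Q := Q) (hpure (bh_one B) (r.2 : Hr)) (hpure (bh_S q.2) (1 : Hr)) : D)) =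
  bd_pure (hpure c (h : Hr) : D) 1.
Proof.
move=> hs ht hu.
(* Summing over [u k] cancels the canonical map of H, and what is left is the fusion operator of B ⊗
   - at k and e. *)
have F (d : b) (k : H) (e : qo Q Hr) :
    \sum_(r <- u k) left_canonical (pure_op (hpure d (r.1 : Hr) : D)
      (cross_mul (Q := Q) (hpure (bh_one B) (r.2 : Hr)) e : D)) =
    cross_dia (Q := Q) (wfusion B Hr Hr (hpure d (hpure (k : Hr) e))).
  have -> : cross_dia (Q := Q) (wfusion B Hr Hr (hpure d (hpure (k : Hr) e))) =
      cross_dia (hmor (linid _) (rmul e) (qT2 Q Hr Hr (hpure d (bd_pure k 1 : htens Hr Hr)))).
    by rewrite -smash_fusion.
  have -> : (bd_pure k 1 : htens Hr Hr) = \sum_(r <- u k) (left_canonical (pure_op r.1 r.2) : htens Hr Hr).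
    by rewrite -[LHS]hu; exact: raddf_sum.
  rewrite (morph_sum (F := fun z : htens Hr Hr =>
     cross_dia (hmor (linid _) (rmul e) (qT2 Q Hr Hr (hpure d z))))); last first.
    have addF : {morph (fun z : htens Hr Hr => hmor (linid _) (rmul e) (qT2 Q Hr Hr (hpure d z))) :
       v w / v + w} by morph_add.
    move=> v w; exact: (etrans (congr1 (@cross_dia _ _ _ Q) (addF v w)) (cross_diaD _ _)).
  apply: eq_bigr => r _.
  have -> : hpure (bh_one B) (r.2 : Hr) = cross_unit Q r.2 by symmetry; exact: smash_qeta.
  exact: smash_left_canonical.
transitivity (\sum_(p <- s) \sum_(q <- t p.2)
    (cross_dia (Q := Q) (wfusion B Hr Hr (hpure p.1 (hpure (q.1 * h : Hr) (hpure (bh_S q.2) (1 : Hr))))) : tens_dia D)).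
  apply: eq_bigr => p _. apply: eq_bigr => q _. exact: (F p.1 (q.1 * h) (hpure (bh_S q.2) (1 : Hr))).
(* Up to multiplying the antipode by 1_B on the right, the arguments sum to [wfusion_inv] at (c ⊗ h)
   ⊗ (1_B ⊗ 1). *)
have E : \sum_(p <- s) \sum_(q <- t p.2)
      wfusion B Hr Hr (hpure p.1 (hpure (q.1 * h : Hr) (hpure (bh_S q.2) (1 : Hr)))) =
    hpure (hpure c (h : Hr)) (hpure (bh_one B) (1 : Hr)).
  transitivity (wfusion B Hr Hr (wfusion_inv B Hr Hr
    (hpure (hpure c (h : Hr)) (hpure (bh_one B) (1 : Hr))))); last exact: wfusion_invK.
  rewrite (wfusion_inv_sum hs ht) (raddf_sum (wfusion B Hr Hr)); apply: eq_bigr => p _.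
  rewrite (raddf_sum (wfusion B Hr Hr)); apply: eq_bigr => q _.
  exact: (congr1 (fun x => wfusion B Hr Hr (hpure p.1 (hpure (q.1 * h : Hr) (hpure x (1 : Hr)))))
    (esym (br_mulr1 (bh_S q.2)))).
transitivity (cross_dia (Q := Q) (\sum_(p <- s) \sum_(q <- t p.2)
    wfusion B Hr Hr (hpure p.1 (hpure (q.1 * h : Hr) (hpure (bh_S q.2) (1 : Hr)))))).
  symmetry; apply: (etrans (cross_dia_sum (Q := Q) _ _)); apply: eq_bigr => p _.
  exact: (cross_dia_sum (Q := Q)).
apply: (etrans (congr1 (@cross_dia _ _ _ Q) E)); apply: (etrans (cross_diaE _ _)).
by congr dpure; exact: smash_one.
Qed.
End SmashProduct.

(** * Invertible fusion operators for the composed monad *)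

Section FusionIso.
Variables (K : fieldType) (A : algType K) (H : bialgebroid A) (Q : bimonad_data (HMod H)).
Hypothesis hQ : is_bimonad Q.
Notation a := (free_adjunction H).

Lemma res_tens_is_iso (M N : lmodType H) : is_iso (adj_U2 a M N).
Proof. by exists (res_tensi M N); split; exact: linext. Qed.

Lemma cross_left_fusion_is_iso :
  hopf_algebroid H -> (forall X Y, is_iso (left_fusion Q X Y)) ->
  forall X Y, is_iso (left_fusion (cross_product a Q) X Y).
Proof.
move=> [[LCi LCK LCiK] _] hl X Y; rewrite (cross_product_left_fusion (free_adjunctionP H) hQ).
apply: is_iso_comp; first exact: res_tens_is_iso.
apply: (functorial_is_iso (res_comonoidal_functor H).1); apply: is_iso_comp; first exact: hl.
by apply: (functorial_is_iso (bimonad_comonoidal_functor hQ).1); exact: hopf_l_is_iso LCK LCiK.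
Qed.

Lemma cross_right_fusion_is_iso :
  hopf_algebroid H -> (forall X Y, is_iso (right_fusion Q X Y)) ->
  forall X Y, is_iso (right_fusion (cross_product a Q) X Y).
Proof.
move=> [_ [RCi RCK RCiK]] hr X Y; rewrite (cross_product_right_fusion (free_adjunctionP H) hQ).
apply: is_iso_comp; first exact: res_tens_is_iso.
apply: (functorial_is_iso (res_comonoidal_functor H).1); apply: is_iso_comp; first exact: hr.
by apply: (functorial_is_iso (bimonad_comonoidal_functor hQ).1); exact: hopf_r_is_iso RCK RCiK.
Qed.
End FusionIso.

Section SmashCarrier.
Variables (K : fieldType) (A : algType K) (H : bialgebroid A).
Variable B : lax_central_hopf (HMod H).
Notation D := (cross_bialgebroid (smash_bimonad B)).

(** The identity: Q(H) for Q = B ⊗ - has B ⊗ H over A as its underlying group. *)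
Definition smash_map (x : smash_carrier B) : D := x.
Let smash_map_zmod : zmod_morphism smash_map. Proof. by []. Qed.
HB.instance Definition _ := GRing.isZmodMorphism.Build (smash_carrier B) D smash_map smash_map_zmod.
End SmashCarrier.

Theorem mainTheorem8 (K : fieldType) (A : algType K) (H : bialgebroid A)
    (HopfH : hopf_algebroid H) (B : lax_central_hopf (HMod H)) :
  let T := cross_product (free_adjunction H) (tensor_bimonad B) in
  exists (D : bialgebroid A) (phi : {additive smash_carrier B -> D}),
    (* D is a bialgebroid structure on B (x)_A H, identified with D by phi *)
    bijective phi /\
    (forall (a1 a2 a3 a4 : A) (b : bh_mod B) (h : H),
       bd_eta D (envp a1 a2) * phi (smash b h) * bd_eta D (envp a3 a4) =
       phi (smash (bd_src H a1 *: b) (bd_tgt H a2 * h * bd_src H a3 * bd_tgt H a4))) /\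
    (1 : D) = phi (smash (bh_one B) 1) /\
    (forall (b b' : bh_mod B) (h h' : H) (w : seq (H * H)),
       bd_Delta h = \sum_(r <- w) bd_pure r.1 r.2 ->
       phi (smash b h) * phi (smash b' h') =
       \sum_(r <- w) phi (smash (bh_mul b (r.1 *: b')) (r.2 * h'))) /\
    (forall (b : bh_mod B) (h : H) (s : seq (bh_mod B * bh_mod B))
        (t : bh_mod B -> seq (H * bh_mod B)) (w : seq (H * H)),
       bh_Delta b = \sum_(p <- s) hpure p.1 p.2 ->
       (forall c, bh_coact c = \sum_(q <- t c) hpure (q.1 : H^o) q.2) ->
       bd_Delta h = \sum_(r <- w) bd_pure r.1 r.2 ->
       bd_Delta (phi (smash b h)) =
       \sum_(p <- s) \sum_(q <- t p.2) \sum_(r <- w)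
         bd_pure (phi (smash p.1 (q.1 * r.1))) (phi (smash q.2 r.2))) /\
    (forall (b : bh_mod B) (h : H),
       bd_eps (phi (smash b h)) = bh_eps b * bd_eps h) /\
    (* the composed monad is a bimonad, and it is the one given by D *)
    left_hopf_monad T /\
    (exists theta : forall M : Bimod A, mor (box_bimonad D M) (T M),
       bimonad_iso theta /\
       forall (M : lmodType (env A)) (b : bh_mod B) (h : H) (m : M),
         (theta M : {linear res (bd_eta D) (box D M) ->
                            res (bd_eta H) (htens (bh_mod B) (box H M))})
           (boxp (phi (smash b h)) m) = hpure b (boxp h m)) /\
    (* the inverse of the left canonical map of D *)
    (exists beta_inv : tens_dia D -> tens_op D,
       cancel (@left_canonical K A D) beta_inv /\
       cancel beta_inv (@left_canonical K A D) /\
       forall (b : bh_mod B) (h : H) (s : seq (bh_mod B * bh_mod B))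
         (t : bh_mod B -> seq (H * bh_mod B)) (u : H -> seq (H * H)),
         bh_Delta b = \sum_(p <- s) hpure p.1 p.2 ->
         (forall c, bh_coact c = \sum_(q <- t c) hpure (q.1 : H^o) q.2) ->
         (forall x, left_canonical (\sum_(r <- u x) pure_op r.1 r.2) = bd_pure x 1) ->
         beta_inv (bd_pure (phi (smash b h)) 1) =
         \sum_(p <- s) \sum_(q <- t p.2) \sum_(r <- u (q.1 * h))
           pure_op (phi (smash p.1 r.1))
                   (phi (smash (bh_one B) r.2) * phi (smash (bh_S q.2) 1))) /\
    (* B (x)_A - is a Hopf monad on H-modules *)
    (hopf_monad (tensor_bimonad B) -> hopf_monad T /\ hopf_algebroid D).
Proof.
move=> T; exists (cross_bialgebroid (smash_bimonad B)), (@smash_map K A H B).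
set D := cross_bialgebroid _.
have hQ := tensor_bimonadP B.
have hT : is_bimonad T := cross_product_bimonad (free_adjunctionP H) hQ.
have hD : is_bimonad (box_bimonad D) := cross_product_bimonad (free_adjunctionP D) (id_bimonadP _).
have hth := theta_bimonad_iso (smash_theta_bij B).
have TL : forall X Y, is_iso (left_fusion T X Y).
  exact: (cross_left_fusion_is_iso hQ HopfH (tensor_bimonad_left_fusion B)).
(* Only the fusion operator at the pair (A^e, A^e) is used, carried from T to D [x] - by theta. *)
have LD : bijective (@left_canonical K A D).
  by apply: left_canonical_bij; apply: (bimonad_iso_left_fusion hD hT hth).
split; first by exists id.
split; first by move=> *; exact: smash_eta.
split; first by symmetry; exact: smash_one.
split; first by move=> *; exact: smash_mul.
split.
  move=> b h s t w hs ht hw.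
  apply: (etrans (cross_bd_Delta _)).
  apply: (etrans (congr1 (@cross_dia _ _ _ (smash_bimonad B)) (smash_Delta hs ht hw))).
  rewrite (cross_dia_sum (Q := smash_bimonad B)); apply: eq_bigr => p _.
  apply: (etrans (cross_dia_sum (Q := smash_bimonad B) _ _)); apply: eq_bigr => q _.
  apply: (etrans (cross_dia_sum (Q := smash_bimonad B) _ _)); apply: eq_bigr => r _.
  exact: (cross_diaE (Q := smash_bimonad B)).
split; first by move=> b h; exact: smash_eps.
split; first by [].
split.
  exists (theta_family (smash_bimonad B)); split; first exact: hth.
  by move=> M b h m; exact: smash_thetaE.
split.
  have [g gK Kg] := LD; exists g.
  split; first exact: gK.
  split; first exact: Kg.
  (* Injectivity of beta lets the formula be compared after applying it, so the abstract inverse [g]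
     is never unfolded. *)
  move=> b h s t u hs ht hu; apply: (can_inj gK).
  apply: (etrans (Kg _)).
  apply: (etrans (esym (smash_left_canonical_inverse h hs ht hu))).
  symmetry.
  apply: (etrans (raddf_sum (@left_canonical K A D) _ _ _)); apply: eq_bigr => p _.
  apply: (etrans (raddf_sum (@left_canonical K A D) _ _ _)); apply: eq_bigr => q _.
  apply: (etrans (raddf_sum (@left_canonical K A D) _ _ _)).
  apply: eq_bigr => r _.
  by congr (left_canonical (pure_op _ _)).
(* The hypothesis on B ⊗ - supplies its right fusion operators; the right canonical map of H does
   the rest. *)
move=> [_ _ hr]; have TR : forall X Y, is_iso (right_fusion T X Y).
  exact: (cross_right_fusion_is_iso hQ HopfH hr).
split; first by split.
split; first exact: LD.
by apply: right_canonical_bij; apply: (bimonad_iso_right_fusion hD hT hth); exact: TR.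
Qed.
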